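(* Let $f(z)=\sum_{n\ge0} a_n z^{-n}\in\mathbb{C}[[z^{-1}]]$ be a Gevrey-1 formal series with Borel transform $\widetilde f(\zeta)=\sum_{n\ge1} \frac{a_n\zeta^{n-1}}{(n-1)!}$. Let $\lambda>0$ and assume that $\widetilde f$ extends holomorphically to $\Delta_\lambda$ and that there exist $A>0$, $B>0$ with $|\widetilde f(\zeta)|\le A e^{B|\zeta|}$ for all $\zeta\in\Delta_\lambda$. Put $a_n^{(\lambda)}=\lambda^{n-1}a_n$ and, for $n\ge0$, $$b_n^{(\lambda)}=\frac{1}{n!}\sum_{k=1}^{n+1}(-1)^{n-k+1}\mathfrak{s}(n,k-1)\,a_k^{(\lambda)}.$$ Then: (i) the factorial series $a_0+\lambda\sum_{n=0}^{+\infty}\frac{\Gamma(\lambda z)\Gamma(n+1)b_n^{(\lambda)}}{\Gamma(\lambda z+n+1)}$ converges absolutely for $\Re(z)>\max(B,1/\lambda)$, and its sum equals $\mathrm{S}_0 f(z)$ there; (ii) for every integer $N\ge0$ and every $z$ with $\Re(z)>B$, $$\Big|\mathrm{S}_0f(z)-\Big(a_0+\lambda\sum_{n=0}^{N}\frac{\Gamma(\lambda z)\Gamma(n+1)b_n^{(\lambda)}}{\Gamma(\lambda z+n+1)}\Big)\Big|\le R_{fact}(\lambda,A,B,N,z),$$ where $$R_{fact}(\lambda,A,B,N,z)=\frac{A}{(\lambda B)^{\lambda B}}\,\frac{(N+\lambda B+1)^{N+\lambda B+1}}{(N+1)^N}\left|\frac{\Gamma(\lambda z)\Gamma(N+1)}{\Gamma(\lambda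 z+N+1)(\Re(z)-B)}\right|.$$
   Context: $\Delta$ denotes the image of the open disc $D(1,1)=\{s:|s-1|<1\}$ under $s\mapsto-\ln s$ (principal logarithm), and $\Delta_\lambda=\{\lambda\zeta:\zeta\in\Delta\}$. A series $\sum a_n z^{-n}$ is Gevrey-1 if $|a_n|\le CK^n n!$ for some constants. The Borel sum is $\mathrm{S}_0 f(z)=a_0+\int_0^{+\infty}\widetilde f(\zeta)e^{-z\zeta}\,d\zeta$ ($\Re z>B$). Stirling numbers of the first kind: $\prod_{k=0}^{n-1}(x-k)=\sum_{k=0}^n\mathfrak{s}(n,k)x^k$. *)

(* Defs.v *)
From Stdlib Require Import Reals ZArith List.
From Coquelicot Require Import Coquelicot.
Open Scope R_scope.

Definition Cexp (z : C) : C :=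
  (exp (Re z) * cos (Im z), exp (Re z) * sin (Im z)).

Definition Carg (s : C) : R :=
  let x := Re s in let y := Im s in
  if Rlt_dec 0 x then atan (y / x)
  else if Rlt_dec x 0 then
         (if Rle_dec 0 y then atan (y / x) + PI else atan (y / x) - PI)
  else if Rlt_dec 0 y then PI / 2
  else if Rlt_dec y 0 then - (PI / 2) else 0.

Definition Clog (s : C) : C := (ln (Cmod s), Carg s).

Definition Delta (zeta : C) : Prop :=
  exists s : C, Cmod (s - 1)%C < 1 /\ zeta = Copp (Clog s).

Definition Delta_lam (lam : R) (zeta : C) : Prop :=
  exists xi : C, Delta xi /\ zeta = (RtoC lam * xi)%C.

Definition Gevrey1 (a : nat -> C) : Prop :=
  exists Cc K : R, forall n : nat, Cmod (a n) <= Cc * K ^ n * INR (fact n).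

(** Borel transform: tilde f (zeta) = sum_{n>=1} a_n zeta^(n-1)/(n-1)!  (reindexed) *)
Definition borel_term (a : nat -> C) (zeta : C) (n : nat) : C :=
  (a (S n) * Cpow zeta n / RtoC (INR (fact n)))%C.

(** Euler's Gamma function  Gamma(w) = int_0^oo t^(w-1) e^(-t) dt,
    (improper Riemann integral; used only for Re w > 0, where it converges). *)
Definition Cgamma (w : C) : C :=
  @RInt_gen C_R_CompleteNormedModule
    (fun t : R => (Cexp ((w - 1) * RtoC (ln t)) * RtoC (exp (- t)))%C)
    (at_right 0) (Rbar_locally p_infty).

(** Stirling numbers of the first kind (signed), as the coefficients of
    prod_{k=0}^{n-1} (x - k) = sum_k s(n,k) x^k.  Polynomials are coefficient
    lists (lowest degree first). *)
Fixpoint padd (p q : list Z) : list Z :=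
  match p, q with
  | nil, _ => q
  | _, nil => p
  | x :: p', y :: q' => (x + y)%Z :: padd p' q'
  end.

Definition mul_X_minus (c : Z) (p : list Z) : list Z :=
  padd (0%Z :: p) (map (fun x => (- c * x)%Z) p).

Fixpoint falling_poly (n : nat) : list Z :=
  match n with
  | O => 1%Z :: nil
  | S m => mul_X_minus (Z.of_nat m) (falling_poly m)
  end.

Definition stirling1 (n k : nat) : Z := nth k (falling_poly n) 0%Z.

Example stirling1_3 : map (stirling1 3) (seq 0 4) = (0 :: 2 :: -3 :: 1 :: nil)%Z.
Proof. reflexivity. Qed.
Example stirling1_4 : map (stirling1 4) (seq 0 5) = (0 :: -6 :: 11 :: -6 :: 1 :: nil)%Z.
Proof. reflexivity. Qed.

Fixpoint csum (f : nat -> C) (N : nat) : C :=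
  match N with
  | O => f O
  | S m => (csum f m + f (S m))%C
  end.

(** b_n^(lambda) = 1/n! sum_{k=1}^{n+1} (-1)^(n-k+1) s(n,k-1) lambda^(k-1) a_k ,
    reindexed with j = k-1 in 0..n: (-1)^(n-j) s(n,j) lambda^j a_(j+1) *)
Definition b_lam (lam : R) (a : nat -> C) (n : nat) : C :=
  (/ RtoC (INR (fact n)) *
   csum (fun j => RtoC ((-1) ^ (n - j) * IZR (stirling1 n j) * lam ^ j) * a (S j)) n)%C.

Definition fact_term (lam : R) (a : nat -> C) (z : C) (n : nat) : C :=
  (RtoC lam * (Cgamma (RtoC lam * z) * Cgamma (RtoC (INR (S n))) * b_lam lam a n)
     / Cgamma (RtoC lam * z + RtoC (INR (S n))))%C.

Definition laplace_integrand (F : C -> C) (z : C) (t : R) : C :=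
  (F (RtoC t) * Cexp (- (z * RtoC t)))%C.

Definition borel_sum (a : nat -> C) (F : C -> C) (z : C) : C :=
  (a O + @RInt_gen C_R_CompleteNormedModule (laplace_integrand F z)
                    (at_point 0) (Rbar_locally p_infty))%C.

Definition R_fact (lam A B : R) (N : nat) (z : C) : R :=
  A / Rpower (lam * B) (lam * B)
  * (Rpower (INR N + lam * B + 1) (INR N + lam * B + 1) / (INR N + 1) ^ N)
  * Cmod (Cgamma (RtoC lam * z) * Cgamma (RtoC (INR (S N)))
          / (Cgamma (RtoC lam * z + RtoC (INR (S N))) * RtoC (Re z - B)))%C.

(* Main.v *)
Require Import Defs.
From Stdlib Require Import Reals Lra Lia ZArith List ClassicalEpsilon.
From Coquelicot Require Import Coquelicot.
Open Scope R_scope.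

(* Write [s = 1 - v] with [v] in the unit disc. The function [G(v) = F(- lam * ln (1 - v))] has the
   [b_lam a n] as Taylor coefficients, since those of the powers of [- ln (1 - v)] are Stirling numbers.
   Let [J(v)] be [(1 - v)^(- lam z)] times the integral of [F(y) exp(- z y)] over the horizontal ray
   issued from [- lam * ln (1 - v)]. Then [J(0)] is the Laplace integral and
   [(1 - v) J' = lam z J - lam G], that is, [lam b_n = (lam z + n) J_n - (n + 1) J_(n+1)]: the factorial
   series telescopes, and its remainder is [(N + 1)! J_(N+1) / (lam z)_(N+1)], with a rising factorial in
   the denominator. On the disc [|G|] and [|J|] are at most a constant times
   [exp(lam B |ln (1 - v)|)]. Cauchy's inequality on the best circle gives the explicit remainder; taking
   means over the circle instead of suprema gains one power of [n], which yields the convergence. *)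

(** * Complex differentiation *)

(* Coquelicot states equalities in the carriers of its algebraic structures, which [ring] does not
   see through. *)
Ltac C_ring := cbv beta; match goal with |- @eq _ ?x ?y => change (@eq C x y); ring end.
Ltac C_field := cbv beta; match goal with |- @eq _ ?x ?y => change (@eq C x y); field end.

Notation CRInt := (@RInt C_R_CompleteNormedModule).

Lemma locally_Cmod (z : C) (P : C -> Prop) :
  locally z P <-> exists d, 0 < d /\ forall y, Cmod (y - z)%C < d -> P y.
Proof.
  rewrite locally_C. split.
  - intros [d Hd]. exists d. split; [apply cond_pos | exact Hd].
  - intros (d & Hd & H). exists (mkposreal d Hd). exact H.
Qed.

Lemma filterlim_Cmod {T : Type} {Fi : (T -> Prop) -> Prop} {FF : Filter Fi} (f : T -> C) (l : C) :
  filterlim f Fi (locally l) <-> forall e, 0 < e -> Fi (fun x => Cmod (f x - l)%C < e).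
Proof.
  split.
  - intros H e He. apply (H (fun y => Cmod (y - l)%C < e)).
    apply locally_Cmod. now exists e.
  - intros H P HP. apply locally_Cmod in HP. destruct HP as (d & Hd & HP).
    unfold filtermap. eapply filter_imp; [|exact (H d Hd)]. intros x. apply HP.
Qed.

Lemma is_derive_Cmod (f : C -> C) (z l : C) :
  is_derive f z l <->
  forall e, 0 < e -> locally z (fun y => Cmod (f y - f z - l * (y - z))%C <= e * Cmod (y - z)%C).
Proof.
  assert (Ediff : forall y, minus (minus (f y) (f z)) (scal (minus y z) l) = (f y - f z - l * (y - z))%C).
  { intros y. change ((f y - f z - (y - z) * l)%C = (f y - f z - l * (y - z))%C). ring. }
  split.
  - intros [_ H] e He. apply locally_C.
    generalize (H z (fun P K => K) (mkposreal e He)). apply filter_imp.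
    intros y. rewrite Ediff. exact (fun K => K).
  - intros H. split; [apply is_linear_scal_l|]. intros y Hy.
    apply (is_filter_lim_locally_unique (V := AbsRing_NormedModule C_AbsRing)) in Hy. subst y.
    intros e. generalize (proj1 (locally_C _ _) (H e (cond_pos e))). apply filter_imp.
    intros y. rewrite Ediff. exact (fun K => K).
Qed.

Lemma is_derive_C_filterdiff (f : C -> C) (z l : C) :
  is_derive f z l <->
  filterdiff (U := C_R_NormedModule) (V := C_R_NormedModule) f (locally z) (fun h => (l * h)%C).
Proof.
  rewrite is_derive_Cmod. split.
  - intros H. split.
    + constructor.
      * intros x y. apply Cmult_plus_distr_l.
      * intros k x. rewrite !scal_R_Cmult. C_ring.
      * exists (Cmod l + 1). pose proof (Cmod_ge_0 l). split; [lra|]. intros x.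
        rewrite <- !Cmod_norm, Cmod_mult. pose proof (Cmod_ge_0 x). nra.
    + intros y Hy. apply (is_filter_lim_locally_unique (V := C_R_NormedModule)) in Hy. subst y.
      intros e. generalize (H e (cond_pos e)). apply filter_imp. intros y.
      rewrite <- !Cmod_norm. exact (fun K => K).
  - intros [_ H] e He. generalize (H z (fun P K => K) (mkposreal e He)). apply filter_imp.
    intros y. rewrite <- !Cmod_norm. exact (fun K => K).
Qed.

Lemma is_derive_curve_comp (f : C -> C) (g : R -> C) (t : R) (l dg : C) :
  is_derive f (g t) l -> is_derive g t dg -> is_derive (fun u => f (g u)) t (l * dg)%C.
Proof.
  intros Hf Hg. apply is_derive_C_filterdiff in Hf.
  apply (filterdiff_ext_lin (U := R_NormedModule) (V := C_R_NormedModule) _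
    (fun h : R => l * scal (V := C_R_NormedModule) h dg)%C).
  - exact (filterdiff_comp' g f t _ _ Hg Hf).
  - intros h. rewrite !scal_R_Cmult. C_ring.
Qed.

Lemma filterdiff_pair {K : AbsRing} {T U V : NormedModule K} (f : T -> U) (g : T -> V) (x : T) lf lg :
  filterdiff f (locally x) lf -> filterdiff g (locally x) lg ->
  filterdiff (fun y => (f y, g y)) (locally x) (fun y => (lf y, lg y)).
Proof.
  intros Hf Hg. apply (filterdiff_comp'_2 _ _ pair _ _ _ pair Hf Hg).
  eapply filterdiff_ext; [|eapply filterdiff_ext_lin; [apply filterdiff_id|]]; now intros [].
Qed.

Lemma is_derive_Cauchy_Riemann (u v p q : R -> R -> R) (x y : R) :
  locally (x, y) (fun z : R * R => is_derive (fun s => u s (snd z)) (fst z) (p (fst z) (snd z))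
    /\ is_derive (fun s => v s (snd z)) (fst z) (q (fst z) (snd z))) ->
  is_derive (fun s => u x s) y (- q x y) -> is_derive (fun s => v x s) y (p x y) ->
  continuous (fun z : R * R => p (fst z) (snd z)) (x, y) ->
  continuous (fun z : R * R => q (fst z) (snd z)) (x, y) ->
  is_derive (fun z : C => (u (fst z) (snd z), v (fst z) (snd z)) : C) (x, y) (p x y, q x y).
Proof.
  intros H Hu Hv Hp Hq. apply is_derive_C_filterdiff.
  assert (Du := is_derive_filterdiff u x y p _ (filter_imp _ _ (fun z K => proj1 K) H) Hu Hp).
  assert (Dv := is_derive_filterdiff v x y q _ (filter_imp _ _ (fun z K => proj2 K) H) Hv Hq).
  eapply filterdiff_ext_lin.
  - exact (filterdiff_pair _ _ _ _ _ Du Dv).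
  - intros [h k]. apply injective_projections; unfold scal, plus; simpl; unfold mult; simpl; ring.
Qed.

Lemma is_derive_C_AbsRing (f : C -> C) (z l : C) :
  is_derive (V := AbsRing_NormedModule C_AbsRing) f z l <-> is_derive f z l.
Proof. split; intros [_ H]; (split; [apply is_linear_scal_l | exact H]). Qed.

Lemma is_derive_Cid (z : C) : is_derive (fun y : C => y) z (RtoC 1).
Proof. apply is_derive_C_AbsRing, (is_derive_id (K := C_AbsRing)). Qed.

Lemma is_derive_Cconst (a z : C) : is_derive (fun _ : C => a) z (RtoC 0).
Proof. exact (is_derive_const a z). Qed.

Lemma is_derive_Cplus (f g : C -> C) (z l m : C) :
  is_derive f z l -> is_derive g z m -> is_derive (fun y => f y + g y)%C z (l + m)%C.
Proof. exact (is_derive_plus f g z l m). Qed.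

Lemma is_derive_Cminus (f g : C -> C) (z l m : C) :
  is_derive f z l -> is_derive g z m -> is_derive (fun y => f y - g y)%C z (l - m)%C.
Proof. exact (is_derive_minus f g z l m). Qed.

Lemma is_derive_Cmult (f g : C -> C) (z l m : C) :
  is_derive f z l -> is_derive g z m -> is_derive (fun y => f y * g y)%C z (l * g z + f z * m)%C.
Proof.
  rewrite <- !is_derive_C_AbsRing. intros Hf Hg. exact (is_derive_mult f g z l m Hf Hg Cmult_comm).
Qed.

Lemma is_derive_Ccomp (f g : C -> C) (z l m : C) :
  is_derive f (g z) l -> is_derive g z m -> is_derive (fun y => f (g y)) z (l * m)%C.
Proof. rewrite <- (is_derive_C_AbsRing g), Cmult_comm. exact (is_derive_comp f g z l m). Qed.

Lemma RtoC_neq_0 (x : R) : x <> 0 -> RtoC x <> 0.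
Proof. intros Hx E. now apply RtoC_inj in E. Qed.

Lemma Cmult_reg_l (k x y : C) : k <> 0 -> (k * x)%C = (k * y)%C -> x = y.
Proof.
  intros Hk E. replace x with (/ k * (k * x))%C by now field. rewrite E. now field.
Qed.

Lemma Re_pos_neq_0 (z : C) : 0 < Re z -> z <> 0.
Proof. intros H ->. simpl in H. lra. Qed.

Lemma Cmod_minus_sym (x y : C) : Cmod (x - y)%C = Cmod (y - x)%C.
Proof. rewrite <- Cmod_opp. f_equal. ring. Qed.

Lemma Cmod_triangle4 (a b c d : C) : Cmod (a + b + c + d)%C <= Cmod a + Cmod b + Cmod c + Cmod d.
Proof.
  eapply Rle_trans; [apply Cmod_triangle|]. apply Rplus_le_compat_r.
  eapply Rle_trans; [apply Cmod_triangle|]. apply Rplus_le_compat_r, Cmod_triangle.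
Qed.

Lemma Cmod_plus_ge (x y : C) : Cmod x - Cmod y <= Cmod (x + y)%C.
Proof.
  pose proof (Cmod_triangle (x + y) (- y)) as Htri. rewrite Cmod_opp in Htri.
  replace (x + y + - y)%C with x in Htri by ring. lra.
Qed.

Lemma Re_le_Cmod (z : C) : Re z <= Cmod z.
Proof. eapply Rle_trans; [apply Rle_abs | apply re_le_Cmod]. Qed.

Lemma im_le_Cmod (z : C) : Rabs (Im z) <= Cmod z.
Proof. eapply Rle_trans; [apply Rmax_r | apply (Rmax_Cmod z)]. Qed.

Lemma Cmod_le_Re_Im (z : C) : Cmod z <= Rabs (Re z) + Rabs (Im z).
Proof.
  rewrite <- (Cmod_R (Re z)), <- (Rmult_1_l (Rabs (Im z))), <- Cmod_Ci, <- (Cmod_R (Im z)), <- Cmod_mult.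
  eapply Rle_trans; [|apply Cmod_triangle].
  right. f_equal. apply injective_projections; unfold Re, Im; simpl; ring.
Qed.

Lemma is_derive_Cinv (z : C) : z <> 0 -> is_derive Cinv z (- / (z * z))%C.
Proof.
  intros Hz. apply is_derive_Cmod. intros e He. apply locally_Cmod.
  assert (Hm : 0 < Cmod z) by now apply Cmod_gt_0.
  set (m := Cmod z) in *. exists (Rmin (m / 2) (e * (m * (m * m)) / 2)). split.
  { apply Rmin_pos; [lra|]. apply Rdiv_lt_0_compat; [|lra].
    repeat (apply Rmult_lt_0_compat; [assumption|]). assumption. }
  intros y Hy. apply Rmin_Rgt in Hy. destruct Hy as [Hym Hye].
  assert (Hy : m / 2 < Cmod y).
  { pose proof (Cmod_plus_ge z (y - z)) as Hge. replace (z + (y - z))%C with y in Hge by ring.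
    unfold m in *. lra. }
  assert (Hy0 : y <> 0) by (apply Cmod_gt_0; lra).
  replace (/ y - / z - - / (z * z) * (y - z))%C with ((y - z) * (y - z) / (y * (z * z)))%C
    by (field; split; assumption).
  rewrite Cmod_div, !Cmod_mult by (repeat apply Cmult_neq_0; assumption). fold m.
  pose proof (Cmod_ge_0 (y - z)%C). apply Rle_div_l.
  - repeat apply Rmult_lt_0_compat; lra.
  - rewrite Rmult_assoc, (Rmult_comm e), Rmult_assoc. apply Rmult_le_compat_l; [assumption|].
    apply Rle_trans with (e * (m / 2 * (m * m))); [lra|]. rewrite (Rmult_comm _ e).
    apply Rmult_le_compat_l; [lra|]. apply Rmult_le_compat_r; [nra|lra].
Qed.

Lemma is_derive_Cpow (f : C -> C) (z l : C) (n : nat) :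
  is_derive f z l -> is_derive (fun y => f y ^ S n)%C z (RtoC (INR (S n)) * f z ^ n * l)%C.
Proof.
  intros Hf. induction n as [|n IH].
  - evar_last; [exact (is_derive_Cmult f (fun _ => 1)%C z _ _ Hf (is_derive_Cconst 1 z))|].
    simpl. ring.
  - evar_last; [exact (is_derive_Cmult f (fun y => f y ^ S n)%C z _ _ Hf IH)|].
    cbv beta. rewrite (S_INR (S n)), RtoC_plus, !Cpow_S. ring.
Qed.

Definition hor (y : R) : R -> C := fun x => (x, y).
Definition ver (x : R) : R -> C := fun y => (x, y).

Lemma is_derive_hor (x y : R) : is_derive (hor y) x (RtoC 1).
Proof. exact (filterdiff_pair _ _ x _ _ (is_derive_id x) (is_derive_const y x)). Qed.

Lemma is_derive_ver (x y : R) : is_derive (ver x) y Ci.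
Proof. exact (filterdiff_pair _ _ y _ _ (is_derive_const x y) (is_derive_id y)). Qed.

Lemma ex_derive_C_continuous (f : C -> C) (z : C) : ex_derive f z -> continuous f z.
Proof.
  intros H P HP. apply locally_C. apply ex_derive_continuous in H. exact (H P HP).
Qed.

Definition holomorphic_on (U : C -> Prop) (f : C -> C) : Prop := forall z, U z -> ex_derive f z.

Section Holomorphic.

Variables (U : C -> Prop) (f g : C -> C).
Hypothesis holo_f : holomorphic_on U f.
Hypothesis holo_g : holomorphic_on U g.

Lemma holomorphic_on_const (c : C) : holomorphic_on U (fun _ => c).
Proof. intros z _. eexists. apply is_derive_Cconst. Qed.

Lemma holomorphic_on_id : holomorphic_on U (fun z => z).
Proof. intros z _. eexists. apply is_derive_Cid. Qed.

Lemma holomorphic_on_plus : holomorphic_on U (fun z => f z + g z)%C.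
Proof.
  intros z Hz. destruct (holo_f z Hz) as [l Hl], (holo_g z Hz) as [m Hm].
  eexists. exact (is_derive_Cplus f g z l m Hl Hm).
Qed.

Lemma holomorphic_on_minus : holomorphic_on U (fun z => f z - g z)%C.
Proof.
  intros z Hz. destruct (holo_f z Hz) as [l Hl], (holo_g z Hz) as [m Hm].
  eexists. exact (is_derive_Cminus f g z l m Hl Hm).
Qed.

Lemma holomorphic_on_mult : holomorphic_on U (fun z => f z * g z)%C.
Proof.
  intros z Hz. destruct (holo_f z Hz) as [l Hl], (holo_g z Hz) as [m Hm].
  eexists. exact (is_derive_Cmult f g z l m Hl Hm).
Qed.

Lemma holomorphic_on_pow (n : nat) : holomorphic_on U (fun z => f z ^ n)%C.
Proof.
  intros z Hz. destruct n as [|n].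
  - apply (holomorphic_on_const 1 z Hz).
  - destruct (holo_f z Hz) as [l Hl]. eexists. exact (is_derive_Cpow f z l n Hl).
Qed.

Lemma holomorphic_on_comp (V : C -> Prop) (h : C -> C) :
  holomorphic_on V h -> (forall z, U z -> V (f z)) -> holomorphic_on U (fun z => h (f z)).
Proof.
  intros Hh HV z Hz. destruct (holo_f z Hz) as [l Hl], (Hh _ (HV z Hz)) as [m Hm].
  eexists. exact (is_derive_Ccomp h f z m l Hm Hl).
Qed.

Lemma holomorphic_on_continuous (z : C) : U z -> continuous f z.
Proof. intros Hz. now apply ex_derive_C_continuous, holo_f. Qed.

End Holomorphic.

Lemma holomorphic_on_Cinv : holomorphic_on (fun z => z <> 0) Cinv.
Proof. intros z Hz. eexists. now apply is_derive_Cinv. Qed.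

(** * Contour integrals and Goursat's theorem *)

Lemma is_RInt_Cmult (c : C) (f : R -> C) (a b : R) (l : C) :
  is_RInt f a b l -> is_RInt (fun t => c * f t)%C a b (c * l)%C.
Proof.
  intros H.
  pose proof (is_RInt_fct_extend_fst _ _ _ _ H) as Hre.
  pose proof (is_RInt_fct_extend_snd _ _ _ _ H) as Him.
  apply (is_RInt_fct_extend_pair (U := R_NormedModule) (V := R_NormedModule)).
  - apply (is_RInt_minus (V := R_NormedModule)); now apply (is_RInt_scal (V := R_NormedModule)).
  - apply (is_RInt_plus (V := R_NormedModule)); now apply (is_RInt_scal (V := R_NormedModule)).
Qed.

Lemma is_RInt_Cmod_le (f : R -> C) (g : R -> R) (a b : R) (l : C) (m : R) : a <= b ->
  (forall t, a <= t <= b -> Cmod (f t) <= g t) -> is_RInt f a b l -> is_RInt g a b m -> Cmod l <= m.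
Proof.
  intros Hab H. rewrite Cmod_norm. apply (norm_RInt_le f g a b l m Hab).
  intros t Ht. rewrite <- Cmod_norm. now apply H.
Qed.

Lemma is_RInt_Cmod_le_const (f : R -> C) (a b : R) (l : C) (M : R) :
  (forall t, Rmin a b <= t <= Rmax a b -> Cmod (f t) <= M) -> is_RInt f a b l ->
  Cmod l <= Rabs (b - a) * M.
Proof.
  intros H. rewrite Cmod_norm. apply (norm_RInt_le_const_abs f a b l M).
  intros t Ht. rewrite <- Cmod_norm. now apply H.
Qed.

Lemma continuous_Cmult {U : UniformSpace} (f g : U -> C) (x : U) :
  continuous f x -> continuous g x -> continuous (fun y => f y * g y)%C x.
Proof.
  intros Hf Hg P HP. apply (continuous_mult (K := C_AbsRing) f g x).
  - intros Q HQ. apply Hf, locally_C, HQ.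
  - intros Q HQ. apply Hg, locally_C, HQ.
  - apply locally_C, HP.
Qed.

Definition contour_integral (f : C -> C) (g dg : R -> C) (a b : R) : C :=
  CRInt (fun t => f (g t) * dg t)%C a b.

Definition smooth_curve (g dg : R -> C) : Prop := forall t, is_derive g t (dg t) /\ continuous dg t.

Section ContourIntegral.

Variables (g dg : R -> C) (a b : R).
Hypothesis smooth_g : smooth_curve g dg.

Lemma continuous_contour_integrand (f : C -> C) (t : R) :
  continuous f (g t) -> continuous (fun t => f (g t) * dg t)%C t.
Proof.
  intros Hf. destruct (smooth_g t) as [Dg Cdg]. apply continuous_Cmult; [|assumption].
  apply (continuous_comp g f); [|assumption]. apply (ex_derive_continuous g). now exists (dg t).
Qed.

Lemma contour_integral_correct (f : C -> C) :
  (forall t, Rmin a b <= t <= Rmax a b -> continuous f (g t)) ->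
  is_RInt (fun t => f (g t) * dg t)%C a b (contour_integral f g dg a b).
Proof.
  intros Hf. apply (@RInt_correct C_R_CompleteNormedModule).
  apply (@ex_RInt_continuous C_R_CompleteNormedModule). intros t Ht.
  now apply continuous_contour_integrand, Hf.
Qed.

Lemma contour_integral_derive (Phi f : C -> C) :
  (forall t, Rmin a b <= t <= Rmax a b -> is_derive Phi (g t) (f (g t))) ->
  (forall t, Rmin a b <= t <= Rmax a b -> continuous f (g t)) ->
  contour_integral f g dg a b = (Phi (g b) - Phi (g a))%C.
Proof.
  intros HPhi Hf. apply (@is_RInt_unique C_R_CompleteNormedModule).
  apply (@is_RInt_derive C_R_CompleteNormedModule (fun t => Phi (g t))); intros t Ht.
  - apply is_derive_curve_comp; [now apply HPhi | apply smooth_g].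
  - now apply continuous_contour_integrand, Hf.
Qed.

Lemma contour_integral_plus (f h : C -> C) :
  (forall t, Rmin a b <= t <= Rmax a b -> continuous f (g t)) ->
  (forall t, Rmin a b <= t <= Rmax a b -> continuous h (g t)) ->
  contour_integral (fun z => f z + h z)%C g dg a b
  = (contour_integral f g dg a b + contour_integral h g dg a b)%C.
Proof.
  intros Hf Hh. apply (@is_RInt_unique C_R_CompleteNormedModule).
  apply (is_RInt_ext (fun t => f (g t) * dg t + h (g t) * dg t)%C).
  - intros t _. C_ring.
  - exact (is_RInt_plus _ _ _ _ _ _ (contour_integral_correct f Hf) (contour_integral_correct h Hh)).
Qed.

Lemma contour_integral_scal (k : C) (f : C -> C) :
  (forall t, Rmin a b <= t <= Rmax a b -> continuous f (g t)) ->
  contour_integral (fun z => k * f z)%C g dg a b = (k * contour_integral f g dg a b)%C.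
Proof.
  intros Hf. apply (@is_RInt_unique C_R_CompleteNormedModule).
  apply (is_RInt_ext (fun t => k * (f (g t) * dg t))%C).
  - intros t _. C_ring.
  - apply is_RInt_Cmult, contour_integral_correct, Hf.
Qed.

Lemma contour_integral_minus (f h : C -> C) :
  (forall t, Rmin a b <= t <= Rmax a b -> continuous f (g t)) ->
  (forall t, Rmin a b <= t <= Rmax a b -> continuous h (g t)) ->
  contour_integral (fun z => f z - h z)%C g dg a b
  = (contour_integral f g dg a b - contour_integral h g dg a b)%C.
Proof.
  intros Hf Hh. apply (@is_RInt_unique C_R_CompleteNormedModule).
  apply (is_RInt_ext (fun t => f (g t) * dg t - h (g t) * dg t)%C).
  - intros t _. C_ring.
  - exact (is_RInt_minus _ _ _ _ _ _ (contour_integral_correct f Hf) (contour_integral_correct h Hh)).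
Qed.

Lemma contour_integral_Cmod_le (f : C -> C) (M L : R) :
  (forall t, Rmin a b <= t <= Rmax a b -> continuous f (g t)) ->
  (forall t, Rmin a b <= t <= Rmax a b -> Cmod (f (g t)) <= M) ->
  (forall t, Rmin a b <= t <= Rmax a b -> Cmod (dg t) <= L) ->
  Cmod (contour_integral f g dg a b) <= Rabs (b - a) * (M * L).
Proof.
  intros Hf HM HL. apply (is_RInt_Cmod_le_const (fun t => f (g t) * dg t)%C).
  - intros t Ht. rewrite Cmod_mult. apply Rmult_le_compat; try apply Cmod_ge_0; auto.
  - now apply contour_integral_correct.
Qed.

End ContourIntegral.

Lemma contour_integral_Chasles (f : C -> C) (g dg : R -> C) (a m b : R) : smooth_curve g dg ->
  a <= m <= b -> (forall t, a <= t <= b -> continuous f (g t)) ->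
  contour_integral f g dg a b = (contour_integral f g dg a m + contour_integral f g dg m b)%C.
Proof.
  intros Hg Hm Hf. symmetry.
  apply (@RInt_Chasles C_R_CompleteNormedModule); eexists; apply contour_integral_correct;
    try assumption; intros t; rewrite Rmin_left, Rmax_right by lra; intros Ht; apply Hf; lra.
Qed.

Lemma smooth_hor (y : R) : smooth_curve (hor y) (fun _ => RtoC 1).
Proof. intros x. split; [apply is_derive_hor | apply continuous_const]. Qed.

Lemma smooth_ver (x : R) : smooth_curve (ver x) (fun _ => Ci).
Proof. intros y. split; [apply is_derive_ver | apply continuous_const]. Qed.

Notation hor_integral f y := (contour_integral f (hor y) (fun _ => RtoC 1)).
Notation ver_integral f x := (contour_integral f (ver x) (fun _ => Ci)).

Lemma hor_integral_Cmod_le (f : C -> C) (y a b M : R) :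
  (forall x, Rmin a b <= x <= Rmax a b -> continuous f (x, y)) ->
  (forall x, Rmin a b <= x <= Rmax a b -> Cmod (f (x, y)) <= M) ->
  Cmod (hor_integral f y a b) <= Rabs (b - a) * M.
Proof.
  intros Hf HM. rewrite <- (Rmult_1_r M). apply contour_integral_Cmod_le; try assumption.
  - apply smooth_hor.
  - intros _ _. rewrite Cmod_1. apply Rle_refl.
Qed.

Lemma ver_integral_Cmod_le (f : C -> C) (x c d M : R) :
  (forall y, Rmin c d <= y <= Rmax c d -> continuous f (x, y)) ->
  (forall y, Rmin c d <= y <= Rmax c d -> Cmod (f (x, y)) <= M) ->
  Cmod (ver_integral f x c d) <= Rabs (d - c) * M.
Proof.
  intros Hf HM. rewrite <- (Rmult_1_r M). apply contour_integral_Cmod_le; try assumption.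
  - apply smooth_ver.
  - intros _ _. rewrite Cmod_Ci. apply Rle_refl.
Qed.

Definition rect_integral (f : C -> C) (a b c d : R) : C :=
  (hor_integral f c a b + ver_integral f b c d
   - hor_integral f d a b - ver_integral f a c d)%C.

Definition rectangle (a b c d : R) (z : C) : Prop := a <= Re z <= b /\ c <= Im z <= d.

Lemma rect_integral_derive (Phi f : C -> C) (a b c d : R) :
  (forall z, is_derive Phi z (f z)) -> (forall z, continuous f z) -> rect_integral f a b c d = 0.
Proof.
  intros HPhi Hf. unfold rect_integral.
  rewrite !(contour_integral_derive _ _ _ _ (smooth_hor _) Phi f) by auto.
  rewrite !(contour_integral_derive _ _ _ _ (smooth_ver _) Phi f) by auto.
  unfold hor, ver. ring.
Qed.

Section RectIntegral.

Variables a b c d : R.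
Hypothesis le_a_b : a <= b.
Hypothesis le_c_d : c <= d.

Lemma continuous_hor (f : C -> C) (y : R) : holomorphic_on (rectangle a b c d) f -> c <= y <= d ->
  forall x, Rmin a b <= x <= Rmax a b -> continuous f (hor y x).
Proof.
  intros Hf Hy x. rewrite Rmin_left, Rmax_right by assumption. intros Hx.
  apply ex_derive_C_continuous, Hf. now split.
Qed.

Lemma continuous_ver (f : C -> C) (x : R) : holomorphic_on (rectangle a b c d) f -> a <= x <= b ->
  forall y, Rmin c d <= y <= Rmax c d -> continuous f (ver x y).
Proof.
  intros Hf Hx y. rewrite Rmin_left, Rmax_right by assumption. intros Hy.
  apply ex_derive_C_continuous, Hf. now split.
Qed.

Lemma rect_integral_minus (f h : C -> C) :
  holomorphic_on (rectangle a b c d) f -> holomorphic_on (rectangle a b c d) h ->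
  rect_integral (fun z => f z - h z)%C a b c d
  = (rect_integral f a b c d - rect_integral h a b c d)%C.
Proof.
  intros Hf Hh. unfold rect_integral.
  rewrite !(contour_integral_minus _ _ _ _ (smooth_hor _)) by (apply continuous_hor; auto; lra).
  rewrite !(contour_integral_minus _ _ _ _ (smooth_ver _)) by (apply continuous_ver; auto; lra).
  ring.
Qed.

Lemma rect_integral_Cmod_le (f : C -> C) (M : R) :
  holomorphic_on (rectangle a b c d) f -> (forall z, rectangle a b c d z -> Cmod (f z) <= M) ->
  Cmod (rect_integral f a b c d) <= 2 * (b - a + (d - c)) * M.
Proof.
  intros Hf HM.
  assert (Hhor : forall y, c <= y <= d -> Cmod (hor_integral f y a b) <= (b - a) * M).
  { intros y Hy. rewrite <- (Rabs_pos_eq (b - a)) by lra.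
    apply hor_integral_Cmod_le; [now apply continuous_hor|].
    rewrite Rmin_left, Rmax_right by assumption. intros x Hx. now apply HM. }
  assert (Hver : forall x, a <= x <= b -> Cmod (ver_integral f x c d) <= (d - c) * M).
  { intros x Hx. rewrite <- (Rabs_pos_eq (d - c)) by lra.
    apply ver_integral_Cmod_le; [now apply continuous_ver|].
    rewrite Rmin_left, Rmax_right by assumption. intros y Hy. now apply HM. }
  unfold rect_integral, Cminus. eapply Rle_trans; [apply Cmod_triangle4|]. rewrite !Cmod_opp.
  pose proof (Hhor c ltac:(lra)). pose proof (Hhor d ltac:(lra)).
  pose proof (Hver a ltac:(lra)). pose proof (Hver b ltac:(lra)). lra.
Qed.

End RectIntegral.

Lemma rect_integral_split (f : C -> C) (a m b c n d : R) : a <= m <= b -> c <= n <= d ->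
  holomorphic_on (rectangle a b c d) f ->
  rect_integral f a b c d
  = (rect_integral f a m c n + rect_integral f m b c n
     + rect_integral f a m n d + rect_integral f m b n d)%C.
Proof.
  intros Hm Hn Hf. unfold rect_integral.
  rewrite !(contour_integral_Chasles f (hor _) _ a m b (smooth_hor _) Hm)
    by (intros x Hx; apply ex_derive_C_continuous, Hf; split; simpl; lra).
  rewrite !(contour_integral_Chasles f (ver _) _ c n d (smooth_ver _) Hn)
    by (intros y Hy; apply ex_derive_C_continuous, Hf; split; simpl; lra).
  ring.
Qed.

Lemma rect_integral_quarters_le (f : C -> C) (a m b c n d e : R) : a <= m <= b -> c <= n <= d ->
  holomorphic_on (rectangle a b c d) f ->
  Cmod (rect_integral f a m c n) <= e -> Cmod (rect_integral f m b c n) <= e ->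
  Cmod (rect_integral f a m n d) <= e -> Cmod (rect_integral f m b n d) <= e ->
  Cmod (rect_integral f a b c d) <= 4 * e.
Proof.
  intros Hm Hn Hf Hsw Hse Hnw Hne. rewrite (rect_integral_split f a m b c n d) by assumption.
  eapply Rle_trans; [apply Cmod_triangle4 | lra].
Qed.

Lemma dyadic_nested_intervals (u : nat -> R) (w : R) : 0 <= w ->
  (forall n, u n <= u (S n) <= u n + w / 2 ^ S n) ->
  exists l, forall n, u n <= l <= u n + w / 2 ^ n.
Proof.
  intros Hw Hu. set (v n := u n + w / 2 ^ n).
  assert (Hv : forall n, v (S n) <= v n).
  { intros n. unfold v. specialize (Hu n).
    replace (w / 2 ^ n) with (2 * (w / 2 ^ S n)) by (simpl; field; apply pow_nonzero; lra). lra. }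
  destruct (ex_lim_seq_adj u v) as (Lu & Lv & E); [apply Hu | exact Hv | |].
  { apply (is_lim_seq_ext (fun n => w * (/ 2) ^ n)).
    - intros n. unfold v, Rdiv. rewrite pow_inv. ring.
    - replace (Finite 0) with (Rbar_mult w 0) by (simpl; f_equal; ring).
      apply is_lim_seq_scal_l, is_lim_seq_geom. rewrite Rabs_pos_eq; lra. }
  exists (real (Lim_seq u)). intros n. split.
  - apply (is_lim_seq_incr_compare u); [apply Lim_seq_correct', Lu | apply Hu].
  - rewrite E. apply (is_lim_seq_decr_compare v); [apply Lim_seq_correct', Lv | exact Hv].
Qed.

(* A rectangle violating [P] would have a quarter violating it; such quarters shrink to a point. *)
Lemma dyadic_rectangle_induction (P : R -> R -> nat -> Prop) (a c w v : R) : 0 <= w -> 0 <= v ->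
  (forall x y n, let s := w / 2 ^ S n in let t := v / 2 ^ S n in
     P x y (S n) -> P (x + s) y (S n) -> P x (y + t) (S n) -> P (x + s) (y + t) (S n) -> P x y n) ->
  (forall p q, a <= p <= a + w -> c <= q <= c + v -> exists n, forall x y,
     x <= p <= x + w / 2 ^ n -> y <= q <= y + v / 2 ^ n -> P x y n) ->
  P a c O.
Proof.
  intros Hw Hv Hmerge Hlocal. apply NNPP. intros Hbad.
  set (bad (s : R * R) n := ~ P (fst s) (snd s) n).
  set (child (s s' : R * R) n := fst s <= fst s' <= fst s + w / 2 ^ S n
    /\ snd s <= snd s' <= snd s + v / 2 ^ S n).
  assert (Hquarter : forall s n, bad s n -> exists s', bad s' (S n) /\ child s s' n).
  { intros [x y] n Hb. set (wn := w / 2 ^ S n). set (vn := v / 2 ^ S n).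
    assert (Hwn : 0 <= wn) by (apply Rdiv_le_0_compat; [assumption | apply pow_lt; lra]).
    assert (Hvn : 0 <= vn) by (apply Rdiv_le_0_compat; [assumption | apply pow_lt; lra]).
    apply NNPP. intros Hn. apply Hb. apply Hmerge; apply NNPP; intros H; apply Hn;
      match type of H with ~ P ?x' ?y' _ => exists (x', y') end;
      (split; [exact H|]); unfold child; cbn [fst snd]; fold wn vn; split; lra. }
  set (next n s := epsilon (inhabits s) (fun s' => bad s' (S n) /\ child s s' n)).
  set (corner := fix corner n := match n with O => (a, c) | S m => next m (corner m) end).
  assert (Hcorner : forall n, bad (corner n) n /\ child (corner n) (corner (S n)) n).
  { assert (Hnext : forall s n, bad s n -> bad (next n s) (S n) /\ child s (next n s) n).
    { intros s n Hb. unfold next. apply epsilon_spec, Hquarter, Hb. }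
    intros n. assert (Hb : bad (corner n) n); [|split; [assumption | now apply Hnext]].
    induction n as [|n IH]; [exact Hbad|]. now apply (Hnext (corner n) n). }
  destruct (dyadic_nested_intervals (fun n => fst (corner n)) w Hw) as [p Hp]; [apply Hcorner|].
  destruct (dyadic_nested_intervals (fun n => snd (corner n)) v Hv) as [q Hq]; [apply Hcorner|].
  destruct (Hlocal p q) as [n Hn].
  - generalize (Hp O). simpl. rewrite Rdiv_1_r. exact (fun H => H).
  - generalize (Hq O). simpl. rewrite Rdiv_1_r. exact (fun H => H).
  - destruct (Hcorner n) as [Hb _]. exact (Hb (Hn _ _ (Hp n) (Hq n))).
Qed.

Lemma is_derive_affine (c l p z : C) : is_derive (fun z => c + l * (z - p))%C z l.
Proof.
  evar_last.
  - apply is_derive_Cplus; [apply is_derive_Cconst|]. apply is_derive_Cmult; [apply is_derive_Cconst|].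
    apply is_derive_Cminus; [apply is_derive_Cid | apply is_derive_Cconst].
  - C_ring.
Qed.

Lemma rect_integral_affine (u l p : C) (a b c d : R) :
  rect_integral (fun z => u + l * (z - p))%C a b c d = 0.
Proof.
  apply (rect_integral_derive (fun z => u * z + l / 2 * ((z - p) * (z - p)))%C).
  - intros z. evar_last.
    + apply is_derive_Cplus.
      * apply is_derive_Cmult; [apply is_derive_Cconst | apply is_derive_Cid].
      * apply is_derive_Cmult; [apply is_derive_Cconst|].
        apply is_derive_Cmult; apply is_derive_Cminus; apply is_derive_Cid || apply is_derive_Cconst.
    + C_field.
  - intros z. apply ex_derive_C_continuous. exists l. apply is_derive_affine.
Qed.

Lemma rect_integral_small (f : C -> C) (p : C) (e : R) : ex_derive f p -> 0 < e ->
  exists r, 0 < r /\ forall a b c d, rectangle a b c d p -> b - a + (d - c) < r ->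
    holomorphic_on (rectangle a b c d) f ->
    Cmod (rect_integral f a b c d) <= e * (b - a + (d - c)) ^ 2.
Proof.
  intros [l Hl] He.
  destruct (proj1 (locally_Cmod _ _) (proj1 (is_derive_Cmod f p l) Hl (e / 2) ltac:(lra)))
    as (r & Hr & Hf).
  exists r. split; [assumption|]. intros a b c d Hp Hsmall Hol.
  assert (Hab : a <= b) by (destruct Hp; lra). assert (Hcd : c <= d) by (destruct Hp; lra).
  set (k := fun z => (f p + l * (z - p))%C).
  assert (Dk : forall z, is_derive k z l) by (intros z; apply is_derive_affine).
  replace (rect_integral f a b c d) with (rect_integral (fun z => f z - k z)%C a b c d).
  2: { rewrite rect_integral_minus by (auto; intros z _; now exists l).
       unfold k. rewrite rect_integral_affine. ring. }
  replace (e * (b - a + (d - c)) ^ 2)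
    with (2 * (b - a + (d - c)) * (e / 2 * (b - a + (d - c)))) by field.
  apply rect_integral_Cmod_le; auto.
  - intros z Hz. destruct (Hol z Hz) as [m Hm]. eexists. exact (is_derive_Cminus f k z _ _ Hm (Dk z)).
  - intros z Hz.
    assert (Hzp : Cmod (z - p)%C <= b - a + (d - c)).
    { eapply Rle_trans; [apply Cmod_le_Re_Im|]. destruct Hz, Hp.
      apply Rplus_le_compat; apply Rabs_le; simpl; unfold Re, Im in *; lra. }
    replace (f z - k z)%C with (f z - f p - l * (z - p))%C by (unfold k; ring).
    eapply Rle_trans; [apply Hf; lra|]. apply Rmult_le_compat_l; lra.
Qed.

Lemma rect_integral_dyadic_small (f : C -> C) (p : C) (w v e : R) : ex_derive f p ->
  0 <= w -> 0 <= v -> 0 < e ->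
  exists n, forall x y, rectangle x (x + w / 2 ^ n) y (y + v / 2 ^ n) p ->
    holomorphic_on (rectangle x (x + w / 2 ^ n) y (y + v / 2 ^ n)) f ->
    Cmod (rect_integral f x (x + w / 2 ^ n) y (y + v / 2 ^ n)) <= e / 4 ^ n.
Proof.
  intros Hp Hw Hv He. set (m := (w + v) ^ 2 + 1). assert (Hm : 0 < m) by (unfold m; nra).
  destruct (rect_integral_small f p (e / m) Hp) as (r & Hr & Hsmall); [now apply Rdiv_lt_0_compat|].
  destruct (pow_lt_1_zero (/ 2) ltac:(rewrite Rabs_pos_eq; lra) (r / m)) as [n Hn];
    [now apply Rdiv_lt_0_compat|].
  specialize (Hn n (Nat.le_refl n)). rewrite Rabs_pos_eq, pow_inv in Hn by (apply pow_le; lra).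
  assert (H2n : 0 < / 2 ^ n) by (apply Rinv_0_lt_compat, pow_lt; lra).
  exists n. intros x y Hxy Hf.
  assert (Esize : x + w / 2 ^ n - x + (y + v / 2 ^ n - y) = (w + v) * / 2 ^ n)
    by (field; apply pow_nonzero; lra).
  eapply Rle_trans; [apply Hsmall; [assumption | | assumption]|]; rewrite Esize.
  - apply Rle_lt_trans with (m * / 2 ^ n); [apply Rmult_le_compat_r; unfold m; nra|].
    rewrite Rmult_comm. now apply Rlt_div_r.
  - replace (e / m * ((w + v) * / 2 ^ n) ^ 2) with (e / 4 ^ n * ((w + v) ^ 2 / m)).
    2: { replace 4 with (2 * 2) by ring. rewrite Rpow_mult_distr. field.
         split; [apply pow_nonzero|]; lra. }
    rewrite <- (Rmult_1_r (e / 4 ^ n)) at 2. apply Rmult_le_compat_l.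
    + apply Rdiv_le_0_compat; [lra | apply pow_lt; lra].
    + apply Rle_div_l; [assumption|]. unfold m. lra.
Qed.

(* The property inherited by merging four quarters is that the integral over a rectangle at level [n]
   is at most [e / 4 ^ n]; on small rectangles it follows from differentiability, because the affine
   part of [f] has a primitive. *)
Lemma goursat (f : C -> C) (a b c d : R) : a <= b -> c <= d ->
  holomorphic_on (rectangle a b c d) f -> rect_integral f a b c d = 0.
Proof.
  intros Hab Hcd Hf. set (w := b - a). set (v := d - c).
  assert (Hw : 0 <= w) by (unfold w; lra). assert (Hv : 0 <= v) by (unfold v; lra).
  apply Cmod_eq_0, Rle_antisym; [|apply Cmod_ge_0]. apply le_epsilon. intros e He. rewrite Rplus_0_l.
  set (P x y n := holomorphic_on (rectangle x (x + w / 2 ^ n) y (y + v / 2 ^ n)) f ->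
    Cmod (rect_integral f x (x + w / 2 ^ n) y (y + v / 2 ^ n)) <= e / 4 ^ n).
  assert (HP : P a c O).
  { apply (dyadic_rectangle_induction P a c w v); [assumption | assumption | |].
    - intros x y n s t Psw Pse Pnw Pne Hol. unfold P in *. fold s t in Psw, Pse, Pnw, Pne.
      assert (Hs : 0 <= s) by (apply Rdiv_le_0_compat; [assumption | apply pow_lt; lra]).
      assert (Ht : 0 <= t) by (apply Rdiv_le_0_compat; [assumption | apply pow_lt; lra]).
      assert (Ew : x + w / 2 ^ n = x + s + s) by (unfold s; simpl; field; apply pow_nonzero; lra).
      assert (Ev : y + v / 2 ^ n = y + t + t) by (unfold t; simpl; field; apply pow_nonzero; lra).
      rewrite Ew, Ev in *.
      replace (e / 4 ^ n) with (4 * (e / 4 ^ S n)) by (simpl; field; apply pow_nonzero; lra).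
      apply (rect_integral_quarters_le f x (x + s) (x + s + s) y (y + t) (y + t + t));
        [lra | lra | assumption | apply Psw | apply Pse | apply Pnw | apply Pne];
        intros z [Hre Him]; apply Hol; split; lra.
    - intros p q Hp Hq.
      destruct (rect_integral_dyadic_small f (p, q) w v e) as [n Hn]; try assumption.
      + apply Hf. unfold w, v in *. split; simpl; lra.
      + exists n. intros x y Hx Hy Hol. apply Hn; [now split | assumption]. }
  unfold P in HP. simpl in HP. rewrite !Rdiv_1_r in HP. unfold w, v in HP.
  replace (a + (b - a)) with b in HP by ring. replace (c + (d - c)) with d in HP by ring. auto.
Qed.

(** * The complex exponential and logarithm *)

Lemma exp_le (x y : R) : x <= y -> exp x <= exp y.
Proof. intros [H | <-]; [left; now apply exp_increasing | right; reflexivity]. Qed.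

Definition circle (r t : R) : C := (r * cos t, r * sin t).

Lemma Cmod_circle (r t : R) : 0 <= r -> Cmod (circle r t) = r.
Proof.
  intros Hr. unfold Cmod, circle. cbn [fst snd].
  replace ((r * cos t) ^ 2 + (r * sin t) ^ 2) with (r ^ 2 * (Rsqr (sin t) + Rsqr (cos t)))
    by (unfold Rsqr; ring).
  rewrite sin2_cos2, Rmult_1_r. now apply sqrt_pow2.
Qed.

Lemma circle_neq_0 (r t : R) : 0 < r -> circle r t <> 0.
Proof. intros Hr. apply Cmod_gt_0. rewrite Cmod_circle; lra. Qed.

Lemma Cexp_circle (z : C) : Cexp z = circle (exp (Re z)) (Im z).
Proof. reflexivity. Qed.

Lemma Cexp_ln (r t : R) : 0 < r -> Cexp (ln r, t) = circle r t.
Proof. intros Hr. rewrite Cexp_circle. simpl. now rewrite exp_ln. Qed.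

Lemma Cmod_Cexp (z : C) : Cmod (Cexp z) = exp (Re z).
Proof. rewrite Cexp_circle. apply Cmod_circle, Rlt_le, exp_pos. Qed.

Lemma Cexp_plus (y z : C) : Cexp (y + z)%C = (Cexp y * Cexp z)%C.
Proof.
  unfold Cexp, Cplus, Cmult, Re, Im. cbn [fst snd]. rewrite exp_plus, cos_plus, sin_plus.
  f_equal; ring.
Qed.

Lemma Cexp_0 : Cexp 0 = 1.
Proof. unfold Cexp. simpl. rewrite exp_0, cos_0, sin_0. now rewrite Rmult_1_r, Rmult_0_r. Qed.

Lemma Cexp_R (x : R) : Cexp x = exp x.
Proof. unfold Cexp. simpl. rewrite cos_0, sin_0. now rewrite Rmult_1_r, Rmult_0_r. Qed.

Lemma is_derive_Cexp (z : C) : is_derive Cexp z (Cexp z).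
Proof.
  destruct z as [x y].
  assert (Hprod : forall h : R -> R, (forall t, continuous h t) ->
    forall s t, continuous (fun z : R * R => exp (fst z) * h (snd z)) (s, t)).
  { intros h Hh s t. apply (continuous_mult (K := R_AbsRing)).
    - apply continuous_comp; [apply continuous_fst | apply continuous_exp].
    - apply continuous_comp; [apply continuous_snd | apply Hh]. }
  apply (is_derive_Cauchy_Riemann (fun x y => exp x * cos y) (fun x y => exp x * sin y)
    (fun x y => exp x * cos y) (fun x y => exp x * sin y));
    auto using continuous_cos, continuous_sin.
  - apply filter_forall. intros [s t]. cbn [fst snd]. split; auto_derive; trivial; ring.
  - auto_derive; trivial; ring.
  - auto_derive; trivial; ring.
Qed.

Lemma is_derive_C_ext_loc (f g : C -> C) (z l : C) :
  locally z (fun y => f y = g y) -> is_derive f z l -> is_derive g z l.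
Proof. intros H. apply is_derive_ext_loc, locally_C, H. Qed.

Lemma Carg_right (z : C) : 0 < Re z -> Carg z = atan (Im z / Re z).
Proof. intros H. unfold Carg. destruct (Rlt_dec 0 (Re z)); [reflexivity | contradiction]. Qed.

Lemma locally_Re_pos (z : C) : 0 < Re z -> locally z (fun y => 0 < Re y).
Proof.
  destruct z as [x y]. intros H. apply (continuous_fst x y (fun s => 0 < s)), open_gt, H.
Qed.

Lemma ln_sqrt (x : R) : 0 < x -> ln (sqrt x) = ln x / 2.
Proof.
  intros Hx. assert (Hs : 0 < sqrt x) by now apply sqrt_lt_R0.
  rewrite <- (sqrt_sqrt x) at 2 by lra. rewrite ln_mult by assumption. field.
Qed.

Lemma Clog_R (t : R) : 0 < t -> Clog t = ln t.
Proof.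
  intros Ht. unfold Clog. rewrite Cmod_R, Rabs_pos_eq, Carg_right by (simpl; lra).
  simpl. unfold Rdiv. now rewrite Rmult_0_l, atan_0.
Qed.

Lemma Clog_1 : Clog 1 = 0.
Proof. rewrite Clog_R, ln_1 by lra. reflexivity. Qed.

Lemma Im_Clog_bound (z : C) : 0 < Re z -> - (PI / 2) < Im (Clog z) < PI / 2.
Proof. intros Hz. unfold Clog. cbn [Im snd]. rewrite Carg_right by assumption.
  pose proof (atan_bound (Im z / Re z)). lra.
Qed.

Lemma Clog_Cexp (z : C) : - (PI / 2) < Im z < PI / 2 -> Clog (Cexp z) = z.
Proof.
  intros Hz. assert (Hc : 0 < cos (Im z)) by (apply cos_gt_0; lra).
  unfold Clog. rewrite Cmod_Cexp, ln_exp, Carg_right.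
  - replace (Im (Cexp z) / Re (Cexp z)) with (tan (Im z)).
    + rewrite atan_tan by lra. now destruct z.
    + unfold tan, Cexp. simpl. field. split; [lra | apply Rgt_not_eq, exp_pos].
  - unfold Cexp. simpl. apply Rmult_lt_0_compat; [apply exp_pos | assumption].
Qed.

Lemma Cexp_Clog (z : C) : 0 < Re z -> Cexp (Clog z) = z.
Proof.
  intros Hz. assert (Hz0 : 0 < Cmod z) by (apply Cmod_gt_0, Re_pos_neq_0, Hz).
  assert (Hs : sqrt (1 + Rsqr (Im z / Re z)) = Cmod z / Re z).
  { rewrite <- (sqrt_pow2 (Re z)) at 2 by lra. unfold Cmod. rewrite <- sqrt_div_alt by (apply pow_lt; lra).
    f_equal. unfold Rsqr. change (fst z) with (Re z). change (snd z) with (Im z). field. lra. }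
  unfold Cexp, Clog. cbn [Re Im fst snd].
  rewrite Carg_right, exp_ln, cos_atan, sin_atan, Hs by assumption.
  destruct z as [x y]. cbn [Re Im fst snd] in *. f_equal; field; lra.
Qed.

Lemma is_derive_Clog (z : C) : 0 < Re z -> is_derive Clog z (/ z)%C.
Proof.
  destruct z as [x y]. simpl. intros Hx.
  assert (Hsq : forall s t : R, 0 < s -> 0 < s ^ 2 + t ^ 2).
  { intros s t Hs. pose proof (pow_lt s 2 Hs). pose proof (pow2_ge_0 t). lra. }
  apply (is_derive_C_ext_loc (fun z => (ln (fst z ^ 2 + snd z ^ 2) / 2, atan (snd z / fst z)))).
  { generalize (locally_Re_pos (x, y) Hx). apply filter_imp. intros z Hz.
    unfold Clog, Cmod. now rewrite Carg_right, ln_sqrt by auto. }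
  assert (Hc : forall k : R * R -> R, continuous k (x, y) ->
    continuous (fun z : R * R => k z / (fst z ^ 2 + snd z ^ 2)) (x, y)).
  { intros k Hk. apply (continuous_mult (K := R_AbsRing) k); [assumption|].
    assert (Hp : forall u : R, continuous (fun v => v ^ 2) u).
    { intros u. apply (ex_derive_continuous (fun v => v ^ 2)). auto_derive. exact I. }
    apply (continuous_comp (fun z => fst z ^ 2 + snd z ^ 2) Rinv).
    - apply (continuous_plus (V := R_NormedModule) (fun z => fst z ^ 2) (fun z => snd z ^ 2)).
      + apply (continuous_comp fst (fun u => u ^ 2)); [apply continuous_fst | apply Hp].
      + apply (continuous_comp snd (fun u => u ^ 2)); [apply continuous_snd | apply Hp].
    - apply continuous_Rinv, Rgt_not_eq, (Hsq x y Hx). }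
  apply (is_derive_Cauchy_Riemann (fun x y => ln (x ^ 2 + y ^ 2) / 2) (fun x y => atan (y / x))
    (fun x y => x / (x ^ 2 + y ^ 2)) (fun x y => - y / (x ^ 2 + y ^ 2))).
  - generalize (locally_Re_pos (x, y) Hx). apply filter_imp. intros [s t] Hs. cbn [Re fst snd] in *.
    specialize (Hsq s t Hs). simpl in Hsq. split; auto_derive; try lra; simpl; field; lra.
  - specialize (Hsq x y Hx). simpl in Hsq. auto_derive; [lra|]. simpl. field. lra.
  - specialize (Hsq x y Hx). simpl in Hsq. auto_derive; [lra|]. simpl. field. lra.
  - apply Hc, continuous_fst.
  - apply (Hc (fun z => - snd z)), (continuous_opp (V := R_NormedModule)), continuous_snd.
Qed.

(** * Taylor coefficients *)

Lemma smooth_circle (r : R) : smooth_curve (circle r) (fun t => Ci * circle r t)%C.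
Proof.
  assert (D : forall t, is_derive (circle r) t (Ci * circle r t)%C).
  { intros t. replace (Ci * circle r t)%C with ((- r * sin t, r * cos t) : C)
      by (apply injective_projections; simpl; ring).
    apply (filterdiff_pair (fun t => r * cos t) (fun t => r * sin t) t
      (fun h => scal h (- r * sin t)) (fun h => scal h (r * cos t))).
    - change (is_derive (fun t => r * cos t) t (- r * sin t)). auto_derive; trivial. ring.
    - change (is_derive (fun t => r * sin t) t (r * cos t)). auto_derive; trivial. ring. }
  intros t. split; [apply D|]. apply continuous_Cmult; [apply continuous_const|].
  apply (ex_derive_continuous (circle r)). eexists. apply D.
Qed.

Definition circle_integral (f : C -> C) (r : R) : C :=
  contour_integral f (circle r) (fun t => Ci * circle r t)%C (- PI) PI.

Lemma circle_integral_radius (f : C -> C) (r s : R) : 0 < r <= s ->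
  holomorphic_on (fun v => r <= Cmod v <= s) f -> circle_integral f r = circle_integral f s.
Proof.
  (* The substitution [v = Cexp u] turns the annulus into a rectangle. *)
  intros Hrs Hf. set (h := fun u => (f (Cexp u) * Cexp u)%C).
  assert (Hver : forall q, 0 < q -> ver_integral h (ln q) (- PI) PI = circle_integral f q).
  { intros q Hq. apply (@RInt_ext C_R_CompleteNormedModule). intros t _. unfold h, ver.
    rewrite Cexp_ln by assumption. C_ring. }
  assert (Hhor : hor_integral h (- PI) (ln r) (ln s) = hor_integral h PI (ln r) (ln s)).
  { apply (@RInt_ext C_R_CompleteNormedModule). intros x _. unfold h, hor, Cexp. simpl.
    now rewrite cos_neg, sin_neg, sin_PI, Ropp_0. }
  assert (Hrect : rect_integral h (ln r) (ln s) (- PI) PI = 0).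
  { pose proof PI_RGT_0. apply goursat; [apply ln_le; lra | lra |].
    assert (Hexp : holomorphic_on (rectangle (ln r) (ln s) (- PI) PI) Cexp).
    { intros u _. eexists. apply is_derive_Cexp. }
    apply holomorphic_on_mult; [|exact Hexp].
    apply (holomorphic_on_comp _ Cexp Hexp (fun v => r <= Cmod v <= s) f Hf).
    intros u [Hu _]. rewrite Cmod_Cexp, <- (exp_ln r), <- (exp_ln s) by lra. split; apply exp_le; lra. }
  unfold rect_integral in Hrect. rewrite Hhor, !Hver in Hrect by lra.
  symmetry. apply Ceq_minus. rewrite <- Hrect. ring.
Qed.

Definition taylor_coeff (f : C -> C) (r : R) (n : nat) : C :=
  (/ (2 * PI * Ci) * circle_integral (fun v => f v * (/ v) ^ S n)%C r)%C.

Definition open_disc (rho : R) (v : C) : Prop := Cmod v < rho.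

Lemma PI_Ci_neq_0 : (2 * PI * Ci)%C <> 0.
Proof.
  pose proof PI_RGT_0. rewrite <- RtoC_mult. apply Cmult_neq_0; [apply RtoC_neq_0; lra | exact Ci_nz].
Qed.

Section TaylorCoefficients.

Variables (f : C -> C) (rho : R).
Hypothesis holo_f : holomorphic_on (open_disc rho) f.

Lemma holomorphic_mult_inv_pow (n : nat) :
  holomorphic_on (fun v => v <> 0 /\ open_disc rho v) (fun v => f v * (/ v) ^ n)%C.
Proof.
  apply holomorphic_on_mult; [intros v [_ Hv]; now apply holo_f|].
  apply (holomorphic_on_pow _ Cinv). intros v [Hv _]. now apply holomorphic_on_Cinv.
Qed.

Lemma continuous_mult_inv_pow (n : nat) (r t : R) : 0 < r < rho ->
  continuous (fun v => f v * (/ v) ^ n)%C (circle r t).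
Proof.
  intros Hr. apply (holomorphic_on_continuous _ _ (holomorphic_mult_inv_pow n)). split.
  - apply circle_neq_0; lra.
  - unfold open_disc. rewrite Cmod_circle; lra.
Qed.

Lemma taylor_coeff_radius (r s : R) (n : nat) : 0 < r < rho -> 0 < s < rho ->
  taylor_coeff f r n = taylor_coeff f s n.
Proof.
  assert (Hle : forall p q, 0 < p <= q -> q < rho -> taylor_coeff f p n = taylor_coeff f q n).
  { intros p q Hpq Hq. unfold taylor_coeff. f_equal. apply circle_integral_radius; [assumption|].
    intros v Hv. apply holomorphic_mult_inv_pow. split; [apply Cmod_gt_0; lra | unfold open_disc; lra]. }
  intros Hr Hs. destruct (Rle_dec r s); [|symmetry]; apply Hle; lra.
Qed.

Lemma taylor_coeff_Cmod_le (r : R) (n : nat) (h : R -> R) (m : R) : 0 < r < rho ->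
  (forall t, - PI <= t <= PI -> Cmod (f (circle r t)) <= h t) -> is_RInt h (- PI) PI m ->
  Cmod (taylor_coeff f r n) <= (/ r) ^ n * (m / (2 * PI)).
Proof.
  intros Hr Hh Hm. pose proof PI_RGT_0 as Hpi.
  assert (Hi : Cmod (circle_integral (fun v => f v * (/ v) ^ S n)%C r) <= (/ r) ^ n * m).
  { eapply (is_RInt_Cmod_le _ (fun t => scal ((/ r) ^ n) (h t)) (- PI) PI); [lra | | |].
    2: { apply contour_integral_correct; [apply smooth_circle|].
         intros t _. now apply continuous_mult_inv_pow. }
    - intros t Ht. cbv beta. rewrite Cpow_S.
      replace (f (circle r t) * (/ circle r t * (/ circle r t) ^ n) * (Ci * circle r t))%C
        with ((/ circle r t) ^ n * f (circle r t) * Ci)%C by (field; apply circle_neq_0; lra).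
      rewrite !Cmod_mult, Cmod_pow, Cmod_inv, Cmod_circle, Cmod_Ci by (lra || (apply circle_neq_0; lra)).
      rewrite Rmult_1_r. apply Rmult_le_compat_l; [|now apply Hh].
      apply pow_le, Rlt_le, Rinv_0_lt_compat. lra.
    - exact (is_RInt_scal h (- PI) PI ((/ r) ^ n) m Hm). }
  unfold taylor_coeff. rewrite Cmod_mult, Cmod_inv by exact PI_Ci_neq_0.
  rewrite !Cmod_mult, !Cmod_R, Cmod_Ci, !Rabs_pos_eq, Rmult_1_r by lra.
  rewrite Rmult_comm. unfold Rdiv. rewrite <- Rmult_assoc.
  apply Rmult_le_compat_r; [apply Rlt_le, Rinv_0_lt_compat; lra | assumption].
Qed.

Lemma cauchy_inequality (r M : R) (n : nat) : 0 < r < rho ->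
  (forall v, Cmod v = r -> Cmod (f v) <= M) -> Cmod (taylor_coeff f r n) <= (/ r) ^ n * M.
Proof.
  intros Hr HM. pose proof PI_RGT_0 as Hpi.
  replace M with (scal (PI - - PI) M / (2 * PI)) by (unfold scal; simpl; unfold mult; simpl; field; lra).
  apply taylor_coeff_Cmod_le with (h := fun _ => M); [assumption | | apply @is_RInt_const].
  intros t _. apply HM, Cmod_circle. lra.
Qed.

Lemma taylor_coeff_eq_0 (r M d : R) (n : nat) : 0 < r < rho -> 0 < d ->
  (forall v, Cmod v < d -> Cmod (f v) <= M * Cmod v ^ S n) -> taylor_coeff f r n = 0.
Proof.
  intros Hr Hd HM. apply Cmod_eq_0, Rle_antisym; [|apply Cmod_ge_0].
  apply le_epsilon. intros e He. rewrite Rplus_0_l.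
  set (q := Rmin (Rmin r (d / 2)) (e / (Rabs M + 1))).
  pose proof (Rabs_pos M) as HM0. pose proof (Rle_abs M) as HM1.
  assert (Hq : 0 < q) by (repeat apply Rmin_pos; try apply Rdiv_lt_0_compat; lra).
  assert (Hqr : q <= r) by (eapply Rle_trans; apply Rmin_l).
  assert (Hqd : q <= d / 2) by (eapply Rle_trans; [apply Rmin_l | apply Rmin_r]).
  assert (Hqe : q <= e / (Rabs M + 1)) by apply Rmin_r.
  rewrite (taylor_coeff_radius r q n) by lra.
  apply Rle_trans with ((/ q) ^ n * (M * q ^ S n)).
  { apply cauchy_inequality; [lra|]. intros v <-. apply HM. lra. }
  replace ((/ q) ^ n * (M * q ^ S n)) with (M * q)
    by (rewrite pow_inv; simpl; field; apply pow_nonzero; lra).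
  apply Rle_div_r in Hqe; [|lra]. nra.
Qed.

End TaylorCoefficients.

Section TaylorCoefficientAlgebra.

Variables (f g : C -> C) (rho r : R).
Hypothesis holo_f : holomorphic_on (open_disc rho) f.
Hypothesis holo_g : holomorphic_on (open_disc rho) g.
Hypothesis r_range : 0 < r < rho.

Lemma taylor_coeff_plus (n : nat) :
  taylor_coeff (fun v => f v + g v)%C r n = (taylor_coeff f r n + taylor_coeff g r n)%C.
Proof.
  unfold taylor_coeff. rewrite <- Cmult_plus_distr_l. f_equal.
  unfold circle_integral. rewrite <- contour_integral_plus.
  - apply (@RInt_ext C_R_CompleteNormedModule). intros t _. C_ring.
  - apply smooth_circle.
  - intros t _. now apply (continuous_mult_inv_pow f rho).
  - intros t _. now apply (continuous_mult_inv_pow g rho).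
Qed.

Lemma taylor_coeff_scal (c : C) (n : nat) :
  taylor_coeff (fun v => c * f v)%C r n = (c * taylor_coeff f r n)%C.
Proof.
  unfold taylor_coeff.
  transitivity (/ (2 * PI * Ci) * (c * circle_integral (fun v => f v * (/ v) ^ S n) r))%C;
    [f_equal | ring].
  unfold circle_integral. rewrite <- contour_integral_scal.
  - apply (@RInt_ext C_R_CompleteNormedModule). intros t _. C_ring.
  - apply smooth_circle.
  - intros t _. now apply (continuous_mult_inv_pow f rho).
Qed.

Lemma taylor_coeff_minus (n : nat) :
  taylor_coeff (fun v => f v - g v)%C r n = (taylor_coeff f r n - taylor_coeff g r n)%C.
Proof.
  unfold taylor_coeff.
  transitivity (/ (2 * PI * Ci) * (circle_integral (fun v => f v * (/ v) ^ S n) r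
    - circle_integral (fun v => g v * (/ v) ^ S n) r))%C; [f_equal | ring].
  unfold circle_integral. rewrite <- contour_integral_minus.
  - apply (@RInt_ext C_R_CompleteNormedModule). intros t _. C_ring.
  - apply smooth_circle.
  - intros t _. now apply (continuous_mult_inv_pow f rho).
  - intros t _. now apply (continuous_mult_inv_pow g rho).
Qed.

Lemma taylor_coeff_eq_near (M d : R) (n : nat) : 0 < d ->
  (forall v, Cmod v < d -> Cmod (f v - g v)%C <= M * Cmod v ^ S n) ->
  taylor_coeff f r n = taylor_coeff g r n.
Proof.
  intros Hd HM. apply Ceq_minus. rewrite <- taylor_coeff_minus.
  apply (taylor_coeff_eq_0 _ rho (holomorphic_on_minus _ f g holo_f holo_g) r M d n); assumption.
Qed.

End TaylorCoefficientAlgebra.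

Lemma taylor_coeff_ext (f g : C -> C) (rho r : R) (n : nat) : 0 < r < rho ->
  (forall v, open_disc rho v -> f v = g v) -> taylor_coeff f r n = taylor_coeff g r n.
Proof.
  intros Hr Hfg. unfold taylor_coeff. f_equal. apply (@RInt_ext C_R_CompleteNormedModule).
  intros t _. rewrite Hfg; [reflexivity|]. unfold open_disc. rewrite Cmod_circle; lra.
Qed.

Lemma taylor_coeff_const (c : C) (r : R) : 0 < r -> taylor_coeff (fun _ => c) r 0 = c.
Proof.
  intros Hr. unfold taylor_coeff, circle_integral, contour_integral.
  rewrite (@is_RInt_unique C_R_CompleteNormedModule _ _ _ (2 * PI * Ci * c)%C).
  - field. split; [exact Ci_nz | apply RtoC_neq_0, PI_neq0].
  - apply (is_RInt_ext (fun _ => (c * Ci)%C : C_R_NormedModule)).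
    + intros t _. simpl. C_field. apply circle_neq_0, Hr.
    + replace (2 * PI * Ci * c)%C with (scal (V := C_R_NormedModule) (PI - - PI) (c * Ci)%C).
      * apply @is_RInt_const.
      * rewrite scal_R_Cmult. replace (PI - - PI) with (2 * PI) by ring. rewrite RtoC_mult. C_ring.
Qed.

Lemma taylor_coeff_0 (f : C -> C) (rho r : R) : holomorphic_on (open_disc rho) f -> 0 < r < rho ->
  taylor_coeff f r 0 = f 0.
Proof.
  intros Hf Hr. rewrite <- (taylor_coeff_const (f 0) r) by lra.
  destruct (Hf 0) as [l Hl]; [unfold open_disc; rewrite Cmod_0; lra|].
  destruct (proj1 (locally_Cmod _ _) (proj1 (is_derive_Cmod f 0 l) Hl 1 Rlt_0_1)) as (d & Hd & Hfd).
  apply (taylor_coeff_eq_near f (fun _ => f 0) rho r Hf (holomorphic_on_const _ _) Hr (1 + Cmod l) d 0 Hd).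
  intros v Hv. specialize (Hfd v). replace (v - 0)%C with v in Hfd by ring. specialize (Hfd Hv).
  replace (f v - f 0)%C with ((f v - f 0 - l * v) + l * v)%C by ring.
  eapply Rle_trans; [apply Cmod_triangle|]. rewrite Cmod_mult. simpl. lra.
Qed.

Lemma taylor_coeff_mult_id (f : C -> C) (r : R) (n : nat) : 0 < r ->
  taylor_coeff (fun v => v * f v)%C r (S n) = taylor_coeff f r n.
Proof.
  intros Hr. unfold taylor_coeff. f_equal. apply (@RInt_ext C_R_CompleteNormedModule).
  intros t _. rewrite (Cpow_S _ (S n)). C_field. apply circle_neq_0, Hr.
Qed.

Section TaylorCoefficientDerivative.

Variables (f f' : C -> C) (rho r : R).
Hypothesis derive_f : forall v, open_disc rho v -> is_derive f v (f' v).
Hypothesis holo_f' : holomorphic_on (open_disc rho) f'.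
Hypothesis r_range : 0 < r < rho.

(* Integrate the derivative of [f v * v ^ - n] over the circle. *)
Lemma taylor_coeff_euler (n : nat) :
  taylor_coeff (fun v => v * f' v)%C r n = (INR n * taylor_coeff f r n)%C.
Proof.
  assert (holo_f : holomorphic_on (open_disc rho) f) by (intros v Hv; eexists; now apply derive_f).
  assert (Hcirc : forall t, circle r t <> 0 /\ open_disc rho (circle r t)).
  { intros t. split; [apply circle_neq_0 | unfold open_disc; rewrite Cmod_circle]; lra. }
  assert (holo_vf' : holomorphic_on (open_disc rho) (fun v => v * f' v)%C)
    by (apply holomorphic_on_mult; [apply holomorphic_on_id | exact holo_f']).
  assert (holo_nf : holomorphic_on (open_disc rho) (fun v => INR n * f v)%C)
    by (apply holomorphic_on_mult; [apply holomorphic_on_const | exact holo_f]).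
  apply Ceq_minus. rewrite <- (taylor_coeff_scal f rho), <- (taylor_coeff_minus _ _ rho) by assumption.
  unfold taylor_coeff, circle_integral.
  rewrite (contour_integral_derive _ _ _ _ (smooth_circle r) (fun v => f v * (/ v) ^ n)%C).
  - replace (circle r (- PI)) with (circle r PI); [ring|].
    unfold circle. now rewrite cos_neg, sin_neg, sin_PI, Ropp_0.
  - intros t _. destruct (Hcirc t) as [Hv0 Hv]. destruct n as [|n]; evar_last.
    + exact (is_derive_Cmult f _ _ _ _ (derive_f _ Hv) (is_derive_Cconst 1 _)).
    + simpl. C_field. assumption.
    + exact (is_derive_Cmult f _ _ _ _ (derive_f _ Hv) (is_derive_Cpow _ _ _ n (is_derive_Cinv _ Hv0))).
    + rewrite !Cpow_S. C_field. assumption.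
  - intros t _. apply (continuous_mult_inv_pow (fun v => v * f' v - INR n * f v)%C rho); [|assumption].
    now apply holomorphic_on_minus.
Qed.

Lemma taylor_coeff_derive (n : nat) : taylor_coeff f' r n = (INR (S n) * taylor_coeff f r (S n))%C.
Proof. rewrite <- taylor_coeff_euler. symmetry. apply taylor_coeff_mult_id. lra. Qed.

End TaylorCoefficientDerivative.

Lemma Re_1_minus_pos (v : C) : open_disc 1 v -> 0 < Re (1 - v)%C.
Proof. intros Hv. pose proof (Re_le_Cmod v). unfold open_disc in Hv. simpl. unfold Re in *. lra. Qed.

Lemma open_disc_1_minus_neq_0 (v : C) : open_disc 1 v -> (1 - v)%C <> 0.
Proof. intros Hv. now apply Re_pos_neq_0, Re_1_minus_pos. Qed.

Lemma taylor_coeff_recurrence (f h : C -> C) (w : C) (r : R) (n : nat) :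
  (forall v, open_disc 1 v -> is_derive f v ((w * f v - h v) / (1 - v))%C) ->
  holomorphic_on (open_disc 1) h -> 0 < r < 1 ->
  (INR (S n) * taylor_coeff f r (S n))%C
  = ((w + INR n) * taylor_coeff f r n - taylor_coeff h r n)%C.
Proof.
  intros Df Hh Hr. set (f' := fun v => ((w * f v - h v) / (1 - v))%C).
  assert (Hf : holomorphic_on (open_disc 1) f) by (intros v Hv; eexists; now apply Df).
  assert (Hwf : holomorphic_on (open_disc 1) (fun v => w * f v)%C)
    by (apply holomorphic_on_mult; [apply holomorphic_on_const | exact Hf]).
  assert (Hinv : holomorphic_on (open_disc 1) (fun v => / (1 - v))%C).
  { apply (holomorphic_on_comp _ (fun v => 1 - v)%C) with (2 := holomorphic_on_Cinv).
    - apply holomorphic_on_minus; [apply holomorphic_on_const | apply holomorphic_on_id].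
    - apply open_disc_1_minus_neq_0. }
  assert (Hf' : holomorphic_on (open_disc 1) f').
  { apply holomorphic_on_mult; [now apply holomorphic_on_minus | exact Hinv]. }
  assert (Hvf' : holomorphic_on (open_disc 1) (fun v => v * f' v)%C)
    by (apply holomorphic_on_mult; [apply holomorphic_on_id | exact Hf']).
  assert (E : taylor_coeff (fun v => f' v - v * f' v)%C r n = taylor_coeff (fun v => w * f v - h v)%C r n).
  { apply (taylor_coeff_ext _ _ 1); [assumption|]. intros v Hv. unfold f'. field.
    now apply open_disc_1_minus_neq_0. }
  rewrite !(taylor_coeff_minus _ _ 1), (taylor_coeff_scal f 1), (taylor_coeff_euler f f' 1),
    (taylor_coeff_derive f f' 1) in E by assumption.
  replace (w + INR n)%C with (INR n + w)%C by ring. rewrite Cmult_plus_distr_r.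
  apply Ceq_minus. apply Ceq_minus in E. rewrite <- E. ring.
Qed.

(** * Ratios of rising factorials *)

Fixpoint Rpochhammer (x : R) (n : nat) : R :=
  match n with O => 1 | S m => Rpochhammer x m * (x + INR m) end.

Lemma Rpochhammer_pos (x : R) (n : nat) : 0 < x -> 0 < Rpochhammer x n.
Proof.
  intros Hx. induction n as [|n IH]; simpl; [lra|].
  pose proof (pos_INR n). apply Rmult_lt_0_compat; lra.
Qed.

Lemma Rpochhammer_1 (n : nat) : Rpochhammer 1 n = INR (fact n).
Proof.
  induction n as [|n IH]; [reflexivity|].
  rewrite fact_simpl, mult_INR, S_INR, <- IH. simpl. ring.
Qed.

Lemma Rpower_succ_le (x p : R) : 0 <= p < x -> Rpower ((x + 1) / x) p <= x / (x - p).
Proof.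
  intros Hp. replace ((x + 1) / x) with (1 + / x) by (field; lra).
  assert (Hx : 0 < / x) by (apply Rinv_0_lt_compat; lra).
  assert (Hln : ln (1 + / x) <= / x).
  { rewrite <- (ln_exp (/ x)) at 2. apply ln_le; [lra | apply exp_ineq1_le]. }
  apply Rle_trans with (exp (p / x)).
  { apply exp_le, Rmult_le_compat_l; lra. }
  replace (x / (x - p)) with (/ (1 + - (p / x))) by (field; lra).
  rewrite <- (Ropp_involutive (p / x)) at 1. rewrite exp_Ropp. apply Rinv_le_contravar.
  - replace (1 + - (p / x)) with ((x - p) / x) by (field; lra). apply Rdiv_lt_0_compat; lra.
  - apply exp_ineq1_le.
Qed.

Lemma Rpochhammer_ratio (a b : R) (n : nat) : 0 < a <= b ->
  Rpower ((b + INR n) / b) (b - a) * Rpochhammer a n <= Rpochhammer b n.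
Proof.
  intros Hab. induction n as [|n IH].
  - simpl. rewrite Rplus_0_r, Rdiv_diag by lra. unfold Rpower. rewrite ln_1, Rmult_0_r, exp_0. lra.
  - pose proof (pos_INR n) as Hn. rewrite S_INR. cbn [Rpochhammer].
    replace ((b + (INR n + 1)) / b) with ((b + INR n) / b * ((b + INR n + 1) / (b + INR n)))
      by (field; lra).
    rewrite <- Rpower_mult_distr by (apply Rdiv_lt_0_compat; lra).
    assert (Hs : Rpower ((b + INR n + 1) / (b + INR n)) (b - a) * (a + INR n) <= b + INR n).
    { apply Rle_div_r; [lra|]. replace (a + INR n) with (b + INR n - (b - a)) by ring.
      apply Rpower_succ_le. lra. }
    apply Rle_trans with (Rpower ((b + INR n) / b) (b - a) * Rpochhammer a n * (b + INR n)).
    + rewrite !Rmult_assoc. apply Rmult_le_compat_l; [apply Rlt_le, exp_pos|].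
      rewrite <- Rmult_assoc, (Rmult_comm _ (Rpochhammer a n)), Rmult_assoc.
      apply Rmult_le_compat_l; [apply Rlt_le, Rpochhammer_pos; lra | exact Hs].
    + apply Rmult_le_compat_r; [lra | exact IH].
Qed.

Lemma Rpower_le_Rpochhammer (c : R) (n : nat) : 1 <= c ->
  Rpower (INR n + 2) (c - 1) <= Rpower (2 * c) (c - 1) * (Rpochhammer c n / INR (fact n)).
Proof.
  intros Hc. pose proof (pos_INR n) as Hn. pose proof (INR_fact_lt_0 n) as Hfact.
  pose proof (Rpochhammer_ratio 1 c n ltac:(lra)) as Hratio. rewrite Rpochhammer_1 in Hratio.
  apply Rle_trans with (Rpower (2 * c) (c - 1) * Rpower ((c + INR n) / c) (c - 1)).
  - rewrite Rpower_mult_distr by (lra || apply Rdiv_lt_0_compat; lra).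
    apply Rle_Rpower_l; [lra|]. split; [lra|].
    replace (2 * c * ((c + INR n) / c)) with (2 * (c + INR n)) by (field; lra). lra.
  - apply Rmult_le_compat_l; [apply Rlt_le, exp_pos|]. now apply Rle_div_r.
Qed.

Lemma Rpower_lim_p_infty (p : R) : 0 < p ->
  filterlim (fun x => Rpower x p) (Rbar_locally p_infty) (Rbar_locally p_infty).
Proof.
  intros Hp P [M HM]. set (m := Rmax M 1). pose proof (Rmax_l M 1). pose proof (Rmax_r M 1).
  exists (Rpower m (/ p)). intros x Hx. apply HM. apply Rle_lt_trans with m; [assumption|].
  rewrite <- (Rpower_1 m), <- (Rinv_l p), <- Rpower_mult by (unfold m; lra).
  apply Rlt_Rpower_l; [assumption|]. split; [apply exp_pos | assumption].
Qed.

Lemma Rpower_lim_0 (p : R) : 0 < p -> filterlim (fun x => Rpower x p) (at_right 0) (locally 0).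
Proof.
  intros Hp. apply filterlim_locally. intros e.
  exists (mkposreal (Rpower e (/ p)) (exp_pos _)). intros x Hx Hx0.
  unfold ball in *; simpl in *; unfold AbsRing_ball, abs, minus, plus, opp in *; simpl in *.
  rewrite Ropp_0, Rplus_0_r in *. rewrite Rabs_pos_eq in * by (apply Rlt_le; apply exp_pos || assumption).
  rewrite <- (Rpower_1 e), <- (Rinv_l p), <- Rpower_mult by (apply cond_pos || lra).
  now apply Rlt_Rpower_l.
Qed.

Lemma Rpochhammer_ratio_vanishes (a b : R) : 0 < a < b ->
  is_lim_seq (fun n => Rpochhammer a n / Rpochhammer b n) 0.
Proof.
  intros Hab.
  apply (is_lim_seq_le_le (fun _ => 0) _ (fun n => / Rpower ((b + INR n) / b) (b - a))).
  - intros n. pose proof (Rpochhammer_pos a n ltac:(lra)). pose proof (Rpochhammer_pos b n ltac:(lra)).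
    split; [apply Rdiv_le_0_compat; lra|].
    apply Rle_div_l; [assumption|].
    apply Rmult_le_reg_l with (Rpower ((b + INR n) / b) (b - a)); [apply exp_pos|].
    rewrite <- Rmult_assoc, Rinv_r, Rmult_1_l by (apply Rgt_not_eq, exp_pos).
    apply Rpochhammer_ratio. lra.
  - apply is_lim_seq_const.
  - replace (Finite 0) with (Rbar_inv p_infty) by reflexivity. apply is_lim_seq_inv; [|discriminate].
    apply (filterlim_comp _ _ _ (fun n => (b + INR n) / b) (fun x => Rpower x (b - a)) _
      (Rbar_locally p_infty)).
    + intros P [M HM]. destruct (INR_unbounded (M * b)) as [N HN]. exists N. intros n Hn. apply HM.
      apply le_INR in Hn. apply Rlt_div_r; lra.
    + apply Rpower_lim_p_infty. lra.
Qed.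

Lemma ex_series_Rpochhammer_ratio (a b : R) : 0 < a < b ->
  ex_series (fun n => Rpochhammer a n / Rpochhammer b (S n)).
Proof.
  intros Hab. exists (/ (b - a)). set (u n := Rpochhammer a n / Rpochhammer b n).
  change (is_lim_seq (sum_n (fun n => Rpochhammer a n / Rpochhammer b (S n))) (/ (b - a))).
  apply (is_lim_seq_ext (fun n => / (b - a) * (1 - u (S n)))).
  - intros n. induction n as [|n IH].
    + rewrite sum_O. unfold u. simpl. field. lra.
    + rewrite sum_Sn, <- IH. unfold u. change plus with Rplus.
      pose proof (pos_INR (S n)). pose proof (Rpochhammer_pos b (S n) ltac:(lra)).
      change (Rpochhammer a (S (S n))) with (Rpochhammer a (S n) * (a + INR (S n))).
      change (Rpochhammer b (S (S n))) with (Rpochhammer b (S n) * (b + INR (S n))).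
      field. repeat split; lra.
  - replace (Finite (/ (b - a))) with (Rbar_mult (/ (b - a)) (1 - 0)) by (simpl; f_equal; ring).
    apply is_lim_seq_scal_l. apply is_lim_seq_minus'; [apply is_lim_seq_const|].
    apply -> (is_lim_seq_incr_1 u). now apply Rpochhammer_ratio_vanishes.
Qed.

(** * Logarithmic growth on the unit disc *)

Lemma is_RInt_Clog_1m (v : C) : open_disc 1 v ->
  is_RInt (fun t => / (1 - RtoC t * v) * - v)%C 0 1 (Clog (1 - v)%C).
Proof.
  unfold open_disc. intros Hv. set (g := fun t : R => (1 - RtoC t * v)%C).
  assert (Hre : forall t, 0 <= t <= 1 -> 0 < Re (g t)).
  { intros t Ht. apply Re_1_minus_pos. unfold open_disc.
    rewrite Cmod_mult, Cmod_R, Rabs_pos_eq by lra. pose proof (Cmod_ge_0 v). nra. }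
  assert (Sg : smooth_curve g (fun _ => - v)%C).
  { intros t. split; [|apply continuous_const].
    evar_last.
    - apply (is_derive_curve_comp (fun u => 1 - u * v)%C (hor 0)); [|apply is_derive_hor].
      apply is_derive_Cminus; [apply is_derive_Cconst|].
      apply is_derive_Cmult; [apply is_derive_Cid | apply is_derive_Cconst].
    - C_ring. }
  assert (Cinv_g : forall t, Rmin 0 1 <= t <= Rmax 0 1 -> continuous Cinv (g t)).
  { rewrite Rmin_left, Rmax_right by lra. intros t Ht.
    apply (holomorphic_on_continuous _ _ holomorphic_on_Cinv), Re_pos_neq_0, Hre, Ht. }
  replace (Clog (1 - v)%C) with (contour_integral Cinv g (fun _ => - v)%C 0 1).
  - now apply contour_integral_correct.
  - rewrite (contour_integral_derive _ _ _ _ Sg Clog); [|rewrite Rmin_left, Rmax_right by lra | assumption].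
    + unfold g. rewrite Cmult_0_l, Cmult_1_l. replace (1 - 0)%C with (RtoC 1) by ring.
      rewrite Clog_1. ring.
    + intros t Ht. now apply is_derive_Clog, Hre.
Qed.

Lemma is_RInt_ln_1m (x : R) : 0 <= x < 1 -> is_RInt (fun t => x / (1 - t * x)) 0 1 (- ln (1 - x)).
Proof.
  intros Hx. replace (- ln (1 - x)) with (minus (- ln (1 - 1 * x)) (- ln (1 - 0 * x))).
  - apply (@is_RInt_derive R_CompleteNormedModule (fun t => - ln (1 - t * x)));
      rewrite Rmin_left, Rmax_right by lra; intros t Ht; assert (0 < 1 - t * x) by nra.
    + auto_derive; [lra | field; lra].
    + apply (ex_derive_continuous (fun t => x / (1 - t * x))). auto_derive. lra.
  - unfold minus, plus, opp; simpl. rewrite Rmult_0_l, Rminus_0_r, ln_1, Rmult_1_l. ring.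
Qed.

Lemma Cmod_Clog_1m_le (v : C) : open_disc 1 v -> Cmod (Clog (1 - v)%C) <= - ln (1 - Cmod v).
Proof.
  intros Hv. assert (Hv' : 0 <= Cmod v < 1) by (split; [apply Cmod_ge_0 | exact Hv]).
  apply (is_RInt_Cmod_le _ _ 0 1 _ _ Rle_0_1) with (2 := is_RInt_Clog_1m v Hv) (3 := is_RInt_ln_1m _ Hv').
  intros t Ht. assert (Hd : 1 - t * Cmod v <= Cmod (1 - RtoC t * v)%C).
  { pose proof (Cmod_plus_ge 1 (- (RtoC t * v))) as Hge.
    rewrite Cmod_1, Cmod_opp, Cmod_mult, Cmod_R, Rabs_pos_eq in Hge by lra. exact Hge. }
  assert (Hpos : 0 < 1 - t * Cmod v) by nra.
  rewrite Cmod_mult, Cmod_opp, Cmod_inv, Rmult_comm by (apply Cmod_gt_0; lra).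
  apply Rmult_le_compat_l; [apply Cmod_ge_0 | now apply Rinv_le_contravar].
Qed.

Lemma sin_ge_third (w : R) : 0 <= w <= PI / 2 -> w / 3 <= sin w.
Proof.
  intros Hw. pose proof PI_4.
  destruct (sin_bound w 0) as [Hsin _]; [lra | lra |].
  unfold sin_approx, sin_term in Hsin. simpl in Hsin.
  apply Rle_trans with (w - w * w * w / 6); [|eapply Rle_trans; [|exact Hsin]; right; field].
  nra.
Qed.

Lemma Cmod_1_minus_circle_sq (r t : R) :
  Cmod (1 - circle r t)%C ^ 2 = (1 - r) ^ 2 + 4 * r * sin (t / 2) ^ 2.
Proof.
  rewrite Cmod2_alt. unfold circle, Re, Im. simpl.
  assert (Ecos : cos t = 1 - 2 * sin (t / 2) * sin (t / 2)).
  { rewrite <- cos_2a_sin. f_equal. field. }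
  pose proof (sin2_cos2 t) as Epyth. unfold Rsqr in Epyth.
  transitivity ((1 - r) ^ 2 + 2 * r * (1 - cos t) + r ^ 2 * (sin t * sin t + cos t * cos t - 1)); [ring|].
  rewrite Epyth, Ecos. ring.
Qed.

Lemma Cmod_1_minus_circle_ge (r t : R) : / 2 <= r < 1 -> - PI <= t <= PI ->
  (1 - r + Rabs t) / 6 <= Cmod (1 - circle r t)%C.
Proof.
  intros Hr Ht. apply Rsqr_incr_0_var; [|apply Cmod_ge_0].
  rewrite !Rsqr_pow2, Cmod_1_minus_circle_sq. pose proof (Rabs_pos t).
  assert (Esin : sin (t / 2) ^ 2 = sin (Rabs t / 2) ^ 2).
  { unfold Rabs. destruct Rcase_abs; [|reflexivity].
    replace (- t / 2) with (- (t / 2)) by field. rewrite sin_neg. ring. }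
  assert (Hs : Rabs t / 2 / 3 <= sin (Rabs t / 2)).
  { apply sin_ge_third. assert (Rabs t <= PI) by (apply Rabs_le; lra). lra. }
  rewrite Esin.
  pose proof (pow2_ge_0 (1 - r - Rabs t)). nra.
Qed.

Lemma exp_Clog_le (b c : R) (u : C) : 0 < b <= c -> 0 < Re u -> Cmod u <= 2 ->
  exp (b * Cmod (Clog u)) <= exp (c * (2 * ln 2 + 2)) * Rpower (Cmod u) (- c).
Proof.
  intros Hb Hre Hu. assert (Hu0 : 0 < Cmod u) by (apply Cmod_gt_0, Re_pos_neq_0, Hre).
  unfold Rpower. rewrite <- exp_plus. apply exp_le.
  assert (Hln2 : 0 < ln 2) by (rewrite <- ln_1; apply ln_increasing; lra).
  assert (Hlnu : ln (Cmod u) <= ln 2) by (apply ln_le; assumption).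
  assert (Hlog : Cmod (Clog u) <= 2 * ln 2 - ln (Cmod u) + 2).
  { eapply Rle_trans; [apply Cmod_le_Re_Im|]. unfold Clog. cbn [Re Im fst snd].
    apply Rplus_le_compat; [apply Rabs_le; lra|].
    rewrite Carg_right by assumption. pose proof (atan_bound (Im u / Re u)). pose proof PI_4.
    apply Rabs_le; lra. }
  pose proof (Cmod_ge_0 (Clog u)).
  apply Rle_trans with (c * Cmod (Clog u)); [apply Rmult_le_compat_r; lra|].
  apply Rle_trans with (c * (2 * ln 2 - ln (Cmod u) + 2)); [apply Rmult_le_compat_l; lra | lra].
Qed.

Lemma is_RInt_Rpower_shift (c d T : R) : 1 < c -> 0 < d -> 0 <= T ->
  is_RInt (fun t => Rpower (d + Rabs t) (- c)) 0 T
    ((Rpower d (1 - c) - Rpower (d + T) (1 - c)) / (c - 1)).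
Proof.
  intros Hc Hd HT.
  apply (is_RInt_ext (fun t => Rpower (d + t) (- c))).
  { intros t. rewrite Rmin_left by assumption. intros Ht. now rewrite Rabs_pos_eq by lra. }
  replace ((Rpower d (1 - c) - Rpower (d + T) (1 - c)) / (c - 1))
    with (minus (Rpower (d + T) (1 - c) / (1 - c)) (Rpower (d + 0) (1 - c) / (1 - c)))
    by (unfold minus, plus, opp; simpl; rewrite Rplus_0_r; field; lra).
  apply (@is_RInt_derive R_CompleteNormedModule (fun t => Rpower (d + t) (1 - c) / (1 - c)));
    rewrite Rmin_left, Rmax_right by assumption; intros t Ht; unfold Rpower.
  - auto_derive; [lra|].
    replace (exp (- c * ln (d + t))) with (exp ((1 - c) * ln (d + t)) / (d + t)).
    + unfold Rminus. field. lra.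
    + rewrite <- (exp_ln (d + t)) at 2 by lra. unfold Rdiv. rewrite <- exp_Ropp, <- exp_plus. f_equal. ring.
  - apply (ex_derive_continuous (fun t => exp (- c * ln (d + t)))). auto_derive. lra.
Qed.

Lemma is_RInt_Rpower_abs (c d T : R) : 1 < c -> 0 < d -> 0 <= T ->
  exists m, is_RInt (fun t => Rpower (d + Rabs t) (- c)) (- T) T m /\
    m <= 2 / (c - 1) * Rpower d (1 - c).
Proof.
  intros Hc Hd HT. pose proof (is_RInt_Rpower_shift c d T Hc Hd HT) as Hr.
  set (m := (Rpower d (1 - c) - Rpower (d + T) (1 - c)) / (c - 1)) in *.
  exists (m + m). split.
  - apply (is_RInt_Chasles (V := R_NormedModule) _ _ 0); [|exact Hr].
    replace m with (opp (opp m)) by apply opp_opp.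
    apply (is_RInt_ext (fun t => opp (opp (Rpower (d + Rabs (- t)) (- c))))).
    { intros t _. now rewrite opp_opp, Rabs_Ropp. }
    apply (is_RInt_opp (V := R_NormedModule)).
    apply (is_RInt_comp_opp (V := R_NormedModule) (fun t => Rpower (d + Rabs t) (- c))).
    rewrite Ropp_involutive, Ropp_0. now apply (is_RInt_swap (V := R_NormedModule)).
  - unfold m. assert (0 < Rpower (d + T) (1 - c) / (c - 1)).
    { apply Rdiv_lt_0_compat; [apply exp_pos | lra]. }
    unfold Rdiv in *. lra.
Qed.

Lemma Rpower_opp_le (x y k c : R) : 0 < x -> 0 < y -> 0 < k -> 0 <= c -> x <= k * y ->
  Rpower y (- c) <= Rpower k c * Rpower x (- c).
Proof.
  intros Hx Hy Hk Hc Hle. rewrite !Rpower_Ropp.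
  apply Rmult_le_reg_r with (Rpower x c); [apply exp_pos|].
  rewrite Rmult_assoc, Rinv_l, Rmult_1_r, Rmult_comm by (apply Rgt_not_eq, exp_pos).
  apply Rle_div_l; [apply exp_pos|]. rewrite Rpower_mult_distr by assumption.
  now apply Rle_Rpower_l.
Qed.

Definition log_growth (b K : R) (f : C -> C) : Prop :=
  forall v, open_disc 1 v -> Cmod (f v) <= K * exp (b * Cmod (Clog (1 - v)%C)).

Section LogGrowth.

Variables (f : C -> C) (b K : R).
Hypothesis holo_f : holomorphic_on (open_disc 1) f.
Hypothesis growth_f : log_growth b K f.
Hypothesis b_pos : 0 < b.
Hypothesis K_nonneg : 0 <= K.

Lemma taylor_coeff_log_growth (r s : R) (n : nat) : 0 < r < 1 -> 0 < s < 1 ->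
  Cmod (taylor_coeff f s n) <= (/ r) ^ n * (K * Rpower (1 - r) (- b)).
Proof.
  intros Hr Hs. rewrite (taylor_coeff_radius f 1 holo_f s r n Hs Hr).
  apply (cauchy_inequality f 1 holo_f); [assumption|]. intros v Hv.
  assert (Hd : open_disc 1 v) by (unfold open_disc; lra).
  eapply Rle_trans; [now apply growth_f|]. apply Rmult_le_compat_l; [assumption|].
  pose proof (Cmod_Clog_1m_le v Hd) as Hlog. rewrite Hv in Hlog. apply exp_le. nra.
Qed.

Lemma log_growth_circle (c r t : R) : b <= c -> / 2 <= r < 1 -> - PI <= t <= PI ->
  Cmod (f (circle r t))
  <= K * exp (c * (2 * ln 2 + 2)) * Rpower 6 c * Rpower (1 - r + Rabs t) (- c).
Proof.
  intros Hbc Hr Ht.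
  assert (Hd : open_disc 1 (circle r t)) by (unfold open_disc; rewrite Cmod_circle; lra).
  assert (Hre : 0 < Re (1 - circle r t)%C) by now apply Re_1_minus_pos.
  eapply Rle_trans; [now apply growth_f|]. rewrite !Rmult_assoc.
  apply Rmult_le_compat_l; [assumption|].
  eapply Rle_trans; [apply exp_Clog_le with (c := c); [lra | assumption |]|].
  - unfold Cminus. eapply Rle_trans; [apply Cmod_triangle|]. rewrite Cmod_1, Cmod_opp, Cmod_circle; lra.
  - apply Rmult_le_compat_l; [apply Rlt_le, exp_pos|].
    pose proof (Cmod_1_minus_circle_ge r t Hr Ht). pose proof (Rabs_pos t).
    apply Rpower_opp_le; lra.
Qed.

(* The bound is large only near [v = 1], so its mean over the circle is smaller than its supremum
   by a factor [1 - r]. *)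
Lemma taylor_coeff_log_growth_mean (c : R) : 1 < c -> b <= c ->
  exists M, 0 <= M /\ forall r s n, / 2 <= r < 1 -> 0 < s < 1 ->
    Cmod (taylor_coeff f s n) <= (/ r) ^ n * (M * Rpower (1 - r) (1 - c)).
Proof.
  intros Hc Hbc. pose proof PI_RGT_0 as Hpi.
  set (k := K * exp (c * (2 * ln 2 + 2)) * Rpower 6 c).
  assert (Hk : 0 <= k) by (repeat apply Rmult_le_pos; try apply Rlt_le, exp_pos; assumption).
  exists (k * (2 / (c - 1)) / (2 * PI)). split.
  { apply Rdiv_le_0_compat; [|lra]. apply Rmult_le_pos; [assumption|]. apply Rdiv_le_0_compat; lra. }
  intros r s n Hr Hs.
  destruct (is_RInt_Rpower_abs c (1 - r) PI Hc ltac:(lra) ltac:(lra)) as (m & Hm & Hle).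
  rewrite (taylor_coeff_radius f 1 holo_f s r n Hs) by lra.
  eapply Rle_trans.
  - apply (taylor_coeff_Cmod_le f 1 holo_f r n (fun t => k * Rpower (1 - r + Rabs t) (- c)) (k * m)).
    + lra.
    + intros t Ht. now apply log_growth_circle.
    + exact (is_RInt_scal _ _ _ k _ Hm).
  - apply Rmult_le_compat_l; [apply pow_le, Rlt_le, Rinv_0_lt_compat; lra|].
    apply Rle_div_l; [lra|].
    replace (k * (2 / (c - 1)) / (2 * PI) * Rpower (1 - r) (1 - c) * (2 * PI))
      with (k * (2 / (c - 1) * Rpower (1 - r) (1 - c))) by (field; lra).
    now apply Rmult_le_compat_l.
Qed.

Lemma taylor_coeff_le_Rpochhammer (c : R) : 1 < c -> b <= c ->
  exists M, 0 <= M /\ forall s n, 0 < s < 1 ->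
    Cmod (taylor_coeff f s n) <= M * (Rpochhammer c n / INR (fact n)).
Proof.
  intros Hc Hbc. destruct (taylor_coeff_log_growth_mean c Hc Hbc) as (M & HM & Hmean).
  exists (exp 1 * M * Rpower (2 * c) (c - 1)). split.
  { repeat apply Rmult_le_pos; try apply Rlt_le, exp_pos. assumption. }
  intros s n Hs. pose proof (pos_INR n) as Hn.
  set (r := (INR n + 1) / (INR n + 2)).
  assert (Er : 1 - r = / (INR n + 2)) by (unfold r; field; lra).
  assert (Hr : / 2 <= r < 1).
  { assert (0 < / (INR n + 2) <= / 2); [|lra].
    split; [apply Rinv_0_lt_compat | apply Rinv_le_contravar]; lra. }
  eapply Rle_trans; [apply (Hmean r s n Hr Hs)|].
  assert (Hpow : (/ r) ^ n <= exp 1).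
  { replace (/ r) with (1 + / (INR n + 1)) by (unfold r; field; lra).
    assert (0 < / (INR n + 1)) by (apply Rinv_0_lt_compat; lra).
    apply Rle_trans with (exp (/ (INR n + 1)) ^ n).
    - apply pow_incr. split; [lra | apply exp_ineq1_le].
    - rewrite <- Rpower_pow by apply exp_pos. unfold Rpower. rewrite ln_exp. apply exp_le.
      apply Rle_div_l; lra. }
  assert (Hgrow : Rpower (1 - r) (1 - c) <= Rpower (2 * c) (c - 1) * (Rpochhammer c n / INR (fact n))).
  { replace (Rpower (1 - r) (1 - c)) with (Rpower (INR n + 2) (c - 1)).
    - apply Rpower_le_Rpochhammer. lra.
    - unfold Rpower. rewrite Er, ln_Rinv by lra. f_equal. ring. }
  rewrite !Rmult_assoc. apply Rmult_le_compat; [|apply Rmult_le_pos; [assumption | apply Rlt_le, exp_pos]| |].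
  - apply pow_le, Rlt_le, Rinv_0_lt_compat. lra.
  - assumption.
  - now apply Rmult_le_compat_l.
Qed.

End LogGrowth.

(** * Improper integrals *)

Lemma minus_plus_middle {G : AbelianGroup} (a b c : G) : minus (plus a (plus b c)) b = plus a c.
Proof.
  unfold minus. now rewrite (plus_comm b c), plus_assoc, <- (plus_assoc _ b), plus_opp_r, plus_zero_r.
Qed.

Lemma RInt_left_difference (g : R -> R) (x x' y : R) : ex_RInt g x y -> ex_RInt g x' y ->
  ex_RInt g x' x /\ RInt g x' x = RInt g x' y - RInt g x y.
Proof.
  intros Hx Hx'. assert (Hi : ex_RInt g x' x) by exact (ex_RInt_Chasles g x' y x Hx' (ex_RInt_swap g x y Hx)).
  split; [assumption|].
  pose proof (RInt_Chasles g x' x y Hi Hx) as Hsum. unfold plus in Hsum. simpl in Hsum. lra.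
Qed.

Lemma RInt_right_difference (g : R -> R) (x y y' : R) : ex_RInt g x y -> ex_RInt g x y' ->
  ex_RInt g y y' /\ RInt g y y' = RInt g x y' - RInt g x y.
Proof.
  intros Hy Hy'. assert (Hi : ex_RInt g y y') by exact (ex_RInt_Chasles g y x y' (ex_RInt_swap g x y Hy) Hy').
  split; [assumption|].
  pose proof (RInt_Chasles g x y y' Hy Hi) as Hsum. unfold plus in Hsum. simpl in Hsum. lra.
Qed.

Section ImproperIntegrals.

Context {V : CompleteNormedModule R_AbsRing}.
Variables (Fa Fb : (R -> Prop) -> Prop) (D : R -> Prop).
Context {PFa : ProperFilter Fa} {PFb : ProperFilter Fb}.
Hypothesis D_convex : forall x y t, D x -> D y -> x <= t <= y -> D t.
Hypothesis D_Fa : Fa D.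
Hypothesis D_Fb : Fb D.

Lemma convex_between (x y t : R) : D x -> D y -> Rmin x y <= t <= Rmax x y -> D t.
Proof.
  intros Hx Hy. unfold Rmin, Rmax. destruct (Rle_dec x y); [now apply D_convex|].
  now apply (D_convex y x).
Qed.

Lemma filter_prod_domain : filter_prod Fa Fb (fun ab => D (fst ab) /\ D (snd ab)).
Proof. apply Filter_prod with D D; auto. Qed.

Lemma is_RInt_gen_derive (f df : R -> V) (la lb : V) :
  (forall t, D t -> is_derive f t (df t)) -> (forall t, D t -> continuous df t) ->
  filterlim f Fa (locally la) -> filterlim f Fb (locally lb) ->
  is_RInt_gen df Fa Fb (minus lb la).
Proof.
  intros Hf Hdf Ha Hb P HP.
  assert (Hlim : filterlim (fun ab => minus (f (snd ab)) (f (fst ab))) (filter_prod Fa Fb)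
    (locally (minus lb la))).
  { apply (filterlim_comp_2 (fun ab : R * R => f (snd ab)) (fun ab => opp (f (fst ab))) plus
      (G := locally lb) (H := locally (opp la))).
    - exact (filterlim_comp _ _ _ _ _ _ _ _ filterlim_snd Hb).
    - exact (filterlim_comp _ _ _ _ opp _ _ _ (filterlim_comp _ _ _ _ _ _ _ _ filterlim_fst Ha)
        (filterlim_opp la)).
    - exact (filterlim_plus lb (opp la)). }
  specialize (Hlim P HP). unfold filtermap in Hlim. unfold filtermapi.
  generalize (filter_and _ _ filter_prod_domain Hlim). apply filter_imp. intros [x y] [[Dx Dy] Hxy].
  exists (minus (f y) (f x)). split; [|exact Hxy].
  apply is_RInt_derive; intros t Ht; [apply Hf | apply Hdf]; exact (convex_between x y t Dx Dy Ht).
Qed.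

Lemma norm_RInt_le_abs (f : R -> V) (g : R -> R) (x y : R) : D x -> D y ->
  (forall t, D t -> continuous f t) -> (forall t, D t -> norm (f t) <= g t) ->
  ex_RInt g x y -> norm (RInt f x y) <= Rabs (RInt g x y).
Proof.
  intros Dx Dy Hf Hfg Hg.
  assert (Hle : forall u v, D u -> D v -> u <= v -> ex_RInt g u v -> norm (RInt f u v) <= RInt g u v).
  { intros u v Du Dv Huv Hi. apply (norm_RInt_le f g u v); [assumption | | | now apply (RInt_correct g)].
    - intros t Ht. now apply Hfg, (D_convex u v).
    - apply (RInt_correct f), ex_RInt_continuous. intros t Ht.
      apply Hf. now apply (convex_between u v). }
  destruct (Rle_dec x y).
  - eapply Rle_trans; [apply Hle; assumption | apply Rle_abs].
  - assert (Hg' : ex_RInt g y x) by now apply ex_RInt_swap.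
    assert (Hf' : ex_RInt f y x).
    { apply ex_RInt_continuous. intros t Ht. now apply Hf, (convex_between y x). }
    rewrite <- (opp_RInt_swap g y x Hg'), <- (opp_RInt_swap f y x Hf').
    eapply Rle_trans; [right; exact (norm_opp (RInt f y x))|].
    unfold opp at 1. simpl. rewrite Rabs_Ropp. eapply Rle_trans; [|apply Rle_abs].
    apply Hle; try assumption. lra.
Qed.

Lemma is_RInt_gen_near (g : R -> R) (lg e : R) : 0 < e -> is_RInt_gen g Fa Fb lg ->
  exists P Q : R -> Prop, Fa P /\ Fb Q /\
    forall x y, P x -> Q y -> ex_RInt g x y /\ Rabs (RInt g x y - lg) < e.
Proof.
  intros He Hg.
  destruct (Hg (ball lg (mkposreal e He)) (locally_ball lg (mkposreal e He))) as [P Q FP FQ HPQ].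
  exists P, Q. split; [assumption|]. split; [assumption|].
  intros x y Px Qy. destruct (HPQ x y Px Qy) as (I & HI & Hball). cbn [fst snd] in HI.
  split; [now exists I|]. rewrite (is_RInt_unique g x y I HI). exact Hball.
Qed.

Lemma RInt_dominated_Cauchy (f : R -> V) (g : R -> R) (x y x' y' lg e : R) : D x -> D y -> D x' -> D y' ->
  (forall t, D t -> continuous f t) -> (forall t, D t -> norm (f t) <= g t) ->
  (forall u v, (u = x \/ u = x') -> (v = y \/ v = y') -> ex_RInt g u v /\ Rabs (RInt g u v - lg) < e) ->
  norm (minus (RInt f x' y') (RInt f x y)) < 4 * e.
Proof.
  intros Dx Dy Dx' Dy' Hf Hfg Hg.
  assert (Hi : forall u v, D u -> D v -> ex_RInt f u v).
  { intros u v Du Dv. apply ex_RInt_continuous. intros t Ht. now apply Hf, (convex_between u v). }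
  destruct (Hg x y) as [Ixy Bxy]; auto. destruct (Hg x' y) as [Ix'y Bx'y]; auto.
  destruct (Hg x' y') as [Ix'y' Bx'y']; auto.
  destruct (RInt_left_difference g x x' y Ixy Ix'y) as [Ileft Eleft].
  destruct (RInt_right_difference g x' y y' Ix'y Ix'y') as [Iright Eright].
  assert (Esum : minus (RInt f x' y') (RInt f x y) = plus (RInt f x' x) (RInt f y y')).
  { rewrite <- (RInt_Chasles f x' x y'), <- (RInt_Chasles f x y y') by auto.
    exact (minus_plus_middle (G := CompleteNormedModule.AbelianGroup _ V) _ _ _). }
  apply Rle_lt_trans with (Rabs (RInt g x' x) + Rabs (RInt g y y')).
  - eapply Rle_trans; [right; exact (f_equal norm Esum)|].
    eapply Rle_trans; [exact (norm_triangle _ _)|].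
    apply Rplus_le_compat; now apply norm_RInt_le_abs.
  - rewrite Eleft, Eright. apply Rabs_def2 in Bxy, Bx'y, Bx'y'.
    assert (Rabs (RInt g x' y - RInt g x y) < 2 * e) by (apply Rabs_def1; lra).
    assert (Rabs (RInt g x' y' - RInt g x' y) < 2 * e) by (apply Rabs_def1; lra). lra.
Qed.

Lemma ex_RInt_gen_dominated (f : R -> V) (g : R -> R) (lg : R) :
  (forall t, D t -> continuous f t) -> (forall t, D t -> norm (f t) <= g t) ->
  is_RInt_gen g Fa Fb lg -> ex_RInt_gen f Fa Fb.
Proof.
  intros Hf Hfg Hg.
  assert (Hlim : exists l, filterlim (fun ab => RInt f (fst ab) (snd ab)) (filter_prod Fa Fb) (locally l)).
  { apply filterlim_locally_cauchy. intros e.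
    destruct (is_RInt_gen_near g lg (e / 4)) as (P & Q & FP & FQ & HPQ);
      [pose proof (cond_pos e); lra | exact Hg |].
    exists (fun ab => (D (fst ab) /\ P (fst ab)) /\ (D (snd ab) /\ Q (snd ab))). split.
    - apply Filter_prod with (fun t => D t /\ P t) (fun t => D t /\ Q t);
        [now apply filter_and | now apply filter_and | now split].
    - intros [x y] [x' y'] [[Dx Px] [Dy Qy]] [[Dx' Px'] [Dy' Qy']]. cbn [fst snd] in *.
      apply (norm_compat1 (V := V)). replace (pos e) with (4 * (e / 4)) by field.
      apply (RInt_dominated_Cauchy f g x y x' y' lg); try assumption.
      intros u v [-> | ->] [-> | ->]; now apply HPQ. }
  destruct Hlim as [l Hl]. exists l. intros P HP. specialize (Hl P HP). unfold filtermap in Hl.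
  unfold filtermapi. generalize (filter_and _ _ filter_prod_domain Hl). apply filter_imp.
  intros [x y] [[Dx Dy] Hxy]. exists (RInt f x y). split; [|exact Hxy].
  apply (RInt_correct f), ex_RInt_continuous. intros t Ht. now apply Hf, (convex_between x y).
Qed.

End ImproperIntegrals.

Lemma is_RInt_gen_comp {V W : NormedModule R_AbsRing} {Fa Fb : (R -> Prop) -> Prop}
  {FFa : Filter Fa} {FFb : Filter Fb} (phi : V -> W) (f : R -> V) (l : V) : continuous phi l ->
  (forall a b m, is_RInt f a b m -> is_RInt (fun t => phi (f t)) a b (phi m)) ->
  is_RInt_gen f Fa Fb l -> is_RInt_gen (fun t => phi (f t)) Fa Fb (phi l).
Proof.
  intros Hphi Hmap Hf P HP. specialize (Hf _ (Hphi P HP)). unfold filtermapi in *.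
  revert Hf. apply filter_imp.
  intros ab (m & Hm & Pm). exists (phi m). split; [now apply Hmap | exact Pm].
Qed.

Lemma is_RInt_gen_Cmult {Fa Fb : (R -> Prop) -> Prop} {FFa : Filter Fa} {FFb : Filter Fb}
  (c : C) (f : R -> C) (l : C) :
  is_RInt_gen f Fa Fb l -> is_RInt_gen (fun t => c * f t)%C Fa Fb (c * l)%C.
Proof.
  apply (is_RInt_gen_comp (V := C_R_NormedModule) (W := C_R_NormedModule) (Cmult c)).
  - exact (continuous_Cmult (fun _ => c) (fun y => y) l (continuous_const c l) (continuous_id l)).
  - intros a b m. apply is_RInt_Cmult.
Qed.

Lemma is_RInt_gen_Cminus {Fa Fb : (R -> Prop) -> Prop} {FFa : Filter Fa} {FFb : Filter Fb}
  (f g : R -> C) (lf lg : C) :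
  is_RInt_gen f Fa Fb lf -> is_RInt_gen g Fa Fb lg ->
  is_RInt_gen (fun t => f t - g t)%C Fa Fb (lf - lg)%C.
Proof. exact (is_RInt_gen_minus (V := C_R_NormedModule) f g lf lg). Qed.

Lemma is_RInt_gen_Re_le {Fa Fb : (R -> Prop) -> Prop} {FFa : ProperFilter Fa} {FFb : ProperFilter Fb}
  (f g : R -> C) (lf lg : C) : filter_prod Fa Fb (fun ab => fst ab <= snd ab) ->
  filter_prod Fa Fb (fun ab => forall t, fst ab <= t <= snd ab -> Re (f t) <= Re (g t)) ->
  is_RInt_gen f Fa Fb lf -> is_RInt_gen g Fa Fb lg -> Re lf <= Re lg.
Proof.
  intros Hab Hfg Hf Hg.
  assert (Hre : is_RInt_gen (V := R_NormedModule) (fun t => Re (g t - f t)%C) Fa Fb (Re (lg - lf)%C)).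
  { apply (is_RInt_gen_comp (V := C_R_NormedModule) (W := R_NormedModule) Re).
    - destruct (lg - lf)%C as [x y]. exact (continuous_fst x y).
    - intros a b m. apply (is_RInt_fct_extend_fst (U := R_NormedModule) (V := R_NormedModule)).
    - now apply is_RInt_gen_Cminus. }
  assert (Hpos : norm (Re (lg - lf)%C) <= Re (lg - lf)%C).
  { refine (RInt_gen_norm (V := R_CompleteNormedModule) _ _ _ _ Hab _ Hre Hre).
    generalize Hfg. apply filter_imp. intros [a b] H t Ht. specialize (H t Ht).
    right. apply Rabs_pos_eq. simpl. unfold Re in H. lra. }
  pose proof (Rle_trans _ _ _ (norm_ge_0 _) Hpos) as Hge. simpl in Hge. unfold Re. lra.
Qed.

Lemma Rlt_convex (x y z t : R) : x < y -> x < z -> y <= t <= z -> x < t.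
Proof. intros. lra. Qed.

Lemma at_right_gt (x : R) : at_right x (Rlt x).
Proof. unfold at_right, within. now apply filter_forall. Qed.

Lemma p_infty_gt (x : R) : Rbar_locally p_infty (Rlt x).
Proof. now exists x. Qed.

Lemma at_right_0_p_infty (P : R -> Prop) : (forall t, 0 < t -> P t) ->
  filter_prod (at_right 0) (Rbar_locally p_infty) (fun ab => forall t, fst ab <= t <= snd ab -> P t).
Proof.
  intros HP. apply Filter_prod with (Rlt 0) (Rlt 0); [apply at_right_gt | apply p_infty_gt|].
  intros a b Ha Hb t Ht. apply HP. cbn [fst snd] in Ht. lra.
Qed.

Lemma at_right_0_le_p_infty :
  filter_prod (at_right 0) (Rbar_locally p_infty) (fun ab => fst ab <= snd ab).
Proof.
  apply Filter_prod with (fun t => t < 1) (Rlt 1).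
  - apply filter_le_within, open_lt, Rlt_0_1.
  - apply p_infty_gt.
  - intros a b Ha Hb. cbn [fst snd]. lra.
Qed.

Lemma filterlim_Cmod_le {Fi : (R -> Prop) -> Prop} {FF : Filter Fi} (f : R -> C) (h : R -> R) :
  Fi (fun t => Cmod (f t) <= h t) -> filterlim h Fi (locally 0) -> filterlim f Fi (locally (RtoC 0)).
Proof.
  intros Hle Hh. apply (filterlim_Cmod (Fi := Fi)). intros e He.
  pose proof (proj1 (filterlim_locally h 0) Hh (mkposreal e He)) as Hb.
  generalize (filter_and _ _ Hle Hb). apply filter_imp. intros t [Hf Hball].
  replace (f t - 0)%C with (f t) by ring. apply Rle_lt_trans with (h t); [assumption|].
  apply Rle_lt_trans with (Rabs (h t - 0)); [rewrite Rminus_0_r; apply Rle_abs | exact Hball].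
Qed.

Lemma p_infty_ge (x : R) : Rbar_locally p_infty (Rle x).
Proof. exists x. intros t. apply Rlt_le. Qed.

Lemma at_point_le_p_infty (x : R) :
  filter_prod (at_point x) (Rbar_locally p_infty) (fun ab => fst ab <= snd ab).
Proof.
  apply Filter_prod with (eq x) (Rle x); [reflexivity | apply p_infty_ge|].
  now intros s t <-.
Qed.

Lemma exp_decay_lim (k d x : R) : 0 < d ->
  filterlim (fun s => k * exp (- (d * (s - x)))) (Rbar_locally p_infty) (locally 0).
Proof.
  intros Hd. rewrite <- (Rmult_0_r k).
  apply (filterlim_comp _ _ _ (fun s => exp (- (d * (s - x)))) (fun u => scal k u) _ (locally 0));
    [|exact (filterlim_scal_r k 0)].
  apply (filterlim_comp _ _ _ (fun s => - (d * (s - x))) exp _ (Rbar_locally m_infty));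
    [|exact is_lim_exp_m].
  intros P [M HM]. exists (x - M / d). intros s Hs. apply HM.
  assert (Hs' : - M / d < s - x) by (unfold Rdiv in *; lra). apply Rlt_div_l in Hs'; lra.
Qed.

Lemma is_RInt_gen_exp (k d x : R) : 0 < d ->
  is_RInt_gen (fun s => k * exp (- (d * (s - x)))) (at_point x) (Rbar_locally p_infty) (k / d).
Proof.
  intros Hd. replace (k / d) with (minus 0 (- (k / d))) by (unfold minus, plus, opp; simpl; ring).
  apply (is_RInt_gen_derive (V := R_CompleteNormedModule) _ _ (fun _ => True)
    (fun _ _ _ _ _ _ => I) I filter_true (fun s => - (k / d) * exp (- (d * (s - x))))).
  - intros s _. auto_derive; [exact I|]. unfold Rminus. field. lra.
  - intros s _. apply (ex_derive_continuous (fun s => k * exp (- (d * (s - x))))). auto_derive. exact I.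
  - intros P HP. apply locally_singleton in HP. unfold filtermap, at_point.
    now rewrite Rminus_diag, Rmult_0_r, Ropp_0, exp_0, Rmult_1_r.
  - now apply exp_decay_lim.
Qed.

(** * Integrals along horizontal rays *)

Lemma contour_integral_const (c : C) (g dg : R -> C) (a b : R) : smooth_curve g dg ->
  contour_integral (fun _ => c) g dg a b = (c * (g b - g a))%C.
Proof.
  intros Hg. rewrite (contour_integral_derive _ _ _ _ Hg (fun z => c * z)%C).
  - ring.
  - intros t _. evar_last; [apply is_derive_Cmult; [apply is_derive_Cconst | apply is_derive_Cid]|]. C_ring.
  - intros t _. apply continuous_const.
Qed.

Lemma contour_integral_near_const (f : C -> C) (c : C) (g dg : R -> C) (a b e L : R) :
  smooth_curve g dg -> (forall t, Rmin a b <= t <= Rmax a b -> continuous f (g t)) ->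
  (forall t, Rmin a b <= t <= Rmax a b -> Cmod (f (g t) - c)%C <= e) ->
  (forall t, Rmin a b <= t <= Rmax a b -> Cmod (dg t) <= L) ->
  Cmod (contour_integral f g dg a b - c * (g b - g a))%C <= Rabs (b - a) * (e * L).
Proof.
  intros Hg Hf He HL. rewrite <- (contour_integral_const c g dg a b Hg).
  rewrite <- contour_integral_minus by (assumption || (intros; apply continuous_const)).
  apply contour_integral_Cmod_le; try assumption.
  intros t Ht. exact (continuous_minus (V := C_R_NormedModule) f _ _ (Hf t Ht) (continuous_const c (g t))).
Qed.

Lemma Rabs_between (x y t : R) : Rmin x y <= t <= Rmax x y -> Rabs (t - x) <= Rabs (y - x).
Proof.
  unfold Rmin, Rmax. destruct (Rle_dec x y); intros Ht.
  - rewrite !Rabs_pos_eq; lra.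
  - rewrite !Rabs_left1; lra.
Qed.

Lemma path_integral_near_const (f : C -> C) (z y : C) (e : R) :
  (forall p, Cmod (p - z)%C <= 2 * Cmod (y - z)%C -> continuous f p /\ Cmod (f p - f z)%C <= e) ->
  Cmod (ver_integral f (Re z) (Im z) (Im y) + hor_integral f (Im y) (Re z) (Re y) - f z * (y - z))%C
  <= 2 * Cmod (y - z)%C * e.
Proof.
  intros Hf. destruct z as [a b], y as [x t]. cbn [Re Im fst snd].
  pose proof (re_le_Cmod ((x, t) - (a, b))%C) as Hre. pose proof (im_le_Cmod ((x, t) - (a, b))%C) as Him.
  set (D := Cmod ((x, t) - (a, b))%C) in *. cbn [Re Im Cminus Cplus Copp fst snd] in Hre, Him.
  assert (Hbox : forall p q, Rabs (p - a) <= D -> Rabs (q - b) <= D ->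
    continuous f (p, q) /\ Cmod (f (p, q) - f (a, b))%C <= e).
  { intros p q Hp Hq. apply Hf. eapply Rle_trans; [apply Cmod_le_Re_Im|].
    cbn [Re Im Cminus Cplus Copp fst snd]. unfold Rminus in *. lra. }
  assert (Hver : forall s, Rmin b t <= s <= Rmax b t ->
    continuous f (ver a s) /\ Cmod (f (ver a s) - f (a, b))%C <= e).
  { intros s Hs. apply Hbox; [rewrite Rminus_diag, Rabs_R0; apply Cmod_ge_0|].
    eapply Rle_trans; [apply (Rabs_between b t s Hs) | exact Him]. }
  assert (Hhor : forall s, Rmin a x <= s <= Rmax a x ->
    continuous f (hor t s) /\ Cmod (f (hor t s) - f (a, b))%C <= e).
  { intros s Hs. apply Hbox; [|exact Him].
    eapply Rle_trans; [apply (Rabs_between a x s Hs) | exact Hre]. }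
  replace (ver_integral f a b t + hor_integral f t a x - f (a, b) * ((x, t) - (a, b)))%C
    with ((ver_integral f a b t - f (a, b) * (ver a t - ver a b))
      + (hor_integral f t a x - f (a, b) * (hor t x - hor t a)))%C by (unfold hor, ver; ring).
  assert (He : 0 <= e).
  { eapply Rle_trans; [apply Cmod_ge_0 | apply (Hbox a b)]; rewrite Rminus_diag, Rabs_R0; apply Cmod_ge_0. }
  eapply Rle_trans; [apply Cmod_triangle|].
  replace (2 * D * e) with (D * (e * 1) + D * (e * 1)) by ring. apply Rplus_le_compat.
  - eapply Rle_trans; [apply contour_integral_near_const with (e := e) (L := 1); try apply Hver|].
    + apply smooth_ver.
    + intros _ _. rewrite Cmod_Ci. lra.
    + apply Rmult_le_compat_r; [lra | exact Him].
  - eapply Rle_trans; [apply contour_integral_near_const with (e := e) (L := 1); try apply Hhor|].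
    + apply smooth_hor.
    + intros _ _. rewrite Cmod_1. lra.
    + apply Rmult_le_compat_r; [lra | exact Hre].
Qed.

Lemma is_derive_path_integral (f P : C -> C) (z : C) : locally z (continuous f) ->
  locally z (fun y => (P y - P z)%C
    = (ver_integral f (Re z) (Im z) (Im y) + hor_integral f (Im y) (Re z) (Re y))%C) ->
  is_derive P z (f z).
Proof.
  intros Hc HP. apply is_derive_Cmod. intros e He.
  assert (Hf : locally z (fun y => Cmod (f y - f z)%C < e / 2)).
  { apply (proj1 (filterlim_Cmod f (f z)) (locally_singleton _ _ Hc)). lra. }
  destruct (proj1 (locally_Cmod _ _) (filter_and _ _ Hc Hf)) as (r & Hr & Hcf).
  destruct (proj1 (locally_Cmod _ _) HP) as (r' & Hr' & HP').
  apply locally_Cmod. exists (Rmin (r / 2) r'). split; [apply Rmin_pos; lra|].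
  intros y Hy. apply Rmin_Rgt in Hy. destruct Hy as [Hyr Hyr']. rewrite (HP' y Hyr').
  replace (e * Cmod (y - z)%C) with (2 * Cmod (y - z)%C * (e / 2)) by field.
  apply path_integral_near_const. intros p Hp.
  destruct (Hcf p) as [Hcont Hnear]; [lra|]. split; [assumption | lra].
Qed.

Definition ray_integral (f : C -> C) (z : C) : C :=
  @RInt_gen C_R_CompleteNormedModule (fun s => f (s, Im z)) (at_point (Re z)) (Rbar_locally p_infty).

Section RayIntegral.

Variables (U : C -> Prop) (f : C -> C) (M : C -> R) (d : R).
Hypothesis U_open : forall z, U z -> locally z U.
Hypothesis U_right : forall z t, U z -> 0 <= t -> U (z + RtoC t)%C.
Hypothesis holo_f : holomorphic_on U f.
Hypothesis d_pos : 0 < d.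
Hypothesis f_decay : forall z t, U z -> 0 <= t -> Cmod (f (z + RtoC t)%C) <= M z * exp (- (d * t)).
Hypothesis M_bounded : forall z, U z -> exists K, locally z (fun y => M y <= K).

Lemma ray_point (x y s : R) : (s, y) = ((x, y) + RtoC (s - x))%C.
Proof. apply injective_projections; simpl; ring. Qed.

Lemma U_ray (x y s : R) : U (x, y) -> x <= s -> U (s, y).
Proof. intros Hz Hs. rewrite (ray_point x). apply U_right; [assumption | lra]. Qed.

Lemma f_ray_decay (x y s : R) : U (x, y) -> x <= s -> Cmod (f (s, y)) <= M (x, y) * exp (- (d * (s - x))).
Proof. intros Hz Hs. rewrite (ray_point x). apply f_decay; [assumption | lra]. Qed.

Lemma ray_integral_correct (z : C) : U z ->
  is_RInt_gen (fun s => f (s, Im z)) (at_point (Re z)) (Rbar_locally p_infty) (ray_integral f z)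
  /\ Cmod (ray_integral f z) <= M z / d.
Proof.
  destruct z as [x y]. cbn [Re Im fst snd]. intros Hz.
  assert (Hg := is_RInt_gen_exp (M (x, y)) d x d_pos).
  assert (Hf : forall s, x <= s -> Cmod (f (s, y)) <= M (x, y) * exp (- (d * (s - x)))).
  { intros s. now apply f_ray_decay. }
  assert (Hi : is_RInt_gen (fun s => f (s, y)) (at_point x) (Rbar_locally p_infty) (ray_integral f (x, y))).
  { apply (RInt_gen_correct (V := C_R_CompleteNormedModule)).
    apply (ex_RInt_gen_dominated (V := C_R_CompleteNormedModule) (at_point x) (Rbar_locally p_infty)
      (Rle x)) with (6 := Hg).
    - intros s t u Hs _ Hu. lra.
    - apply Rle_refl.
    - apply p_infty_ge.
    - intros s Hs. apply (continuous_comp (hor y) f).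
      + apply (ex_derive_continuous (hor y)). eexists. apply is_derive_hor.
      + apply ex_derive_C_continuous, holo_f. now apply (U_ray x).
    - intros s Hs. rewrite <- Cmod_norm. now apply Hf. }
  split; [exact Hi|]. rewrite Cmod_norm.
  refine (RInt_gen_norm (V := C_R_CompleteNormedModule) _ _ _ _ (at_point_le_p_infty x) _ Hi Hg).
  apply Filter_prod with (eq x) (Rle x); [reflexivity | apply p_infty_ge|].
  intros a b <- _ s [Hs _]. rewrite <- Cmod_norm. now apply Hf.
Qed.

Lemma continuous_ray (x y s : R) : U (x, y) -> x <= s -> continuous f (s, y).
Proof. intros Hz Hs. apply ex_derive_C_continuous, holo_f. now apply (U_ray x). Qed.

Lemma hor_integral_lim_ray (x y : R) : U (x, y) ->
  filterlim (fun X => hor_integral f y x X) (Rbar_locally p_infty)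
    (locally (ray_integral f (x, y))).
Proof.
  intros Hz P HP. destruct (proj1 (ray_integral_correct (x, y) Hz) P HP) as [Q S HQ HS H].
  unfold filtermap. generalize HS. apply filter_imp. intros X SX.
  destruct (H x X HQ SX) as (l & Hl & Pl). cbn [fst snd Im] in Hl.
  replace (hor_integral f y x X) with l; [exact Pl|].
  symmetry. apply (@is_RInt_unique C_R_CompleteNormedModule).
  apply (is_RInt_ext (fun s => f (s, y))); [|exact Hl]. intros s _. symmetry. apply Cmult_1_r.
Qed.

Lemma ray_integral_hor (x x' y : R) : U (x, y) -> U (x', y) ->
  (ray_integral f (x, y) - ray_integral f (x', y))%C = hor_integral f y x x'.
Proof.
  intros Hz Hz'.
  assert (Hc : is_RInt (fun s => f (s, y)) x x' (hor_integral f y x x')).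
  { apply (is_RInt_ext (fun s => f (s, y) * 1)%C); [intros s _; apply Cmult_1_r|].
    apply contour_integral_correct; [apply smooth_hor|]. intros s Hs. unfold Rmin in Hs.
    destruct (Rle_dec x x'); [apply (continuous_ray x) | apply (continuous_ray x')]; tauto. }
  apply is_RInt_gen_at_point in Hc.
  pose proof (is_RInt_gen_Chasles _ _ _ _ Hc (proj1 (ray_integral_correct (x', y) Hz'))) as Hsum.
  replace (ray_integral f (x, y))
    with (hor_integral f y x x' + ray_integral f (x', y))%C; [ring|].
  symmetry. exact (is_RInt_gen_unique (V := C_R_CompleteNormedModule) _ _ Hsum).
Qed.

Lemma ray_integral_ver_le (x y y' K : R) : y <= y' ->
  (forall s, y <= s <= y' -> U (x, s) /\ M (x, s) <= K) ->
  (ray_integral f (x, y) - ray_integral f (x, y'))%C = ver_integral f x y y'.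
Proof.
  intros Hy HK. apply Ceq_minus, Cmod_eq_0, Rle_antisym; [|apply Cmod_ge_0].
  apply le_epsilon. intros e He. rewrite Rplus_0_l. assert (He3 : 0 < e / 3) by lra.
  assert (Hlim : forall t, y <= t <= y' -> Rbar_locally p_infty
    (fun X => Cmod (hor_integral f t x X - ray_integral f (x, t))%C < e / 3)).
  { intros t Ht. apply (proj1 (filterlim_Cmod (Fi := Rbar_locally p_infty) _ _)); [|exact He3].
    now apply hor_integral_lim_ray, HK. }
  assert (Hdecay : Rbar_locally p_infty (fun X => Rabs ((y' - y) * K * exp (- (d * (X - x)))) < e / 3)).
  { apply (exp_decay_lim _ d x d_pos (fun u => Rabs u < e / 3)). exists (mkposreal _ He3).
    intros u Hu. rewrite <- (Rminus_0_r u). exact Hu. }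
  destruct (filter_ex _ (filter_and _ _
    (filter_and _ _ (Hlim y (conj (Rle_refl y) Hy)) (Hlim y' (conj Hy (Rle_refl y'))))
    (filter_and _ _ Hdecay (p_infty_ge x)))) as (X & (By & By') & Bexp & HX).
  assert (HU : forall s t, x <= s -> y <= t <= y' -> U (s, t)).
  { intros s t Hs Ht. apply (U_ray x); [apply HK, Ht | assumption]. }
  assert (Hrect : rect_integral f x X y y' = 0).
  { apply goursat; [assumption | assumption|]. intros [s t] [Hs Ht]. apply holo_f, HU; apply Hs || exact Ht. }
  assert (Bver : Cmod (ver_integral f X y y') < e / 3).
  { eapply Rle_lt_trans.
    - apply (ver_integral_Cmod_le f X y y' (K * exp (- (d * (X - x)))));
        rewrite ?Rmin_left, ?Rmax_right by assumption; intros t Ht.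
      + apply ex_derive_C_continuous, holo_f, HU; assumption.
      + eapply Rle_trans; [apply (f_ray_decay x); [apply HK, Ht | assumption]|].
        apply Rmult_le_compat_r; [apply Rlt_le, exp_pos | apply HK, Ht].
    - rewrite Rabs_pos_eq, <- Rmult_assoc by lra.
      eapply Rle_lt_trans; [apply Rle_abs | exact Bexp]. }
  unfold rect_integral in Hrect.
  replace (ray_integral f (x, y) - ray_integral f (x, y') - ver_integral f x y y')%C
    with (- (hor_integral f y x X - ray_integral f (x, y))
      + (hor_integral f y' x X - ray_integral f (x, y')) + - ver_integral f X y y'
      + (hor_integral f y x X + ver_integral f X y y' - hor_integral f y' x X - ver_integral f x y y'))%C
    by ring.
  rewrite Hrect. eapply Rle_trans; [apply Cmod_triangle4|]. rewrite !Cmod_opp, Cmod_0. lra.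
Qed.

Lemma ray_integral_ver (x y y' K : R) :
  (forall s, Rmin y y' <= s <= Rmax y y' -> U (x, s) /\ M (x, s) <= K) ->
  (ray_integral f (x, y) - ray_integral f (x, y'))%C = ver_integral f x y y'.
Proof.
  intros HK. destruct (Rle_dec y y') as [Hy | Hy].
  - apply (ray_integral_ver_le x y y' K Hy). now rewrite Rmin_left, Rmax_right in HK.
  - rewrite Rmin_right, Rmax_left in HK by lra.
    assert (Hy' : y' <= y) by lra.
    assert (Hi : ex_RInt (fun t => f (ver x t) * Ci)%C y' y).
    { eexists. apply contour_integral_correct; [apply smooth_ver|].
      rewrite Rmin_left, Rmax_right by assumption. intros t Ht.
      apply ex_derive_C_continuous, holo_f, HK, Ht. }
    unfold contour_integral. rewrite <- (opp_RInt_swap (V := C_R_CompleteNormedModule) _ _ _ Hi).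
    change (ray_integral f (x, y) - ray_integral f (x, y')
      = - ver_integral f x y' y)%C.
    rewrite <- (ray_integral_ver_le x y' y K Hy' HK). ring.
Qed.

Lemma is_derive_ray_integral (z : C) : U z -> is_derive (ray_integral f) z (- f z)%C.
Proof.
  intros Hz.
  apply (is_derive_ext (fun y => opp (- ray_integral f y)%C));
    [intros y; exact (opp_opp (ray_integral f y))|].
  apply (is_derive_opp (fun y => - ray_integral f y)%C z (f z)).
  destruct (M_bounded z Hz) as [K HK].
  assert (Hloc := filter_and _ _ (U_open z Hz) HK).
  apply is_derive_path_integral.
  - generalize (U_open z Hz). apply filter_imp. intros y Hy. apply ex_derive_C_continuous, holo_f, Hy.
  - apply locally_Cmod in Hloc. destruct Hloc as (r & Hr & Hloc).
    apply locally_Cmod. exists r. split; [assumption|]. intros y Hy.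
    destruct z as [a b], y as [x t]. cbn [Re Im fst snd].
    assert (Hver : forall s, Rmin b t <= s <= Rmax b t -> U (a, s) /\ M (a, s) <= K).
    { intros s Hs. apply Hloc. eapply Rle_lt_trans; [apply Cmod_le_Re_Im|].
      eapply Rle_lt_trans; [|exact Hy]. cbn [Re Im Cminus Cplus Copp fst snd].
      rewrite Rplus_opp_r, Rabs_R0, Rplus_0_l.
      eapply Rle_trans; [apply (Rabs_between b t s Hs)|].
      exact (im_le_Cmod ((x, t) - (a, b))%C). }
    rewrite <- (ray_integral_ver a b t K Hver), <- (ray_integral_hor a x t).
    + ring.
    + apply Hver. split; [apply Rmin_r | apply Rmax_r].
    + now apply Hloc.
Qed.

End RayIntegral.

(** * The Laplace integral as a function on the disc *)

(* The map [s |-> - lam * ln s] defining [Delta_lam], recentred by [s = 1 - v]. *)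
Definition log_chart (lam : R) (v : C) : C := (- (RtoC lam * Clog (1 - v)))%C.

Lemma Delta_lam_log_chart (lam : R) (v : C) : open_disc 1 v -> Delta_lam lam (log_chart lam v).
Proof.
  intros Hv. exists (- Clog (1 - v))%C. split.
  - exists (1 - v)%C. split; [|reflexivity].
    replace (1 - v - 1)%C with (- v)%C by ring. now rewrite Cmod_opp.
  - unfold log_chart. ring.
Qed.

Lemma Delta_lam_iff (lam : R) (z : C) : 0 < lam ->
  Delta_lam lam z <->
  - (PI / 2) < Im (- (z / lam)) < PI / 2 /\ open_disc 1 (1 - Cexp (- (z / lam)))%C.
Proof.
  intros Hlam. assert (Hlam0 : RtoC lam <> 0) by (apply RtoC_neq_0; lra).
  split.
  - intros (xi & (s & Hs & ->) & ->).
    assert (Hre : 0 < Re s).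
    { replace s with (1 - (1 - s))%C by ring. apply Re_1_minus_pos. unfold open_disc.
      now rewrite Cmod_minus_sym. }
    replace (- (lam * - Clog s / lam))%C with (Clog s) by (field; assumption).
    split; [now apply Im_Clog_bound|]. rewrite Cexp_Clog by assumption. unfold open_disc.
    now rewrite Cmod_minus_sym.
  - intros [Him Hd]. replace z with (log_chart lam (1 - Cexp (- (z / lam)))).
    + now apply Delta_lam_log_chart.
    + unfold log_chart. replace (1 - (1 - Cexp (- (z / lam))))%C with (Cexp (- (z / lam))) by ring.
      rewrite Clog_Cexp by assumption. field. assumption.
Qed.

Lemma continuous_Im (z : C) : continuous Im z.
Proof. destruct z as [x y]. exact (continuous_snd x y). Qed.

Lemma continuous_Cmod (z : C) : continuous Cmod z.
Proof.
  apply (continuous_ext (norm (V := C_R_NormedModule))); [intros y; symmetry; apply Cmod_norm|].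
  exact (filterlim_norm (V := C_R_NormedModule) z).
Qed.

Lemma Delta_lam_open (lam : R) (z : C) : 0 < lam -> Delta_lam lam z -> locally z (Delta_lam lam).
Proof.
  intros Hlam Hz. apply Delta_lam_iff in Hz; [|assumption]. destruct Hz as [Him Hd].
  set (u := fun y => (- (y / lam))%C) in *.
  assert (Du : forall y, is_derive u y (- / lam)%C).
  { intros y. apply (is_derive_ext (fun y => - / lam * y)%C); [intros v; unfold u, Cdiv; C_ring|].
    evar_last; [apply is_derive_Cmult; [apply is_derive_Cconst | apply is_derive_Cid] | C_ring]. }
  assert (Cu : continuous u z) by (apply ex_derive_C_continuous; eexists; apply Du).
  assert (Cv : continuous (fun y => 1 - Cexp (u y))%C z).
  { apply ex_derive_C_continuous. eexists. apply is_derive_Cminus; [apply is_derive_Cconst|].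
    exact (is_derive_Ccomp Cexp u z _ _ (is_derive_Cexp _) (Du z)). }
  assert (Lim : locally z (fun y => - (PI / 2) < Im (u y) < PI / 2)).
  { apply (continuous_comp u Im z Cu (continuous_Im _) (fun s => - (PI / 2) < s < PI / 2)).
    apply (open_and (fun s => - (PI / 2) < s) (fun s => s < PI / 2));
      [apply open_gt | apply open_lt | exact Him]. }
  assert (Ldisc : locally z (fun y => open_disc 1 (1 - Cexp (u y))%C)).
  { apply (continuous_comp (fun y => 1 - Cexp (u y))%C Cmod z Cv (continuous_Cmod _) (fun s => s < 1)).
    apply open_lt, Hd. }
  generalize (filter_and _ _ Lim Ldisc). apply filter_imp. intros y Hy. now apply Delta_lam_iff.
Qed.

Lemma Delta_lam_plus_pos (lam : R) (z : C) (t : R) : 0 < lam -> Delta_lam lam z -> 0 <= t ->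
  Delta_lam lam (z + RtoC t)%C.
Proof.
  intros Hlam Hz Ht. apply Delta_lam_iff in Hz; [|assumption]. destruct Hz as [Him Hd].
  assert (Hq : 0 <= t / lam) by (apply Rdiv_le_0_compat; assumption).
  assert (Eshift : (- ((z + t) / lam))%C = (- (z / lam) + RtoC (- (t / lam)))%C).
  { rewrite RtoC_opp, RtoC_div by lra. field. apply RtoC_neq_0. lra. }
  apply Delta_lam_iff; [assumption|]. rewrite Eshift. split.
  - cbn [Im Cplus snd RtoC]. rewrite Rplus_0_r. exact Him.
  - rewrite Cexp_plus, Cexp_R. set (p := exp (- (t / lam))).
    assert (Hp : 0 < p <= 1).
    { split; [apply exp_pos|]. rewrite <- exp_0. apply exp_le. lra. }
    set (q := Cexp (- (z / lam))) in *. unfold open_disc in *.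
    replace (1 - q * p)%C with (RtoC (1 - p) + p * (1 - q))%C by (rewrite RtoC_minus; ring).
    eapply Rle_lt_trans; [apply Cmod_triangle|].
    rewrite Cmod_mult, !Cmod_R, !Rabs_pos_eq by lra. nra.
Qed.

Lemma is_derive_Clog_1m (v : C) : open_disc 1 v ->
  is_derive (fun v => Clog (1 - v))%C v (- / (1 - v))%C.
Proof.
  intros Hv. evar_last.
  - apply (is_derive_Ccomp Clog (fun v => 1 - v)%C).
    + apply is_derive_Clog, Re_1_minus_pos, Hv.
    + apply is_derive_Cminus; [apply is_derive_Cconst | apply is_derive_Cid].
  - C_ring.
Qed.

Lemma is_derive_log_chart (lam : R) (v : C) : open_disc 1 v ->
  is_derive (log_chart lam) v (lam / (1 - v))%C.
Proof.
  intros Hv. apply (is_derive_ext (fun v => - RtoC lam * Clog (1 - v))%C).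
  - intros u. unfold log_chart. C_ring.
  - evar_last; [apply is_derive_Cmult; [apply is_derive_Cconst | now apply is_derive_Clog_1m]|].
    cbv beta. unfold Cdiv. ring.
Qed.

Lemma holomorphic_log_chart (lam : R) : holomorphic_on (open_disc 1) (log_chart lam).
Proof. intros v Hv. eexists. now apply is_derive_log_chart. Qed.

Lemma log_chart_0 (lam : R) : log_chart lam 0 = 0.
Proof. unfold log_chart. replace (1 - 0)%C with (RtoC 1) by ring. rewrite Clog_1. ring. Qed.

Lemma Cmod_log_chart (lam : R) (v : C) : 0 < lam ->
  Cmod (log_chart lam v) = lam * Cmod (Clog (1 - v)%C).
Proof. intros Hlam. unfold log_chart. rewrite Cmod_opp, Cmod_mult, Cmod_R, Rabs_pos_eq; lra. Qed.

Definition laplace_ray (F : C -> C) (lam : R) (z v : C) : C :=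
  (Cexp (z * log_chart lam v)
   * ray_integral (fun y => F y * Cexp (- (z * y)))%C (log_chart lam v))%C.

Section LaplaceRay.

Variables (F : C -> C) (lam A B : R) (z : C).
Hypothesis lam_pos : 0 < lam.
Hypothesis A_pos : 0 < A.
Hypothesis B_pos : 0 < B.
Hypothesis z_large : B < Re z.
Hypothesis holo_F : holomorphic_on (Delta_lam lam) F.
Hypothesis exp_bound_F : forall y, Delta_lam lam y -> Cmod (F y) <= A * exp (B * Cmod y).

Let f (y : C) : C := (F y * Cexp (- (z * y)))%C.
Let M (y : C) : R := A * exp (B * Cmod y - Re (z * y)).

Lemma holomorphic_laplace_integrand : holomorphic_on (Delta_lam lam) f.
Proof.
  apply holomorphic_on_mult; [exact holo_F|]. intros y _. eexists.
  apply (is_derive_Ccomp Cexp (fun y => - (z * y))%C); [apply is_derive_Cexp|].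
  apply (is_derive_ext (fun y => - z * y)%C); [intros u; C_ring|].
  apply is_derive_Cmult; [apply is_derive_Cconst | apply is_derive_Cid].
Qed.

Lemma laplace_integrand_decay (y : C) (t : R) : Delta_lam lam y -> 0 <= t ->
  Cmod (f (y + t)%C) <= M y * exp (- ((Re z - B) * t)).
Proof.
  intros Hy Ht. unfold f, M. rewrite Cmod_mult, Cmod_Cexp.
  apply Rle_trans with (A * exp (B * Cmod (y + t)%C) * exp (Re (- (z * (y + t))))%C).
  - apply Rmult_le_compat_r; [apply Rlt_le, exp_pos|].
    apply exp_bound_F. now apply Delta_lam_plus_pos.
  - rewrite !Rmult_assoc, <- !exp_plus. apply Rmult_le_compat_l; [lra|]. apply exp_le.
    pose proof (Cmod_triangle y t) as Htri. rewrite Cmod_R, Rabs_pos_eq in Htri by assumption.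
    destruct z as [a b], y as [p q]. cbn [Re Cmult Cplus Copp RtoC fst snd] in *. nra.
Qed.

Lemma laplace_majorant_bounded (y : C) : exists K, locally y (fun u => M u <= K).
Proof.
  exists (A * exp ((B + Cmod z) * (Cmod y + 1))). apply locally_Cmod. exists 1. split; [lra|].
  intros u Hu. unfold M. apply Rmult_le_compat_l; [lra|]. apply exp_le.
  pose proof (Cmod_triangle (u - y) y) as Htri. replace (u - y + y)%C with u in Htri by ring.
  pose proof (re_le_Cmod (z * u)) as Hre. rewrite Cmod_mult in Hre. pose proof (Cmod_ge_0 z).
  apply Rabs_le_between in Hre. apply Rle_trans with ((B + Cmod z) * Cmod u); [lra|].
  apply Rmult_le_compat_l; lra.
Qed.

Lemma laplace_ray_correct (y : C) : Delta_lam lam y ->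
  is_RInt_gen (fun s => f (s, Im y)) (at_point (Re y)) (Rbar_locally p_infty) (ray_integral f y)
  /\ Cmod (ray_integral f y) <= M y / (Re z - B).
Proof.
  apply (ray_integral_correct (Delta_lam lam)).
  - intros u t Hu. now apply Delta_lam_plus_pos.
  - apply holomorphic_laplace_integrand.
  - lra.
  - apply laplace_integrand_decay.
Qed.

Lemma is_derive_laplace_ray (v : C) : open_disc 1 v ->
  is_derive (laplace_ray F lam z) v
    ((lam * z * laplace_ray F lam z v - lam * F (log_chart lam v)) / (1 - v))%C.
Proof.
  intros Hv. pose proof (is_derive_log_chart lam v Hv) as Dchart.
  evar_last.
  - apply is_derive_Cmult.
    + apply (is_derive_Ccomp Cexp (fun v => z * log_chart lam v)%C); [apply is_derive_Cexp|].
      apply is_derive_Cmult; [apply is_derive_Cconst | exact Dchart].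
    + apply (is_derive_Ccomp (ray_integral f)); [|exact Dchart].
      apply (is_derive_ray_integral (Delta_lam lam) f M (Re z - B)).
      * intros u. now apply Delta_lam_open.
      * intros u t Hu. now apply Delta_lam_plus_pos.
      * apply holomorphic_laplace_integrand.
      * lra.
      * apply laplace_integrand_decay.
      * intros u _. apply laplace_majorant_bounded.
      * now apply Delta_lam_log_chart.
  - unfold laplace_ray. fold f. set (c := log_chart lam v).
    assert (Hcancel : (Cexp (z * c) * Cexp (- (z * c)))%C = 1).
    { rewrite <- Cexp_plus, Cplus_opp_r. apply Cexp_0. }
    transitivity ((lam * z * (Cexp (z * c) * ray_integral f c)
      - lam * F c * (Cexp (z * c) * Cexp (- (z * c)))) / (1 - v))%C.
    + unfold f. C_field. now apply open_disc_1_minus_neq_0.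
    + now rewrite Hcancel, Cmult_1_r.
Qed.

Lemma holomorphic_laplace_ray : holomorphic_on (open_disc 1) (laplace_ray F lam z).
Proof. intros v Hv. eexists. now apply is_derive_laplace_ray. Qed.

Lemma log_growth_laplace_ray : log_growth (lam * B) (A / (Re z - B)) (laplace_ray F lam z).
Proof.
  intros v Hv. unfold laplace_ray. fold f. set (c := log_chart lam v).
  destruct (laplace_ray_correct c (Delta_lam_log_chart lam v Hv)) as [_ Hle].
  rewrite Cmod_mult, Cmod_Cexp.
  eapply Rle_trans; [apply Rmult_le_compat_l; [apply Rlt_le, exp_pos | exact Hle]|].
  right. unfold M. replace (lam * B * Cmod (Clog (1 - v)%C)) with (B * Cmod c)
    by (unfold c; rewrite Cmod_log_chart by assumption; ring).
  unfold Rminus at 1. rewrite exp_plus, exp_Ropp. field. split; [lra | apply Rgt_not_eq, exp_pos].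
Qed.

Lemma is_RInt_gen_laplace_ray_0 :
  is_RInt_gen (laplace_integrand F z) (at_point 0) (Rbar_locally p_infty) (laplace_ray F lam z 0).
Proof.
  assert (Hzero : Delta_lam lam 0).
  { rewrite <- (log_chart_0 lam). apply Delta_lam_log_chart. unfold open_disc. rewrite Cmod_0. lra. }
  unfold laplace_ray. rewrite log_chart_0, Cmult_0_r, Cexp_0, Cmult_1_l.
  exact (proj1 (laplace_ray_correct 0 Hzero)).
Qed.

Lemma holomorphic_comp_log_chart : holomorphic_on (open_disc 1) (fun v => F (log_chart lam v)).
Proof.
  apply (holomorphic_on_comp _ (log_chart lam) (holomorphic_log_chart lam) (Delta_lam lam) F holo_F).
  apply Delta_lam_log_chart.
Qed.

Lemma log_growth_comp_log_chart : log_growth (lam * B) A (fun v => F (log_chart lam v)).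
Proof.
  intros v Hv. eapply Rle_trans; [apply exp_bound_F, Delta_lam_log_chart, Hv|].
  right. rewrite Cmod_log_chart by assumption. do 2 f_equal. ring.
Qed.

End LaplaceRay.

(** * The Gamma function *)

Lemma Rpower_le_exp (x t : R) : 0 < x -> 0 < t -> Rpower t x <= Rpower (2 * x) x * exp (t / 2).
Proof.
  intros Hx Ht. unfold Rpower. rewrite <- exp_plus. apply exp_le.
  assert (Hu : 0 < t / (2 * x)) by (apply Rdiv_lt_0_compat; lra).
  pose proof (exp_ineq1_le (ln (t / (2 * x)))) as Hln. rewrite exp_ln, ln_div in Hln by lra.
  replace (t / 2) with (x * (t / (2 * x))) by (field; lra). nra.
Qed.

Lemma is_RInt_gen_Rpower_kernel (x : R) : 0 < x ->
  is_RInt_gen (fun t => Rpower t (x - 1) / (1 + Rpower t x) ^ 2) (at_right 0) (Rbar_locally p_infty) (/ x).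
Proof.
  intros Hx. assert (Hp : forall t, 0 < Rpower t x) by (intros t; apply exp_pos).
  replace (/ x) with (minus 0 (- (/ x * / (1 + 0))))
    by (unfold minus, plus, opp; simpl; field; lra).
  assert (Dk : forall t, 0 < t -> is_derive (fun t => - (/ x * / (1 + Rpower t x))) t
    (Rpower t (x - 1) / (1 + Rpower t x) ^ 2)).
  { intros t Ht. specialize (Hp t). unfold Rpower in *. auto_derive; [lra|].
    replace ((x - 1) * ln t) with (x * ln t + - ln t) by ring.
    rewrite exp_plus, exp_Ropp, exp_ln by assumption. field. lra. }
  apply (is_RInt_gen_derive (V := R_CompleteNormedModule) _ _ (Rlt 0) (Rlt_convex 0) (at_right_gt 0)
    (p_infty_gt 0) (fun t => - (/ x * / (1 + Rpower t x))) _ _ _ Dk).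
  - intros t Ht. apply (ex_derive_continuous (fun t => Rpower t (x - 1) / (1 + Rpower t x) ^ 2)).
    specialize (Hp t). unfold Rpower in *. auto_derive. repeat split; trivial.
    apply Rgt_not_eq. nra.
  - apply (filterlim_comp _ _ _ (fun t => Rpower t x) (fun u => - (/ x * / (1 + u))) _ (locally 0));
      [now apply Rpower_lim_0|].
    apply (ex_derive_continuous (fun u => - (/ x * / (1 + u)))). auto_derive. lra.
  - replace 0 with (- (/ x * 0)) by ring.
    apply (filterlim_comp _ _ _ (fun t => / (1 + Rpower t x)) (fun u => - (/ x * u)) _ (locally 0)).
    2: { apply (ex_derive_continuous (fun u => - (/ x * u))). auto_derive. exact I. }
    apply (is_lim_inv (fun t => 1 + Rpower t x) p_infty p_infty); [|discriminate].
    apply (is_lim_plus (fun _ => 1) (fun t => Rpower t x) p_infty 1 p_infty p_infty).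
    + apply is_lim_const.
    + now apply Rpower_lim_p_infty.
    + reflexivity.
Qed.

Definition gamma_integrand (w : C) (t : R) : C := (Cexp ((w - 1) * ln t) * exp (- t))%C.

Lemma gamma_integrand_Clog (w : C) (t : R) : 0 < t ->
  gamma_integrand w t = Cexp ((w - 1) * Clog t - t)%C.
Proof.
  intros Ht. unfold gamma_integrand. rewrite <- Clog_R, <- Cexp_R, <- Cexp_plus by assumption.
  f_equal. rewrite RtoC_opp. ring.
Qed.

Lemma Cmod_gamma_integrand (w : C) (t : R) :
  Cmod (gamma_integrand w t) = Rpower t (Re w - 1) * exp (- t).
Proof.
  unfold gamma_integrand. rewrite Cmod_mult, Cmod_Cexp, Cmod_R, Rabs_pos_eq by (apply Rlt_le, exp_pos).
  unfold Rpower. do 2 f_equal. destruct w as [x y]. simpl. ring.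
Qed.

Lemma gamma_integrand_succ (w : C) (t : R) : 0 < t ->
  gamma_integrand (w + 1)%C t = (t * gamma_integrand w t)%C.
Proof.
  intros Ht. unfold gamma_integrand.
  replace ((w + 1 - 1) * ln t)%C with (ln t + (w - 1) * ln t)%C by ring.
  rewrite Cexp_plus, Cexp_R, exp_ln by assumption. ring.
Qed.

Lemma is_derive_gamma_integrand (w : C) (t : R) : 0 < t ->
  is_derive (gamma_integrand (w + 1)%C) t (w * gamma_integrand w t - gamma_integrand (w + 1) t)%C.
Proof.
  intros Ht. apply (is_derive_ext_loc (fun s => Cexp (w * Clog (hor 0 s) - hor 0 s)%C)).
  { generalize (open_gt 0 t Ht). apply filter_imp. intros s Hs.
    rewrite gamma_integrand_Clog by assumption. f_equal. change (hor 0 s) with (RtoC s). ring. }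
  evar_last.
  - apply (is_derive_curve_comp (fun z => Cexp (w * Clog z - z)%C) (hor 0)); [|apply is_derive_hor].
    apply (is_derive_Ccomp Cexp (fun z => w * Clog z - z)%C); [apply is_derive_Cexp|].
    apply is_derive_Cminus; [|apply is_derive_Cid].
    apply is_derive_Cmult; [apply is_derive_Cconst | now apply is_derive_Clog].
  - change (hor 0 t) with (RtoC t). rewrite gamma_integrand_succ by assumption.
    replace (Cexp (w * Clog t - t)) with (t * gamma_integrand w t)%C.
    + C_field. apply RtoC_neq_0. lra.
    + rewrite <- gamma_integrand_succ, gamma_integrand_Clog by assumption. f_equal. ring.
Qed.

Lemma continuous_gamma_integrand (w : C) (t : R) : 0 < t -> continuous (gamma_integrand w) t.
Proof.
  intros Ht. replace w with (w - 1 + 1)%C by ring.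
  apply (ex_derive_continuous (gamma_integrand (w - 1 + 1)%C)). eexists.
  now apply is_derive_gamma_integrand.
Qed.

Lemma gamma_integrand_le_kernel (w : C) (t : R) : 0 < Re w -> 0 < t ->
  Cmod (gamma_integrand w t)
  <= (1 + Rpower (2 * Re w) (Re w)) ^ 2 * (Rpower t (Re w - 1) / (1 + Rpower t (Re w)) ^ 2).
Proof.
  intros Hw Ht. rewrite Cmod_gamma_integrand. set (x := Re w) in *.
  pose proof (Rpower_le_exp x t Hw Ht) as Hle.
  assert (Hp : 0 < Rpower t x) by apply exp_pos.
  set (K := Rpower (2 * x) x) in *.
  assert (Hexp : 1 <= exp (t / 2)) by (rewrite <- exp_0; apply exp_le; lra).
  replace ((1 + K) ^ 2 * (Rpower t (x - 1) / (1 + Rpower t x) ^ 2))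
    with (Rpower t (x - 1) * ((1 + K) ^ 2 / (1 + Rpower t x) ^ 2)) by (field; lra).
  apply Rmult_le_compat_l; [apply Rlt_le, exp_pos|].
  apply Rle_div_r; [apply pow_lt; lra|].
  replace (exp (- t)) with (/ exp (t / 2) ^ 2).
  - rewrite Rmult_comm. apply Rle_div_l; [apply pow_lt, exp_pos|].
    rewrite <- Rpow_mult_distr. apply pow_incr. nra.
  - rewrite exp_Ropp, <- Rsqr_pow2. unfold Rsqr. rewrite <- exp_plus. do 2 f_equal. field.
Qed.

Lemma is_RInt_gen_Cgamma (w : C) : 0 < Re w ->
  is_RInt_gen (gamma_integrand w) (at_right 0) (Rbar_locally p_infty) (Cgamma w).
Proof.
  intros Hw. apply (RInt_gen_correct (V := C_R_CompleteNormedModule)).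
  apply (ex_RInt_gen_dominated (V := C_R_CompleteNormedModule) _ _ (Rlt 0) (Rlt_convex 0) (at_right_gt 0)
    (p_infty_gt 0) _ (fun t => (1 + Rpower (2 * Re w) (Re w)) ^ 2
      * (Rpower t (Re w - 1) / (1 + Rpower t (Re w)) ^ 2)) ((1 + Rpower (2 * Re w) (Re w)) ^ 2 * / Re w)).
  - intros t Ht. now apply continuous_gamma_integrand.
  - intros t Ht. rewrite <- Cmod_norm. now apply gamma_integrand_le_kernel.
  - exact (is_RInt_gen_scal _ _ _ (is_RInt_gen_Rpower_kernel (Re w) Hw)).
Qed.

Lemma gamma_integrand_lim_0 (w : C) : 0 < Re w ->
  filterlim (gamma_integrand (w + 1)%C) (at_right 0) (locally (RtoC 0)).
Proof.
  intros Hw. apply filterlim_Cmod_le with (fun t => Rpower t (Re w)); [|now apply Rpower_lim_0].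
  generalize (at_right_gt 0). apply filter_imp. intros t Ht. rewrite Cmod_gamma_integrand.
  replace (Re (w + 1)%C - 1) with (Re w) by (simpl; unfold Re; ring).
  rewrite <- (Rmult_1_r (Rpower t (Re w))) at 2. apply Rmult_le_compat_l; [apply Rlt_le, exp_pos|].
  rewrite <- exp_0. apply exp_le. lra.
Qed.

Lemma gamma_integrand_lim_p_infty (w : C) : 0 < Re w ->
  filterlim (gamma_integrand (w + 1)%C) (Rbar_locally p_infty) (locally (RtoC 0)).
Proof.
  intros Hw.
  apply filterlim_Cmod_le with (fun t => Rpower (2 * Re w) (Re w) * exp (- (/ 2 * (t - 0))));
    [|apply exp_decay_lim; lra].
  generalize (p_infty_gt 0). apply filter_imp. intros t Ht. rewrite Cmod_gamma_integrand.
  replace (Re (w + 1)%C - 1) with (Re w) by (simpl; unfold Re; ring).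
  replace (- (/ 2 * (t - 0))) with (t / 2 + - t) by field. rewrite exp_plus, <- Rmult_assoc.
  apply Rmult_le_compat_r; [apply Rlt_le, exp_pos | now apply Rpower_le_exp].
Qed.

Lemma Cgamma_succ (w : C) : 0 < Re w -> Cgamma (w + 1)%C = (w * Cgamma w)%C.
Proof.
  intros Hw.
  assert (Hw1 : 0 < Re (w + 1)%C) by (simpl; unfold Re in *; lra).
  assert (Hparts := is_RInt_gen_derive (V := C_R_CompleteNormedModule) _ _ (Rlt 0) (Rlt_convex 0)
    (at_right_gt 0) (p_infty_gt 0) _ _ _ _ (is_derive_gamma_integrand w)
    (fun t Ht => continuous_minus (V := C_R_NormedModule) _ _ t
      (continuous_Cmult _ _ t (continuous_const w t) (continuous_gamma_integrand w t Ht))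
      (continuous_gamma_integrand (w + 1) t Ht))
    (gamma_integrand_lim_0 w Hw) (gamma_integrand_lim_p_infty w Hw)).
  assert (Hdiff := is_RInt_gen_Cminus _ _ _ _
    (is_RInt_gen_Cmult w _ _ (is_RInt_gen_Cgamma w Hw)) (is_RInt_gen_Cgamma (w + 1) Hw1)).
  assert (E : (w * Cgamma w - Cgamma (w + 1))%C = (0 - 0)%C).
  { exact (eq_trans (eq_sym (is_RInt_gen_unique (V := C_R_CompleteNormedModule) _ _ Hdiff))
      (is_RInt_gen_unique (V := C_R_CompleteNormedModule) _ _ Hparts)). }
  symmetry. apply Ceq_minus. rewrite E. ring.
Qed.

Lemma gamma_integrand_R (x t : R) : gamma_integrand (RtoC x) t = Rpower t (x - 1) * exp (- t).
Proof.
  unfold gamma_integrand. rewrite <- RtoC_minus, <- RtoC_mult, Cexp_R, <- RtoC_mult. reflexivity.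
Qed.

Lemma Cgamma_1 : Cgamma 1 = 1.
Proof.
  assert (Heq : forall t, gamma_integrand 1 t = exp (- t)).
  { intros t. rewrite gamma_integrand_R, Rminus_diag. unfold Rpower.
    now rewrite Rmult_0_l, exp_0, Rmult_1_l. }
  assert (Dexp : forall t, is_derive (fun t => RtoC (- exp (- t))) t (gamma_integrand 1 t)).
  { intros t. evar_last.
    - apply (is_derive_comp (V := C_R_NormedModule) (hor 0) (fun t => - exp (- t)) t (RtoC 1) (exp (- t)));
        [apply is_derive_hor | auto_derive; [exact I | ring]].
    - rewrite Heq, scal_R_Cmult. C_ring. }
  assert (Hprim : is_RInt_gen (gamma_integrand 1) (at_right 0) (Rbar_locally p_infty) (0 - - (1))%C).
  { refine (is_RInt_gen_derive (V := C_R_CompleteNormedModule) _ _ (Rlt 0) (Rlt_convex 0) (at_right_gt 0)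
      (p_infty_gt 0) (fun t => RtoC (- exp (- t))) _ (- (1))%C (RtoC 0) (fun t _ => Dexp t) _ _ _).
    - intros t Ht. now apply (continuous_gamma_integrand 1).
    - apply (filterlim_filter_le_1 _ (filter_le_within (F := locally 0) (Rlt 0))).
      replace (- (1))%C with (RtoC (- exp (- 0))) by (rewrite Ropp_0, exp_0; apply RtoC_opp).
      apply (ex_derive_continuous (fun t => RtoC (- exp (- t)))). eexists. apply Dexp.
    - apply filterlim_Cmod_le with (fun t => 1 * exp (- (1 * (t - 0)))); [|apply exp_decay_lim; lra].
      apply filter_forall. intros t. rewrite Cmod_R, Rabs_Ropp, Rabs_pos_eq by (apply Rlt_le, exp_pos).
      right. rewrite Rmult_1_l. do 2 f_equal. ring. }
  transitivity (0 - - (1))%C; [|ring].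
  exact (is_RInt_gen_unique (V := C_R_CompleteNormedModule) _ _ Hprim).
Qed.

Fixpoint pochhammer (w : C) (n : nat) : C :=
  match n with O => 1 | S m => (pochhammer w m * (w + RtoC (INR m)))%C end.

Lemma Cgamma_add_INR (w : C) (n : nat) : 0 < Re w ->
  Cgamma (w + INR n)%C = (pochhammer w n * Cgamma w)%C.
Proof.
  intros Hw. induction n as [|n IH].
  - simpl. rewrite Cplus_0_r. ring.
  - rewrite S_INR, RtoC_plus, Cplus_assoc, Cgamma_succ, IH; [simpl; ring|].
    pose proof (pos_INR n). simpl. unfold Re in Hw. lra.
Qed.

Lemma Cgamma_INR_succ (n : nat) : Cgamma (INR (S n)) = INR (fact n).
Proof.
  induction n as [|n IH]; [exact Cgamma_1|].
  rewrite S_INR, RtoC_plus, Cgamma_succ, IH, fact_simpl, mult_INR, RtoC_mult; [reflexivity|].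
  change (0 < INR (S n)). apply lt_0_INR. lia.
Qed.

Lemma ln_sqr_le (u : R) : 0 < u -> ln u ^ 2 <= 4 * (u - 2 + / u).
Proof.
  intros Hu. set (s := exp (ln u / 2)). set (p := exp (- (ln u / 2))).
  assert (Esp : s * p = 1) by (unfold s, p; rewrite <- exp_plus, Rplus_opp_r; apply exp_0).
  assert (Es : s * s = u).
  { unfold s. rewrite <- exp_plus, Rplus_half_diag. now apply exp_ln. }
  assert (Ep : / u = p * p) by (apply Rmult_eq_reg_l with u; [rewrite Rinv_r|]; nra).
  pose proof (exp_ineq1_le (ln u / 2)) as Hs. pose proof (exp_ineq1_le (- (ln u / 2))) as Hp.
  fold s in Hs. fold p in Hp.
  replace (4 * (u - 2 + / u)) with ((2 * (s - p)) ^ 2) by (rewrite Ep; nra).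
  rewrite <- !Rsqr_pow2. apply Rsqr_le_abs_1.
  destruct (Rle_dec 0 (ln u)).
  - assert (p <= 1) by nra. rewrite !Rabs_pos_eq; lra.
  - assert (s <= 1) by nra. rewrite !Rabs_left1; lra.
Qed.

Lemma Rabs_sin_le (x : R) : Rabs (sin x) <= Rabs x.
Proof.
  pose proof (bounded_variation sin cos 1 0 x) as H. rewrite sin_0, !Rminus_0_r, Rmult_1_l in H.
  apply H. intros t _. split; [apply is_derive_sin | apply Rabs_le, COS_bound].
Qed.

Lemma cos_ge_quadratic (x : R) : 1 - x ^ 2 / 2 <= cos x.
Proof.
  replace x with (2 * (x / 2)) at 2 by field. rewrite cos_2a_sin.
  pose proof (Rsqr_le_abs_1 _ _ (Rabs_sin_le (x / 2))) as H. unfold Rsqr in H. lra.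
Qed.

Lemma Cgamma_R_ge_1 (x : R) : 2 <= x -> 1 <= Re (Cgamma x).
Proof.
  intros Hx.
  assert (Hone : 0 < Re 1) by (simpl; lra). assert (Htwo : 0 < Re (1 + 1)%C) by (simpl; lra).
  assert (Hlin := is_RInt_gen_Cminus _ _ _ _
    (is_RInt_gen_Cmult (RtoC (x - 1)) _ _ (is_RInt_gen_Cgamma _ Htwo))
    (is_RInt_gen_Cmult (RtoC (x - 2)) _ _ (is_RInt_gen_Cgamma _ Hone))).
  rewrite Cgamma_succ, Cgamma_1 in Hlin by exact Hone.
  replace 1 with (Re (RtoC (x - 1) * (1 * 1) - RtoC (x - 2) * 1)%C) by (simpl; ring).
  refine (is_RInt_gen_Re_le _ _ _ _ at_right_0_le_p_infty _ Hlin (is_RInt_gen_Cgamma x ltac:(simpl; lra))).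
  apply (at_right_0_p_infty (fun t => Re (_ - _)%C <= Re (gamma_integrand x t))). intros t Ht.
  rewrite gamma_integrand_succ, !gamma_integrand_R by assumption.
  rewrite Rminus_diag. unfold Rpower. rewrite Rmult_0_l, exp_0. simpl.
  replace ((x - 1) * ln t) with ((x - 2) * ln t + ln t) by ring. rewrite exp_plus, exp_ln by assumption.
  assert (Hbern : (x - 1) * t - (x - 2) <= exp ((x - 2) * ln t) * t).
  { pose proof (exp_ineq1_le ((x - 2) * ln t)) as Hexp.
    assert (Hln : 1 - / t <= ln t).
    { pose proof (exp_ineq1_le (- ln t)) as Hinv. rewrite exp_Ropp, exp_ln in Hinv by assumption. lra. }
    apply Rle_trans with ((1 + (x - 2) * (1 - / t)) * t); [right; field; lra|].
    apply Rmult_le_compat_r; nra. }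
  pose proof (exp_pos (- t)). nra.
Qed.

Lemma Re_gamma_integrand_twisted (x y t : R) : 0 < t -> 0 < x ->
  Re (Cexp (0, - (y * ln x))%R * gamma_integrand (x, y) t)%C
  = Rpower t (x - 1) * exp (- t) * cos (y * ln (t / x)).
Proof.
  intros Ht Hx. unfold gamma_integrand. rewrite Cmult_assoc, <- Cexp_plus.
  replace ((0, - (y * ln x))%R + ((x, y) - 1) * ln t)%C with (((x - 1) * ln t, y * ln (t / x))%R : C).
  - unfold Cexp, Rpower. simpl. ring.
  - rewrite ln_div by assumption. apply injective_projections; simpl; ring.
Qed.

(* For [w = x + i y] the mass of [t^(x-1) e^(-t)] concentrates near [t = x], where [t^(i y)] is close
   to [x^(i y)]. *)
Lemma Cgamma_R_le_twisted (x y : R) : 2 <= x ->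
  (1 - 2 * y ^ 2 / (x - 1)) * Re (Cgamma x) <= Re (Cexp (0, - (y * ln x))%R * Cgamma (x, y))%C.
Proof.
  intros Hx. set (q := 2 * y ^ 2).
  assert (Hmid : 0 < Re x) by (simpl; lra). assert (Hpred : 0 < Re (x - 1)%C) by (simpl; lra).
  assert (Hsucc : 0 < Re (x + 1)%C) by (simpl; lra).
  assert (Hlin := is_RInt_gen_Cminus _ _ _ _
    (is_RInt_gen_Cminus _ _ _ _
      (is_RInt_gen_Cmult (RtoC (1 + 2 * q)) _ _ (is_RInt_gen_Cgamma _ Hmid))
      (is_RInt_gen_Cmult (RtoC (q / x)) _ _ (is_RInt_gen_Cgamma _ Hsucc)))
    (is_RInt_gen_Cmult (RtoC (q * x)) _ _ (is_RInt_gen_Cgamma _ Hpred))).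
  assert (Epred : Cgamma (x - 1)%C = (RtoC (/ (x - 1)) * Cgamma x)%C).
  { replace (RtoC x) with (x - 1 + 1)%C at 2 by ring. rewrite Cgamma_succ by assumption.
    rewrite <- RtoC_minus, RtoC_inv by lra. field. apply RtoC_neq_0. lra. }
  rewrite (Cgamma_succ x Hmid), Epred in Hlin.
  refine (Rle_trans _ _ _ _ (is_RInt_gen_Re_le _ _ _ _ at_right_0_le_p_infty _ Hlin
    (is_RInt_gen_Cmult (Cexp (0, - (y * ln x))%R) _ _ (is_RInt_gen_Cgamma (x, y) Hmid)))).
  - right. destruct (Cgamma x) as [g h]. simpl. field. lra.
  - apply (at_right_0_p_infty (fun t => Re (_ - _)%C <= Re (_ * gamma_integrand (x, y) t)%C)).
    intros t Ht. rewrite Re_gamma_integrand_twisted, gamma_integrand_succ, <- RtoC_minus, !gamma_integrand_R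
      by lra.
    set (k := Rpower t (x - 1) * exp (- t)). assert (Hk : 0 < k) by (apply Rmult_lt_0_compat; apply exp_pos).
    assert (Ekernel : Rpower t (x - 1 - 1) * exp (- t) = k / t).
    { unfold k, Rpower. replace ((x - 1 - 1) * ln t) with ((x - 1) * ln t + - ln t) by ring.
      rewrite exp_plus, exp_Ropp, exp_ln by assumption. field. lra. }
    rewrite Ekernel.
    apply Rle_trans with (k * (1 - q * (t / x - 2 + / (t / x)))); [right; simpl; field; lra|].
    apply Rmult_le_compat_l; [lra|].
    pose proof (cos_ge_quadratic (y * ln (t / x))) as Hcos. rewrite Rpow_mult_distr in Hcos.
    assert (Hln := ln_sqr_le (t / x) ltac:(apply Rdiv_lt_0_compat; lra)).
    unfold q. nra.
Qed.

Lemma pochhammer_neq_0 (w : C) (n : nat) : 0 < Re w -> pochhammer w n <> 0.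
Proof.
  intros Hw. induction n as [|n IH]; simpl.
  - exact C1_nz.
  - apply Cmult_neq_0; [assumption|]. apply Re_pos_neq_0. pose proof (pos_INR n).
    simpl. unfold Re in Hw. lra.
Qed.

Lemma Cgamma_neq_0 (w : C) : 0 < Re w -> Cgamma w <> 0.
Proof.
  intros Hw E. destruct (INR_unbounded (2 + 2 * Im w ^ 2)) as [n Hn].
  set (x := Re w + INR n). assert (Hx : 2 + 2 * Im w ^ 2 <= x) by (unfold x; lra).
  assert (Hx2 : 2 <= x) by (pose proof (pow2_ge_0 (Im w)); lra).
  assert (Ezero : Cgamma (x, Im w) = 0).
  { replace ((x, Im w) : C) with (w + INR n)%C.
    - rewrite Cgamma_add_INR, E by assumption. ring.
    - destruct w as [u v]. unfold x. apply injective_projections; simpl; ring. }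
  pose proof (Cgamma_R_le_twisted x (Im w) Hx2) as Hle. rewrite Ezero, Cmult_0_r in Hle.
  pose proof (Cgamma_R_ge_1 x Hx2) as Hge1.
  assert (Hfrac : 2 * Im w ^ 2 / (x - 1) < 1) by (apply Rlt_div_l; lra).
  simpl Re in Hle at 2. nra.
Qed.

Lemma Cgamma_ratio (w : C) (n : nat) : 0 < Re w ->
  (Cgamma w * Cgamma (INR (S n)) / Cgamma (w + INR (S n)))%C
  = (INR (fact n) / pochhammer w (S n))%C.
Proof.
  intros Hw. rewrite Cgamma_INR_succ, Cgamma_add_INR by assumption. field.
  split; [now apply pochhammer_neq_0 | now apply Cgamma_neq_0].
Qed.

Lemma Rpochhammer_le_Cmod_pochhammer (w : C) (n : nat) : 0 < Re w ->
  Rpochhammer (Re w) n <= Cmod (pochhammer w n).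
Proof.
  intros Hw. induction n as [|n IH]; cbn [Rpochhammer pochhammer].
  - rewrite Cmod_1. lra.
  - rewrite Cmod_mult. pose proof (Rpochhammer_pos (Re w) n Hw). pose proof (pos_INR n).
    apply Rmult_le_compat; try lra.
    eapply Rle_trans; [|apply Re_le_Cmod]. right. reflexivity.
Qed.

(** * Stirling numbers and the Borel transform *)

Lemma sum_n_csum (f : nat -> C) (n : nat) : sum_n (G := C_NormedModule) f n = csum f n.
Proof.
  induction n as [|n IH]; [now rewrite sum_O | now rewrite sum_Sn, IH].
Qed.

Lemma csum_ext (f g : nat -> C) (n : nat) : (forall k, (k <= n)%nat -> f k = g k) -> csum f n = csum g n.
Proof.
  induction n as [|n IH]; intros H; simpl; [now apply H|]. rewrite IH by auto. f_equal. now apply H.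
Qed.

Lemma csum_scal (c : C) (f : nat -> C) (n : nat) : csum (fun k => c * f k)%C n = (c * csum f n)%C.
Proof. induction n as [|n IH]; simpl; [reflexivity|]. rewrite IH. ring. Qed.

Lemma is_series_norm_le {K : AbsRing} {V : NormedModule K} (u : nat -> V) (g : nat -> R) (s : V) (m : R) :
  (forall n, norm (u n) <= g n) -> is_series u s -> is_series g m -> norm s <= m.
Proof.
  intros Hle Hu Hg.
  apply (filterlim_le (F := eventually) (fun n => norm (sum_n u n)) (sum_n g) (norm s) m).
  - apply filter_forall. intros n. unfold sum_n. eapply Rle_trans; [apply norm_sum_n_m|].
    now apply sum_n_m_le.
  - exact (filterlim_comp _ _ _ _ norm _ _ _ Hu (filterlim_norm s)).
  - exact Hg.
Qed.

Lemma power_series_remainder_le (c : nat -> C) (z s : C) (D q : R) (n : nat) :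
  (forall k, Cmod (c k) <= D * q ^ k) -> 0 <= q -> q * Cmod z <= / 2 ->
  @is_series C_AbsRing C_NormedModule (fun k => c k * z ^ k)%C s ->
  Cmod (s - csum (fun k => c k * z ^ k) n)%C <= 2 * D * (q * Cmod z) ^ S n.
Proof.
  intros Hc Hq Hz Hs. set (u := fun k => (c k * z ^ k)%C) in *. set (x := q * Cmod z) in *.
  assert (Hx : 0 <= x) by (apply Rmult_le_pos; [assumption | apply Cmod_ge_0]).
  assert (HD : 0 <= D) by (generalize (Rle_trans _ _ _ (Cmod_ge_0 _) (Hc O)); simpl; lra).
  assert (Htail : @is_series C_AbsRing C_NormedModule (fun k => u (S n + k)%nat) (s - csum u n)%C).
  { apply (is_series_incr_n (V := C_NormedModule) u); [lia|]. rewrite Nat.pred_succ, sum_n_csum.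
    change (@is_series C_AbsRing C_NormedModule u (s - csum u n + csum u n)%C).
    now replace (s - csum u n + csum u n)%C with s by ring. }
  apply Rle_trans with (D * x ^ S n * / (1 - x)).
  - apply (is_series_norm_le (V := C_NormedModule) _ (fun k => D * x ^ S n * x ^ k) _ _) with (2 := Htail).
    + intros k. unfold u. change (Cmod (c (S n + k)%nat * z ^ (S n + k)) <= D * x ^ S n * x ^ k).
      rewrite Cmod_mult, Cmod_pow, Rmult_assoc, <- pow_add. unfold x.
      rewrite Rpow_mult_distr, <- Rmult_assoc. apply Rmult_le_compat_r; [apply pow_le, Cmod_ge_0 | apply Hc].
    + apply (is_series_scal (V := R_NormedModule) (D * x ^ S n)), is_series_geom.
      rewrite Rabs_pos_eq; lra.
  - replace (2 * D * x ^ S n) with (D * x ^ S n * 2) by ring. apply Rmult_le_compat_l.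
    + apply Rmult_le_pos; [assumption | now apply pow_le].
    + replace 2 with (/ / 2) by field. apply Rinv_le_contravar; lra.
Qed.

Lemma INR_succ_le_pow2 (n : nat) : INR (S n) <= 2 ^ n.
Proof.
  replace 2 with (INR 2) by reflexivity. rewrite <- pow_INR. apply le_INR.
  apply Nat.pow_gt_lin_r. lia.
Qed.

Lemma Cmod_log_chart_le (lam : R) (v : C) : 0 < lam -> Cmod v <= / 2 ->
  Cmod (log_chart lam v) <= 2 * lam * Cmod v.
Proof.
  intros Hlam Hv. rewrite Cmod_log_chart by assumption.
  assert (Hd : open_disc 1 v) by (unfold open_disc; lra). pose proof (Cmod_ge_0 v) as Hv0.
  rewrite (Rmult_comm 2), Rmult_assoc. apply Rmult_le_compat_l; [lra|].
  eapply Rle_trans; [now apply Cmod_Clog_1m_le|].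
  rewrite <- ln_Rinv by lra. set (y := / (1 - Cmod v)).
  assert (Hy : 0 < y) by (apply Rinv_0_lt_compat; lra).
  pose proof (exp_ineq1_le (ln y)) as Hln. rewrite exp_ln in Hln by assumption.
  apply Rle_trans with (y - 1); [lra|].
  replace (y - 1) with (Cmod v / (1 - Cmod v)) by (unfold y; field; lra).
  apply Rle_div_l; nra.
Qed.

Lemma nth_padd (p q : list Z) (k : nat) : nth k (padd p q) 0%Z = (nth k p 0 + nth k q 0)%Z.
Proof.
  revert q k. induction p as [|x p IH]; intros [|y q] [|k]; simpl; try lia. apply IH.
Qed.

Lemma nth_map_mult (c : Z) (p : list Z) (k : nat) :
  nth k (map (fun x => (c * x)%Z) p) 0%Z = (c * nth k p 0)%Z.
Proof. rewrite <- (Z.mul_0_r c) at 1. apply (map_nth (fun x => (c * x)%Z)). Qed.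

Lemma stirling1_succ_0 (n : nat) : stirling1 (S n) 0 = (- Z.of_nat n * stirling1 n 0)%Z.
Proof. unfold stirling1. cbn [falling_poly]. unfold mul_X_minus. now rewrite nth_padd, nth_map_mult. Qed.

Lemma stirling1_succ_succ (n k : nat) :
  stirling1 (S n) (S k) = (stirling1 n k - Z.of_nat n * stirling1 n (S k))%Z.
Proof.
  unfold stirling1. cbn [falling_poly]. unfold mul_X_minus. rewrite nth_padd, nth_map_mult.
  cbn [nth]. lia.
Qed.

Definition unsigned_stirling1 (n k : nat) : R := (-1) ^ (n + k) * IZR (stirling1 n k).

Lemma unsigned_stirling1_succ_0 (n : nat) :
  unsigned_stirling1 (S n) 0 = INR n * unsigned_stirling1 n 0.
Proof.
  unfold unsigned_stirling1. rewrite stirling1_succ_0, mult_IZR, opp_IZR, <- INR_IZR_INZ. simpl. ring.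
Qed.

Lemma unsigned_stirling1_succ_succ (n k : nat) :
  unsigned_stirling1 (S n) (S k) = unsigned_stirling1 n k + INR n * unsigned_stirling1 n (S k).
Proof.
  unfold unsigned_stirling1. rewrite stirling1_succ_succ, minus_IZR, mult_IZR, <- INR_IZR_INZ.
  rewrite !Nat.add_succ_r. simpl. ring.
Qed.

Lemma is_derive_log_chart_pow (lam : R) (j : nat) (v : C) : open_disc 1 v ->
  is_derive (fun v => log_chart lam v ^ j)%C v
    (RtoC (INR j * lam) * log_chart lam v ^ pred j / (1 - v))%C.
Proof.
  intros Hv. destruct j as [|j].
  - evar_last; [exact (is_derive_Cconst 1 v)|]. rewrite Rmult_0_l. unfold Cdiv. ring.
  - evar_last; [exact (is_derive_Cpow _ v _ j (is_derive_log_chart lam v Hv))|].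
    rewrite RtoC_mult, Nat.pred_succ. unfold Cdiv. ring.
Qed.

Lemma holomorphic_log_chart_pow (lam : R) (j : nat) :
  holomorphic_on (open_disc 1) (fun v => log_chart lam v ^ j)%C.
Proof. apply holomorphic_on_pow, holomorphic_log_chart. Qed.

Lemma taylor_coeff_log_chart_pow (lam r : R) (n j : nat) : 0 < r < 1 ->
  taylor_coeff (fun v => log_chart lam v ^ j)%C r n
  = RtoC (lam ^ j * INR (fact j) / INR (fact n) * unsigned_stirling1 n j).
Proof.
  intros Hr. revert j. induction n as [|n IH]; intros j.
  - rewrite (taylor_coeff_0 _ 1), log_chart_0 by (apply holomorphic_log_chart_pow || assumption).
    unfold unsigned_stirling1. destruct j as [|j].
    + simpl. f_equal. change (stirling1 0 0) with 1%Z. field.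
    + rewrite Cpow_S, Cmult_0_l. replace (stirling1 0 (S j)) with 0%Z by now destruct j. f_equal. ring.
  - assert (Hn : INR (S n) <> 0) by (apply not_0_INR; lia). pose proof (INR_fact_neq_0 n) as Hfn.
    apply (Cmult_reg_l (INR (S n))); [now apply RtoC_neq_0|].
    rewrite (taylor_coeff_recurrence _
      (fun v => - RtoC (INR j * lam) * log_chart lam v ^ pred j)%C 0).
    + rewrite (taylor_coeff_scal _ 1) by (apply holomorphic_log_chart_pow || assumption).
      rewrite !IH, Cplus_0_l, <- RtoC_opp, <- !RtoC_mult, <- RtoC_minus. f_equal.
      rewrite fact_simpl, mult_INR. destruct j as [|j].
      * rewrite unsigned_stirling1_succ_0. change (INR 0) with 0. field. now split.
      * rewrite unsigned_stirling1_succ_succ, Nat.pred_succ, fact_simpl, mult_INR. simpl pow.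
        field. now split.
    + intros v Hv. evar_last; [now apply is_derive_log_chart_pow|].
      f_equal. ring.
    + apply holomorphic_on_mult; [apply holomorphic_on_const | apply holomorphic_log_chart_pow].
    + assumption.
Qed.

Lemma holomorphic_csum (U : C -> Prop) (f : nat -> C -> C) (n : nat) :
  (forall k, holomorphic_on U (f k)) -> holomorphic_on U (fun v => csum (fun k => f k v) n).
Proof.
  intros Hf. induction n as [|n IH]; [apply Hf|]. simpl. now apply holomorphic_on_plus.
Qed.

Lemma taylor_coeff_csum (f : nat -> C -> C) (rho r : R) (m n : nat) :
  (forall k, holomorphic_on (open_disc rho) (f k)) -> 0 < r < rho ->
  taylor_coeff (fun v => csum (fun k => f k v) m) r n = csum (fun k => taylor_coeff (f k) r n) m.
Proof.
  intros Hf Hr. induction m as [|m IH]; [reflexivity|]. simpl. rewrite <- IH.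
  apply (taylor_coeff_plus _ (f (S m)) rho); [now apply holomorphic_csum | apply Hf | assumption].
Qed.

Definition borel_coeff (a : nat -> C) (k : nat) : C := (a (S k) / INR (fact k))%C.

Lemma Gevrey1_borel_coeff (a : nat -> C) : Gevrey1 a -> exists D q, 0 <= q /\
  forall k, Cmod (borel_coeff a k) <= D * q ^ k.
Proof.
  intros (Cc & K & Ha). exists (Rabs (Cc * K)), (2 * Rabs K).
  split; [pose proof (Rabs_pos K); lra|]. intros k. unfold borel_coeff.
  pose proof (INR_fact_lt_0 k) as Hk.
  rewrite Cmod_div, Cmod_R, Rabs_pos_eq by (lra || (apply RtoC_neq_0; lra)).
  apply Rle_div_l; [assumption|]. eapply Rle_trans; [apply Ha|].
  eapply Rle_trans; [apply Rle_abs|].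
  rewrite fact_simpl, mult_INR, !Rabs_mult, (Rabs_pos_eq (INR (S k))), (Rabs_pos_eq (INR (fact k)))
    by (lra || apply pos_INR).
  rewrite <- RPow_abs, Rpow_mult_distr. simpl pow at 1. pose proof (INR_succ_le_pow2 k) as Hpow2.
  replace (Rabs Cc * (Rabs K * Rabs K ^ k) * (INR (S k) * INR (fact k)))
    with (Rabs Cc * Rabs K * Rabs K ^ k * INR (fact k) * INR (S k)) by ring.
  replace (Rabs Cc * Rabs K * (2 ^ k * Rabs K ^ k) * INR (fact k))
    with (Rabs Cc * Rabs K * Rabs K ^ k * INR (fact k) * 2 ^ k) by ring.
  apply Rmult_le_compat_l; [|assumption].
  repeat apply Rmult_le_pos; try apply Rabs_pos; [apply pow_le, Rabs_pos | lra].
Qed.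

Section BorelLogChart.

Variables (a : nat -> C) (F : C -> C) (lam : R).
Hypothesis gevrey_a : Gevrey1 a.
Hypothesis lam_pos : 0 < lam.
Hypothesis series_F : exists d, 0 < d /\ forall y, Cmod y < d ->
  @is_series C_AbsRing C_NormedModule (borel_term a y) (F y).

Lemma borel_log_chart_remainder (n : nat) : exists M d, 0 < d /\ forall v, Cmod v < d ->
  Cmod (F (log_chart lam v) - csum (fun k => borel_coeff a k * log_chart lam v ^ k) n)%C
  <= M * Cmod v ^ S n.
Proof.
  destruct series_F as (d & Hd & HF). destruct (Gevrey1_borel_coeff a gevrey_a) as (D & q & Hq & Hcoeff).
  assert (HD : 0 <= D) by (generalize (Rle_trans _ _ _ (Cmod_ge_0 _) (Hcoeff O)); simpl; lra).
  exists (2 * D * (q * (2 * lam)) ^ S n), (Rmin (/ 2) (Rmin (d / (2 * lam)) (/ (4 * lam * (q + 1))))).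
  split; [repeat apply Rmin_pos; try apply Rinv_0_lt_compat; try apply Rdiv_lt_0_compat; nra|].
  intros v Hv. apply Rmin_Rgt in Hv. destruct Hv as [Hvhalf Hv].
  apply Rmin_Rgt in Hv. destruct Hv as [Hvd Hvq].
  assert (Hchart : Cmod (log_chart lam v) <= 2 * lam * Cmod v) by (apply Cmod_log_chart_le; lra).
  assert (Hd' : Cmod v * (2 * lam) < d) by (apply Rlt_div_r; [lra | exact Hvd]).
  assert (Hq' : Cmod v * (4 * lam * (q + 1)) < 1).
  { apply Rlt_div_r; [nra|]. unfold Rdiv. rewrite Rmult_1_l. exact Hvq. }
  replace (2 * D * (q * (2 * lam)) ^ S n * Cmod v ^ S n) with (2 * D * (q * (2 * lam * Cmod v)) ^ S n)
    by (rewrite (Rmult_assoc (2 * D)), <- Rpow_mult_distr; do 2 f_equal; ring).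
  eapply Rle_trans; [apply (power_series_remainder_le (borel_coeff a) _ _ D q n Hcoeff Hq)|].
  - apply Rle_trans with (q * (2 * lam * Cmod v)); [now apply Rmult_le_compat_l | nra].
  - apply (is_series_ext (borel_term a (log_chart lam v))); [|apply HF; lra].
    intros k. unfold borel_term, borel_coeff, Cdiv. C_ring.
  - apply Rmult_le_compat_l; [lra|]. apply pow_incr.
    split; [apply Rmult_le_pos; [assumption | apply Cmod_ge_0] | now apply Rmult_le_compat_l].
Qed.

Lemma taylor_coeff_borel_log_chart (r : R) (n : nat) : 0 < r < 1 ->
  holomorphic_on (open_disc 1) (fun v => F (log_chart lam v)) ->
  taylor_coeff (fun v => F (log_chart lam v)) r n = b_lam lam a n.
Proof.
  intros Hr HG. destruct (borel_log_chart_remainder n) as (M & d & Hd & HM).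
  set (p := fun k v => (borel_coeff a k * log_chart lam v ^ k)%C).
  assert (Hp : forall k, holomorphic_on (open_disc 1) (p k)).
  { intros k. apply holomorphic_on_mult; [apply holomorphic_on_const | apply holomorphic_log_chart_pow]. }
  rewrite (taylor_coeff_eq_near _ (fun v => csum (fun k => p k v) n) 1 r HG (holomorphic_csum _ p n Hp)
    Hr M d n Hd HM).
  rewrite (taylor_coeff_csum p 1) by assumption.
  unfold b_lam. rewrite <- csum_scal. apply csum_ext. intros k Hk. unfold p, borel_coeff.
  rewrite (taylor_coeff_scal _ 1), taylor_coeff_log_chart_pow
    by (apply holomorphic_log_chart_pow || assumption).
  unfold unsigned_stirling1. replace (n + k)%nat with (n - k + 2 * k)%nat by lia.
  rewrite pow_add, pow_1_even, Rmult_1_r, !RtoC_mult, RtoC_div, RtoC_mult by apply INR_fact_neq_0.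
  field. split; apply RtoC_neq_0, INR_fact_neq_0.
Qed.

End BorelLogChart.

(** * The factorial series *)

Lemma fact_term_pochhammer (lam : R) (a : nat -> C) (z : C) (n : nat) : 0 < Re (lam * z)%C ->
  fact_term lam a z n = (lam * b_lam lam a n * INR (fact n) / pochhammer (lam * z) (S n))%C.
Proof.
  intros Hw. unfold fact_term.
  transitivity (lam * b_lam lam a n
    * (Cgamma (lam * z) * Cgamma (INR (S n)) / Cgamma (lam * z + INR (S n))))%C.
  - unfold Cdiv. ring.
  - rewrite Cgamma_ratio by assumption. unfold Cdiv. ring.
Qed.

(* The radius [r] minimises [r ^ - n * (1 - r) ^ - b]. *)
Lemma optimal_radius_value (b : R) (n : nat) : 0 < b -> (0 < n)%nat ->
  let r := INR n / (INR n + b) in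
  (/ r) ^ n * Rpower (1 - r) (- b) = Rpower (INR n + b) (INR n + b) / (Rpower b b * INR n ^ n).
Proof.
  intros Hb Hn r. apply lt_0_INR in Hn. set (m := INR n) in *. set (q := m + b).
  assert (Hq : 0 < q) by (unfold q; lra). assert (Hm : 0 < m ^ n) by now apply pow_lt.
  assert (Hbb : 0 < Rpower b b) by apply exp_pos.
  replace (Rpower q q) with (q ^ n * Rpower q b).
  2: { unfold q at 4. rewrite Rpower_plus. f_equal. symmetry. now apply Rpower_pow. }
  replace (Rpower (1 - r) (- b)) with (Rpower q b / Rpower b b).
  - replace (/ r) with (q / m) by (unfold r, q; field; unfold q in Hq; lra).
    unfold Rdiv. rewrite Rpow_mult_distr, pow_inv. field. lra.
  - replace (1 - r) with (b / q) by (unfold r, q; field; unfold q in Hq; lra).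
    unfold Rpower. rewrite ln_div by assumption.
    replace (- b * (ln b - ln q)) with (b * ln q + - (b * ln b)) by ring.
    now rewrite exp_plus, exp_Ropp.
Qed.

Lemma R_fact_pochhammer (lam A B : R) (N : nat) (z : C) : 0 < lam -> 0 < B -> B < Re z ->
  let r := INR (S N) / (INR (S N) + lam * B) in
  R_fact lam A B N z = (/ r) ^ S N * (A / (Re z - B) * Rpower (1 - r) (- (lam * B)))
    * (INR (fact (S N)) / Cmod (pochhammer (lam * z) (S N))).
Proof.
  intros Hlam HB Hz r. assert (Hb : 0 < lam * B) by now apply Rmult_lt_0_compat.
  assert (Hw : 0 < Re (lam * z)%C) by (rewrite re_scal_l; apply Rmult_lt_0_compat; lra).
  assert (HwN : 0 < Re (lam * z + INR (S N))%C).
  { pose proof (pos_INR (S N)). simpl in *. unfold Re in *. lra. }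
  assert (Hd : RtoC (Re z - B) <> 0) by (apply RtoC_neq_0; lra).
  assert (Hp : 0 < Cmod (pochhammer (lam * z) (S N))) by now apply Cmod_gt_0, pochhammer_neq_0.
  assert (Egamma : Cmod (Cgamma (lam * z) * Cgamma (INR (S N))
      / (Cgamma (lam * z + INR (S N)) * RtoC (Re z - B)))%C
    = INR (fact N) / Cmod (pochhammer (lam * z) (S N)) / (Re z - B)).
  { replace (Cgamma (lam * z) * Cgamma (INR (S N)) / (Cgamma (lam * z + INR (S N)) * RtoC (Re z - B)))%C
      with (INR (fact N) / pochhammer (lam * z) (S N) / RtoC (Re z - B))%C.
    - now rewrite !Cmod_div, !Cmod_R, !Rabs_pos_eq
        by (lra || apply pos_INR || assumption || now apply pochhammer_neq_0).
    - rewrite <- Cgamma_ratio by assumption. field. split; [assumption | now apply Cgamma_neq_0]. }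
  unfold R_fact. rewrite Egamma.
  replace (INR N + lam * B + 1) with (INR (S N) + lam * B) by (rewrite S_INR; ring).
  replace (INR N + 1) with (INR (S N)) by now rewrite S_INR.
  transitivity ((/ r) ^ S N * Rpower (1 - r) (- (lam * B)) * (A / (Re z - B))
    * (INR (fact (S N)) / Cmod (pochhammer (lam * z) (S N)))); [|ring].
  unfold r. rewrite optimal_radius_value by (assumption || lia).
  rewrite fact_simpl, mult_INR. assert (HN : 0 < INR (S N)) by (apply lt_0_INR; lia).
  assert (Hpow : INR (S N) ^ N <> 0) by (apply pow_nonzero; lra).
  assert (Hbb : Rpower (lam * B) (lam * B) <> 0) by apply Rgt_not_eq, exp_pos.
  cbn [pow]. field. repeat split; lra.
Qed.

Section FactorialSeries.

Variables (a : nat -> C) (F : C -> C) (lam A B : R) (z : C).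
Hypothesis gevrey_a : Gevrey1 a.
Hypothesis lam_pos : 0 < lam.
Hypothesis A_pos : 0 < A.
Hypothesis B_pos : 0 < B.
Hypothesis holo_F : holomorphic_on (Delta_lam lam) F.
Hypothesis series_F : exists r, 0 < r /\ forall y, Cmod y < r ->
  @is_series C_AbsRing C_NormedModule (borel_term a y) (F y).
Hypothesis exp_bound_F : forall y, Delta_lam lam y -> Cmod (F y) <= A * exp (B * Cmod y).
Hypothesis z_large : B < Re z.

Let w : C := (lam * z)%C.

Let laplace_coeff (n : nat) : C := taylor_coeff (laplace_ray F lam z) (/ 2) n.

Lemma Re_w_pos : 0 < Re w.
Proof. unfold w. rewrite re_scal_l. apply Rmult_lt_0_compat; lra. Qed.

Lemma laplace_coeff_recurrence (n : nat) :
  (INR (S n) * laplace_coeff (S n) = (w + INR n) * laplace_coeff n - lam * b_lam lam a n)%C.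
Proof.
  assert (HG := holomorphic_comp_log_chart F lam holo_F).
  unfold laplace_coeff.
  rewrite (taylor_coeff_recurrence _ (fun v => lam * F (log_chart lam v))%C w).
  - now rewrite (taylor_coeff_scal _ 1), (taylor_coeff_borel_log_chart a) by (assumption || lra).
  - intros v Hv. now apply (is_derive_laplace_ray F lam A B z).
  - apply holomorphic_on_mult; [apply holomorphic_on_const | exact HG].
  - lra.
Qed.

Lemma borel_sum_laplace_coeff : borel_sum a F z = (a O + laplace_coeff 0)%C.
Proof.
  unfold borel_sum, laplace_coeff. f_equal.
  rewrite (taylor_coeff_0 _ 1) by (now apply (holomorphic_laplace_ray F lam A B z) || lra).
  apply (is_RInt_gen_unique (V := C_R_CompleteNormedModule)).
  now apply (is_RInt_gen_laplace_ray_0 F lam A B).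
Qed.

Lemma fact_term_telescope (n : nat) :
  fact_term lam a z n = (INR (fact n) * laplace_coeff n / pochhammer w n
    - INR (fact (S n)) * laplace_coeff (S n) / pochhammer w (S n))%C.
Proof.
  pose proof Re_w_pos as Hw. rewrite fact_term_pochhammer by assumption. fold w.
  rewrite fact_simpl, mult_INR, RtoC_mult.
  transitivity (INR (fact n) * laplace_coeff n / pochhammer w n
    - INR (fact n) * (INR (S n) * laplace_coeff (S n)) / pochhammer w (S n))%C.
  - rewrite laplace_coeff_recurrence. cbn [pochhammer]. field.
    split; [|now apply pochhammer_neq_0].
    apply Re_pos_neq_0. pose proof (pos_INR n). simpl. unfold Re in Hw. simpl in Hw. lra.
  - unfold Cdiv. ring.
Qed.

Lemma borel_remainder (N : nat) :
  (borel_sum a F z - (a O + csum (fact_term lam a z) N))%C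
  = (INR (fact (S N)) * laplace_coeff (S N) / pochhammer w (S N))%C.
Proof.
  rewrite borel_sum_laplace_coeff. set (u n := (INR (fact n) * laplace_coeff n / pochhammer w n)%C).
  assert (Hu0 : u O = laplace_coeff 0) by (unfold u; simpl; field).
  assert (Hsum : csum (fact_term lam a z) N = (u O - u (S N))%C).
  { induction N as [|N IH]; [apply fact_term_telescope|].
    cbn [csum]. rewrite IH, fact_term_telescope. fold (u (S N)) (u (S (S N))). ring. }
  rewrite Hsum, Hu0. fold (u (S N)). ring.
Qed.

Lemma Cmod_borel_remainder (N : nat) :
  Cmod (borel_sum a F z - (a O + csum (fact_term lam a z) N))%C
  = Cmod (laplace_coeff (S N)) * (INR (fact (S N)) / Cmod (pochhammer w (S N))).
Proof.
  rewrite borel_remainder, Cmod_div, Cmod_mult, Cmod_R, Rabs_pos_eq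
    by (apply pos_INR || apply pochhammer_neq_0, Re_w_pos).
  unfold Rdiv. ring.
Qed.

Lemma borel_remainder_le_R_fact (N : nat) :
  Cmod (borel_sum a F z - (a O + csum (fact_term lam a z) N))%C <= R_fact lam A B N z.
Proof.
  rewrite Cmod_borel_remainder, R_fact_pochhammer by assumption. fold w.
  assert (Hb : 0 < lam * B) by now apply Rmult_lt_0_compat.
  assert (HN : 0 < INR (S N)) by (apply lt_0_INR; lia).
  apply Rmult_le_compat_r.
  - apply Rdiv_le_0_compat; [apply pos_INR | apply Cmod_gt_0, pochhammer_neq_0, Re_w_pos].
  - apply (taylor_coeff_log_growth _ (lam * B)).
    + now apply (holomorphic_laplace_ray F lam A B z).
    + now apply log_growth_laplace_ray.
    + assumption.
    + apply Rdiv_le_0_compat; lra.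
    + split; [apply Rdiv_lt_0_compat; lra | apply Rlt_div_l; lra].
    + lra.
Qed.

Hypothesis z_gt_inv_lam : / lam < Re z.

Let x : R := lam * Re z.

Lemma growth_exponent : exists c, 1 < c < x /\ lam * B <= c.
Proof.
  assert (Hx1 : 1 < x).
  { unfold x. rewrite <- (Rinv_r lam) by lra. now apply Rmult_lt_compat_l. }
  assert (HxB : lam * B < x) by (apply Rmult_lt_compat_l; assumption).
  assert (Hmax : Rmax 1 (lam * B) < x) by now apply Rmax_lub_lt.
  pose proof (Rmax_l 1 (lam * B)). pose proof (Rmax_r 1 (lam * B)).
  exists ((Rmax 1 (lam * B) + x) / 2). lra.
Qed.

Lemma Rpochhammer_le_Cmod_pochhammer_w (n : nat) : 0 < Rpochhammer x n <= Cmod (pochhammer w n).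
Proof.
  assert (Ex : x = Re w) by (unfold x, w; now rewrite re_scal_l).
  pose proof Re_w_pos. rewrite Ex.
  split; [now apply Rpochhammer_pos | now apply Rpochhammer_le_Cmod_pochhammer].
Qed.

Lemma ex_series_Cmod_fact_term : ex_series (fun n => Cmod (fact_term lam a z n)).
Proof.
  destruct growth_exponent as (c & Hc & HcB).
  assert (Hb : 0 < lam * B) by now apply Rmult_lt_0_compat.
  assert (HG := holomorphic_comp_log_chart F lam holo_F).
  destruct (taylor_coeff_le_Rpochhammer _ (lam * B) A HG
    (log_growth_comp_log_chart F lam A B lam_pos exp_bound_F) Hb (Rlt_le _ _ A_pos) c (proj1 Hc) HcB)
    as (M & HM & Hcoeff).
  apply (ex_series_le (V := R_CompleteNormedModule) _
    (fun n => scal (lam * M) (Rpochhammer c n / Rpochhammer x (S n)))).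
  2: { apply (ex_series_scal (V := R_NormedModule)), ex_series_Rpochhammer_ratio. lra. }
  intros n. specialize (Hcoeff (/ 2) n ltac:(lra)).
  rewrite (taylor_coeff_borel_log_chart a) in Hcoeff by (assumption || lra).
  destruct (Rpochhammer_le_Cmod_pochhammer_w (S n)) as [Hx Hxw]. pose proof (INR_fact_lt_0 n) as Hfact.
  rewrite fact_term_pochhammer by exact Re_w_pos. fold w.
  change (Rabs (Cmod (lam * b_lam lam a n * INR (fact n) / pochhammer w (S n))%C)
    <= lam * M * (Rpochhammer c n / Rpochhammer x (S n))).
  rewrite Rabs_pos_eq, Cmod_div, !Cmod_mult, !Cmod_R, !Rabs_pos_eq
    by (lra || apply Cmod_ge_0 || apply pochhammer_neq_0, Re_w_pos).
  apply Rle_trans with (lam * (M * (Rpochhammer c n / INR (fact n))) * INR (fact n) * / Rpochhammer x (S n)).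
  - apply Rmult_le_compat.
    + repeat apply Rmult_le_pos; lra || apply Cmod_ge_0.
    + apply Rlt_le, Rinv_0_lt_compat. lra.
    + apply Rmult_le_compat_r; [lra|]. apply Rmult_le_compat_l; lra.
    + now apply Rinv_le_contravar.
  - right. field. lra.
Qed.

Lemma borel_remainder_vanishes :
  is_lim_seq (fun N => Cmod (borel_sum a F z - (a O + csum (fact_term lam a z) N))%C) 0.
Proof.
  destruct growth_exponent as (c & Hc & HcB).
  assert (Hb : 0 < lam * B) by now apply Rmult_lt_0_compat.
  assert (HA : 0 <= A / (Re z - B)) by (apply Rdiv_le_0_compat; lra).
  destruct (taylor_coeff_le_Rpochhammer (laplace_ray F lam z) (lam * B) (A / (Re z - B))
    (holomorphic_laplace_ray F lam A B z lam_pos A_pos B_pos z_large holo_F exp_bound_F)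
    (log_growth_laplace_ray F lam A B z lam_pos A_pos B_pos z_large holo_F exp_bound_F)
    Hb HA c (proj1 Hc) HcB) as (M & HM & Hcoeff).
  apply (is_lim_seq_le_le (fun _ => 0) _ (fun N => M * (Rpochhammer c (S N) / Rpochhammer x (S N)))).
  - intros N. split; [apply Cmod_ge_0|]. rewrite Cmod_borel_remainder.
    destruct (Rpochhammer_le_Cmod_pochhammer_w (S N)) as [Hx Hxw]. pose proof (INR_fact_lt_0 (S N)) as Hfact.
    apply Rle_trans with (M * (Rpochhammer c (S N) / INR (fact (S N)))
      * (INR (fact (S N)) / Rpochhammer x (S N))).
    + apply Rmult_le_compat; [apply Cmod_ge_0 | | apply Hcoeff; lra |].
      * apply Rdiv_le_0_compat; lra.
      * apply Rmult_le_compat_l; [lra | now apply Rinv_le_contravar].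
    + right. field. lra.
  - apply is_lim_seq_const.
  - replace (Finite 0) with (Rbar_mult M 0) by (simpl; f_equal; ring). apply is_lim_seq_scal_l.
    apply -> (is_lim_seq_incr_1 (fun N => Rpochhammer c N / Rpochhammer x N)).
    apply Rpochhammer_ratio_vanishes. lra.
Qed.

Lemma is_series_fact_term :
  @is_series C_AbsRing C_NormedModule (fact_term lam a z) (borel_sum a F z - a O)%C.
Proof.
  apply (filterlim_Cmod (Fi := eventually)). intros e He.
  generalize (proj2 (is_lim_seq_spec _ _) borel_remainder_vanishes (mkposreal e He)).
  apply filter_imp. intros N. cbn [pos]. rewrite Rminus_0_r, Rabs_pos_eq by apply Cmod_ge_0.
  rewrite sum_n_csum, <- Cmod_opp.
  now replace (- (borel_sum a F z - (a O + csum (fact_term lam a z) N)))%C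
    with (csum (fact_term lam a z) N - (borel_sum a F z - a O))%C by ring.
Qed.

End FactorialSeries.

Theorem theorem3p2 (a : nat -> C) (F : C -> C) (lam A B : R) :
  Gevrey1 a ->
  0 < lam -> 0 < A -> 0 < B ->
  (* F is holomorphic on Delta_lambda *)
  (forall zeta : C, Delta_lam lam zeta -> @ex_derive C_AbsRing C_NormedModule F zeta) ->
  (* F extends the Borel transform (agrees with its series near 0) *)
  (exists r : R, 0 < r /\ forall zeta : C, Cmod zeta < r ->
      @is_series C_AbsRing C_NormedModule (borel_term a zeta) (F zeta)) ->
  (* exponential bound on Delta_lambda *)
  (forall zeta : C, Delta_lam lam zeta -> Cmod (F zeta) <= A * exp (B * Cmod zeta)) ->
  (* (i) *)
  (forall z : C, Rmax B (/ lam) < Re z ->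
     @ex_RInt_gen C_R_NormedModule (laplace_integrand F z) (at_point 0) (Rbar_locally p_infty)
     /\ ex_series (fun n => Cmod (fact_term lam a z n))
     /\ @is_series C_AbsRing C_NormedModule (fact_term lam a z) (borel_sum a F z - a O)%C)
  /\
  (* (ii) *)
  (forall (N : nat) (z : C), B < Re z ->
     @ex_RInt_gen C_R_NormedModule (laplace_integrand F z) (at_point 0) (Rbar_locally p_infty)
     /\ Cmod (borel_sum a F z - (a O + csum (fact_term lam a z) N))%C
          <= R_fact lam A B N z).
Proof.
  intros Ha Hlam HA HB HF Hser Hexp.
  assert (Hconv : forall z, B < Re z ->
    @ex_RInt_gen C_R_NormedModule (laplace_integrand F z) (at_point 0) (Rbar_locally p_infty)).
  { intros z Hz. exists (laplace_ray F lam z 0). now apply (is_RInt_gen_laplace_ray_0 F lam A B). }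
  split.
  - intros z Hz. apply Rmax_Rlt in Hz. destruct Hz as [HzB Hzl]. split; [now apply Hconv|]. split.
    + now apply (ex_series_Cmod_fact_term a F lam A B).
    + now apply (is_series_fact_term a F lam A B).
  - intros N z Hz. split; [now apply Hconv | now apply borel_remainder_le_R_fact].
Qed.
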